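(* Let $A$ and $B$ be $C^*$-algebras, and let $E$ be a $C^*$-correspondence from $A$ to $B$. If the action of $A$ on $E$ is through $B$-compact operators, then the operator $B$-$A$-bimodule $E^*$ is left adjoint to $E$; that is, there is an isomorphism (bijection) $$\mathrm{CB}_B(E^*\otimes_{hA}X,\,Y)\;\cong\;\mathrm{CB}_A(X,\,E\otimes_{hB}Y),$$ natural in $X$ and $Y$, as $X$ ranges over all left operator $A$-modules and $Y$ over all left operator $B$-modules.
   Context: An operator space is a complex vector space $X$ with a Banach space norm on each $M_n(X)$ such that $\|axb\|\le\|a\|\|x\|\|b\|$ for $x\in M_n(X)$, $a,b\in M_n(\mathbb C)$, and the norm of a block-diagonal matrix is the maximum of the norms of the diagonal blocks. A linear map $T:X\to Y$ is completely bounded (c.b.) if the entrywise maps $M_n(T):M_n(X)\to M_n(Y)$ satisfy $\sup_n\|M_n(T)\|<\infty$, and completely contractive if each $M_n(T)$ is contractive. A bilinear map $\Phi:X\times Y\to Z$ is completely contractive if each map $([x_{ij}],[y_{ij}])\mapsto[\sum_k\Phi(x_{ik},y_{kj})]$ has norm at most $1$. The Haagerup tensor product $X\otimes_hY$ is the completion of the algebraic tensor product, and operator space, through which every completely contractive bilinear map $X\times Y\to Z$ factors uniquely as a completely contractive linear map. A left operator module over a $C^*$-algebra $A$ is an operator space $X$ that is a nondegenerate left $A$-module ($A\cdot X$ dense in $X$) whose action extends to a completely contractive map $A\otimes_hX\to X$; right operator modules and operator bimodules are defined similarly. $\mathrm{CB}_A(X,X')$ denotes the completely bounded $A$-module maps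 $X\to X'$. These are the morphisms with respect to which naturality is understood. For a right operator $B$-module $X$ and a left operator $B$-module $Y$, the balanced Haagerup tensor product $X\otimes_{hB}Y$ is the completion of the algebraic tensor product over $B$, and operator space, such that every completely contractive bilinear $\Phi:X\times Y\to Z$ with $\Phi(xb,y)=\Phi(x,by)$ extends to a completely contractive map $X\otimes_{hB}Y\to Z$. If $X$ is an operator $A$-$B$-bimodule, then $X\otimes_{hB}Y$ is a left operator $A$-module. A right Hilbert $C^*$-$B$-module $E$ is an operator space by regarding $M_n(E)$ as a Hilbert $C^*$-module over $M_n(B)$ with inner product $\langle[e_{ij}],[f_{ij}]\rangle=[\sum_k\langle e_{ki},f_{kj}\rangle]$. A $C^*$-correspondence from $A$ to $B$ is a right Hilbert $C^*$-$B$-module $E$ with a nondegenerate left action of $A$ given by a $*$-homomorphism from $A$ to the bounded adjointable operators on $E$; it is an operator $A$-$B$-bimodule. The $B$-compact operators on $E$ are the elements of the closed linear span of the operators $e\mapsto e_1\langle e_2,e\rangle$, $e_1,e_2\in E$. The adjoint $E^*$ of $E$ is the complex conjugate vector space with norms $\|[e_{ij}]\|_{M_n(E^* )}=\|[e_{ji}]\|_{M_n(E)}$, made into an operator $B$-$A$-bimodule by $b\cdot e^*\cdot a=(a^*\cdot e\cdot b^* )^*$. *)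

(* Defs.v *)
From HB Require Import structures.
From mathcomp Require Import all_boot all_order all_algebra.
From mathcomp Require Import complex.
From mathcomp Require Import all_classical all_reals all_analysis.

Set Implicit Arguments.
Unset Strict Implicit.
Unset Printing Implicit Defensive.

Import Order.TTheory GRing.Theory Num.Theory.
Import numFieldNormedType.Exports.
Local Open Scope classical_set_scope.
Local Open Scope ring_scope.

(** * Norms, matrices, bilinear maps *)

Section Basics.
Variable R : realType.
Local Notation C := R[i].

Definition norm_complete (V : zmodType) (N : V -> R) : Prop :=
  forall u : nat -> V,
    (forall e : R, 0 < e -> exists n0 : nat, forall m n : nat,
       (n0 <= m)%N -> (n0 <= n)%N -> N (u m - u n) < e) ->
    exists l : V, N (u n - l) @[n --> \oo] --> (0 : R).

(* The scalar action is an argument because 'M[V]_n carries no canonical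
   module structure over C when V is only a C-module. *)
Definition is_banach_norm (V : zmodType) (scale : C -> V -> V) (N : V -> R)
    : Prop :=
  [/\ forall x, N x = 0 -> x = 0,
      forall x y, N (x + y) <= N x + N y,
      forall c x, N (scale c x) = Normc.normc c * N x
    & norm_complete N].

Definition is_bilinear (U V W : lmodType C) (Phi : U -> V -> W) : Prop :=
  (forall u, linear (Phi u)) /\ (forall v, linear (Phi^~ v)).

Definition mxbil (U V : Type) (W : zmodType) (Phi : U -> V -> W) (n : nat)
    (x : 'M[U]_n) (y : 'M[V]_n) : 'M[W]_n :=
  \matrix_(i, j) \sum_(k < n) Phi (x i k) (y k j).

Definition mxscale (V : lmodType C) (n : nat) (c : C) (x : 'M[V]_n)
    : 'M[V]_n := map_mx ( *:%R c) x.

(* The linear span of S is dense for N. *)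
Definition total_set (V : lmodType C) (N : V -> R) (S : set V) : Prop :=
  forall (v : V) (e : R), 0 < e ->
    exists (n : nat) (c : 'I_n -> C) (s : 'I_n -> V),
      (forall i, S (s i)) /\ N (v - \sum_(i < n) c i *: s i) < e.

Definition l2norm (n : nat) (v : 'cV[C]_n) : R :=
  Num.sqrt (\sum_(i < n) Normc.normc (v i 0) ^+ 2).

Definition mxopnorm (n : nat) (a : 'M[C]_n) : R :=
  sup [set l2norm (a *m v) | v in [set v | l2norm v <= 1]].

End Basics.

(** * Operator spaces *)

(* A complex vector space X with an arbitrary nonnegative function on each
   M_n(X); is_operator_space below adds the axioms. *)
Record matNormed (R : realType) := MatNormed {
  mn_car :> lmodType R[i];
  mn_norm : forall n : nat, 'M[mn_car]_n -> R;
  mn_ge0 : forall (n : nat) (x : 'M[mn_car]_n), 0 <= mn_norm x }.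

Section OperatorSpaces.
Variable R : realType.
Local Notation C := R[i].

Definition norm1 (X : matNormed R) (x : X) : R :=
  mn_norm (const_mx x : 'M[X]_1).

Definition is_operator_space (X : matNormed R) : Prop :=
  [/\ forall n, is_banach_norm (@mxscale R X n) (@mn_norm R X n),
      forall n (a b : 'M[C]_n) (x : 'M[X]_n),
        mn_norm (mxbil (fun y c => c *: y) (mxbil *:%R a x) b)
          <= mxopnorm a * mn_norm x * mxopnorm b
    & forall m n (x : 'M[X]_m) (y : 'M[X]_n),
        mn_norm (block_mx x 0 0 y) = Num.max (mn_norm x) (mn_norm y)].

Definition completely_bounded (X Y : matNormed R) (T : X -> Y) : Prop :=
  exists c : R, forall (n : nat) (x : 'M[X]_n),
    mn_norm (map_mx T x) <= c * mn_norm x.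

Definition completely_contractive (X Y : matNormed R) (T : X -> Y) : Prop :=
  forall (n : nat) (x : 'M[X]_n), mn_norm (map_mx T x) <= mn_norm x.

Definition completely_contractive2 (X Y Z : matNormed R)
    (Phi : X -> Y -> Z) : Prop :=
  forall (n : nat) (x : 'M[X]_n) (y : 'M[Y]_n),
    mn_norm (mxbil Phi x y) <= mn_norm x * mn_norm y.

End OperatorSpaces.

Record operatorSpace (R : realType) := OperatorSpace {
  os_mn :> matNormed R;
  os_axioms : is_operator_space os_mn }.

(** * C*-algebras, not necessarily unital *)

Definition is_cstar_norm (R : realType) (V : zmodType)
    (scale : R[i] -> V -> V) (mul : V -> V -> V) (star : V -> V)
    (N : V -> R) : Prop :=
  [/\ is_banach_norm scale N,
      forall a b, N (mul a b) <= N a * N b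
    & forall a, N (mul (star a) a) = N a ^+ 2].

Record cstarAlgebra (R : realType) := CstarAlgebra {
  cs_car :> lmodType R[i];
  cs_mul : cs_car -> cs_car -> cs_car;
  cs_star : cs_car -> cs_car;
  cs_norm : cs_car -> R;
  cs_mul_bilinear : is_bilinear cs_mul;
  cs_mulA : forall a b c, cs_mul a (cs_mul b c) = cs_mul (cs_mul a b) c;
  cs_starD : forall a b, cs_star (a + b) = cs_star a + cs_star b;
  cs_starZ : forall (c : R[i]) a, cs_star (c *: a) = c^* *: cs_star a;
  cs_starM : forall a b, cs_star (cs_mul a b) = cs_mul (cs_star b) (cs_star a);
  cs_starK : forall a, cs_star (cs_star a) = a;
  cs_normP : is_cstar_norm *:%R cs_mul cs_star cs_norm }.

Section CstarAlgebras.
Variables (R : realType) (A : cstarAlgebra R).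

Definition cs_positive (a : A) : Prop :=
  exists b : A, a = cs_mul (cs_star b) b.

Definition cs_mxstar (n : nat) (a : 'M[A]_n) : 'M[A]_n :=
  map_mx (@cs_star R A) a^T.

(* The second clause (compatibility with the norm of A on the diagonal
   corners) follows from the first; it is recorded for convenience. *)
Definition is_cs_mxnorm (n : nat) (N : 'M[A]_n -> R) : Prop :=
  is_cstar_norm (@mxscale R A n)
    (fun a b => mxbil (@cs_mul R A) a b) (@cs_mxstar n) N /\
  forall (k : 'I_n) (a : A),
    N (\matrix_(i, j) (a *+ ((i == k) && (j == k)))) = cs_norm a.

(* The norm of M_n(A): the *-algebra M_n(A) has exactly one C*-norm. *)
Definition cs_mxnorm (n : nat) : 'M[A]_n -> R :=
  xget (fun=> 0) [set N | is_cs_mxnorm N].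

End CstarAlgebras.

(** * Operator modules *)

Record opModule (R : realType) (A : cstarAlgebra R) := OpModule {
  om_space :> operatorSpace R;
  om_act : A -> om_space -> om_space;
  om_act_bilinear : is_bilinear om_act;
  om_actA : forall a b x, om_act (cs_mul a b) x = om_act a (om_act b x);
  (* contractivity of A \otimes_h X -> X *)
  om_act_cc : forall (n : nat) (a : 'M[A]_n) (x : 'M[om_space]_n),
    mn_norm (mxbil om_act a x) <= cs_mxnorm a * mn_norm x;
  om_nondegenerate : total_set (@norm1 R om_space)
    [set om_act p.1 p.2 | p in [set: A * om_space]] }.

Definition cb_module_maps (R : realType) (A : cstarAlgebra R)
    (X Y : opModule A) : set (X -> Y) :=
  [set T | [/\ linear T, completely_bounded T
             & forall a x, T (om_act a x) = om_act a (T x)]].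
Arguments cb_module_maps {R A} X Y.

(* Just the data entering the definition of X \otimes_{hB} Y and of its left
   A-action. *)
Record matBimodule (R : realType) (A B : cstarAlgebra R) := MatBimodule {
  mb_space :> matNormed R;
  mb_lact : A -> mb_space -> mb_space;
  mb_ract : mb_space -> B -> mb_space }.

(** * The balanced Haagerup tensor product *)

(* A model of M \otimes_{hB} Y, as a left operator A-module; any two are
   completely isometrically isomorphic by ht_cc,
   ht_dense and ht_universal. *)
Record haagerupTensor (R : realType) (A B : cstarAlgebra R)
    (M : matBimodule A B) (Y : opModule B) := HaagerupTensor {
  ht_module :> opModule A;
  ht_tens : M -> Y -> ht_module;
  ht_bilinear : is_bilinear ht_tens;
  ht_balanced : forall m b y,
    ht_tens (mb_ract m b) y = ht_tens m (om_act b y);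
  ht_lact : forall a m y, om_act a (ht_tens m y) = ht_tens (mb_lact a m) y;
  ht_cc : completely_contractive2 ht_tens;
  ht_dense : total_set (@norm1 R ht_module)
    [set ht_tens p.1 p.2 | p in [set: M * Y]];
  ht_universal : forall (Z : operatorSpace R) (Phi : M -> Y -> Z),
    is_bilinear Phi ->
    (forall m b y, Phi (mb_ract m b) y = Phi m (om_act b y)) ->
    completely_contractive2 Phi ->
    exists F : ht_module -> Z,
      [/\ linear F, completely_contractive F
        & forall m y, F (ht_tens m y) = Phi m y] }.

(* A linear map, bounded for norm1, is determined on a total set. *)
Lemma total_linear_eq0 (R : realType) (X : matNormed R) (Z : operatorSpace R)
    (S : set X) (D : X -> Z) (K : R) :
  total_set (@norm1 R X) S -> linear D ->
  (forall v, norm1 (D v) <= K * norm1 v) ->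
  (forall v, S v -> D v = 0) -> forall v, D v = 0.
Proof.
move=> totS linD bD D0 v.
pose Dl : {linear X -> Z} := HB.pack D (GRing.isLinear.Build _ _ _ _ D linD).
have DlE u : D u = Dl u by [].
have N0 (z : Z) : norm1 z = 0 -> z = 0.
  case: (os_axioms Z) => /(_ 1%N)[N0 _ _ _] _ _ /N0 /matrixP /(_ 0 0).
  by rewrite !mxE.
apply: N0; apply/eqP; rewrite eq_le mn_ge0 andbT.
apply/ler_addgt0Pr => e e0; rewrite add0r.
have K0 : 0 < Num.max K 1 by rewrite lt_max ltr01 orbT.
have [n [c [s [Ss lte]]]] := totS v (e / Num.max K 1) (divr_gt0 e0 K0).
have -> : D v = D (v - \sum_(i < n) c i *: s i).
  rewrite !DlE linearB linear_sum big1 ?subr0 // => i _.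
  by rewrite linearZ_LR -DlE D0 ?scaler0 //; exact: Ss.
rewrite (le_trans (bD _))// ltW// -[ltRHS](divfK (lt0r_neq0 K0)) mulrC.
apply: (@le_lt_trans _ _ (norm1 (v - \sum_(i < n) c i *: s i) * Num.max K 1)).
  by rewrite ler_wpM2l ?mn_ge0// le_max lexx.
by rewrite ltr_pM2r.
Qed.

Lemma norm1B (R : realType) (Z : operatorSpace R) (x y : Z) :
  norm1 (x - y) <= norm1 x + norm1 y.
Proof.
case: (os_axioms Z) => /(_ 1%N)[_ ND NZ _] _ _.
have -> : norm1 y = mn_norm (mxscale (-1) (const_mx y : 'M[Z]_1)).
  rewrite NZ (_ : Normc.normc _ = 1) ?mul1r //=.
  by rewrite sqrrN expr1n oppr0 expr0n addr0 sqrtr1.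
rewrite /norm1 (_ : const_mx (x - y) =
  const_mx x + mxscale (-1) (const_mx y : 'M[Z]_1)) ?ND //.
by apply/matrixP=> i j; rewrite !mxE scaleN1r.
Qed.

Lemma norm1_act (R : realType) (A : cstarAlgebra R) (X : opModule A)
    (a : A) (x : X) :
  norm1 (om_act a x) <= cs_mxnorm (const_mx a : 'M[A]_1) * norm1 x.
Proof.
rewrite /norm1 (_ : const_mx _ = mxbil (@om_act R A X) (const_mx a)
  (const_mx x)) ?om_act_cc //.
by apply/matrixP=> i j; rewrite !mxE big_ord1 !mxE.
Qed.

Lemma norm1_map (R : realType) (X Y : matNormed R) (T : X -> Y) (c : R) :
  (forall n (x : 'M[X]_n), mn_norm (map_mx T x) <= c * mn_norm x) ->
  forall x, norm1 (T x) <= c * norm1 x.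
Proof.
move=> Tc x; rewrite /norm1 (_ : const_mx _ = map_mx T (const_mx x)) ?Tc //.
by apply/matrixP=> i j; rewrite !mxE.
Qed.

Section TensorMap.
Variables (R : realType) (A B : cstarAlgebra R) (M : matBimodule A B).
Variables (Y Y' : opModule B).
Variables (Q : haagerupTensor M Y) (Q' : haagerupTensor M Y').

(* 1 \otimes f, see tensor_mapP and tensor_map_unique *)
Definition tensor_map (f : Y -> Y') : Q -> Q' :=
  xget (fun=> 0) [set F | cb_module_maps Q Q' F /\
    forall m y, F (ht_tens Q m y) = ht_tens Q' m (f y)].

Lemma tensor_map_unique (F G : Q -> Q') :
  linear F -> completely_bounded F -> linear G -> completely_bounded G ->
  (forall m y, F (ht_tens Q m y) = G (ht_tens Q m y)) -> F = G.
Proof.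
move=> linF [c Fc] linG [d Gd] FG.
pose D v := F v - G v.
suff D0 v : D v = 0.
  by apply/funext=> v; apply/eqP; rewrite -subr_eq0; apply/eqP/D0.
move: v; apply: (@total_linear_eq0 _ Q Q' _ D (c + d) (@ht_dense R A B M Y Q)).
- by move=> a u v; rewrite /D linF linG scalerBr opprD addrACA.
- move=> v; apply: (le_trans (norm1B _ _)); rewrite mulrDl.
  by apply: lerD; apply: norm1_map.
- by move=> _ [[m y] _ <-] /=; rewrite /D FG subrr.
Qed.

Lemma tensor_map_exists (f : Y -> Y') : cb_module_maps Y Y' f ->
  exists F, cb_module_maps Q Q' F /\
    forall m y, F (ht_tens Q m y) = ht_tens Q' m (f y).
Proof.
move=> [linf [c fc] fmod].
pose k := Num.max c 1.
have k0 : 0 < k by rewrite lt_max ltr01 orbT.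
have fk n (x : 'M[Y]_n) : mn_norm (map_mx f x) <= k * mn_norm x.
  by apply: (le_trans (fc _ _)); rewrite ler_wpM2r ?mn_ge0// le_max lexx.
have normk (r : R) : 0 <= r -> Normc.normc (r%:C)%C = r.
  by move=> r0; rewrite /= expr0n addr0 sqrtr_sqr ger0_norm.
have NZ n (a : R) (x : 'M[Q']_n) : 0 <= a ->
    mn_norm (mxscale (a%:C)%C x) = a * mn_norm x.
  case: (os_axioms Q') => /(_ n)[_ _ NZ _] _ _ a0.
  by rewrite NZ normk.
pose Phi m y := ((k^-1)%:C)%C *: ht_tens Q' m (f y).
have [bl br] := ht_bilinear Q'.
have [F0 [linF0 F0c F0E]] : exists F : Q -> Q',
    [/\ linear F, completely_contractive F
      & forall m y, F (ht_tens Q m y) = Phi m y].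
  apply: ht_universal.
  - split=> [m a u v|y a u v]; rewrite /Phi.
      by rewrite linf bl scalerDr !scalerA mulrC.
    by rewrite /= (br (f y)) scalerDr !scalerA mulrC.
  - by move=> m b y; rewrite /Phi ht_balanced fmod.
  - move=> n x y.
    have -> : mxbil Phi x y =
        mxscale ((k^-1)%:C)%C (mxbil (ht_tens Q') x (map_mx f y)).
      apply/matrixP=> i j; rewrite !mxE scaler_sumr.
      by apply: eq_bigr => l _; rewrite mxE.
    rewrite NZ ?invr_ge0 ?(ltW k0)// mulrC ler_pdivrMr//.
    apply: (le_trans (ht_cc _ _ _)); rewrite -mulrA.
    by rewrite ler_wpM2l ?mn_ge0// mulrC.
pose F v := (k%:C)%C *: F0 v.
have FE m y : F (ht_tens Q m y) = ht_tens Q' m (f y).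
  rewrite /F F0E /Phi scalerA -rmorphM divff ?lt0r_neq0//.
  by rewrite rmorph1 scale1r.
have linF : linear F.
  by move=> a u v; rewrite /F linF0 scalerDr !scalerA mulrC.
have Fk n (x : 'M[Q]_n) : mn_norm (map_mx F x) <= k * mn_norm x.
  rewrite (_ : map_mx F x = mxscale (k%:C)%C (map_mx F0 x)); last first.
    by apply/matrixP=> i j; rewrite !mxE.
  by rewrite NZ ?(ltW k0)// ler_wpM2l ?(ltW k0)//; exact: F0c.
exists F; split=> //; split=> //; first by exists k.
move=> a.
have [aQ _] := @om_act_bilinear R A Q.
have [aQ' _] := @om_act_bilinear R A Q'.
pose na := cs_mxnorm (const_mx a : 'M[A]_1).
pose D v := F (om_act a v) - om_act a (F v).
suff D0 v : D v = 0.
  by move=> v; apply/eqP; rewrite -subr_eq0; apply/eqP/D0.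
move: v; apply: (@total_linear_eq0 _ Q Q' _ D (k * na + `|na| * k)
  (@ht_dense R A B M Y Q)).
- by move=> c0 u v; rewrite /D aQ linF linF aQ' scalerBr opprD addrACA.
- move=> v; apply: (le_trans (norm1B _ _)); rewrite mulrDl; apply: lerD.
    apply: (le_trans (norm1_map Fk _)); rewrite -mulrA ler_wpM2l ?(ltW k0)//.
    exact: norm1_act.
  apply: (le_trans (norm1_act _ _)); rewrite -mulrA.
  apply: (@le_trans _ _ (`|na| * norm1 (F v))).
    by rewrite ler_wpM2r ?mn_ge0// ler_norm.
  by rewrite ler_wpM2l// norm1_map.
- by move=> _ [[m y] _ <-] /=; rewrite /D ht_lact !FE ht_lact subrr.
Qed.

Lemma tensor_mapP (f : Y -> Y') : cb_module_maps Y Y' f ->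
  cb_module_maps Q Q' (tensor_map f) /\
  forall m y, tensor_map f (ht_tens Q m y) = ht_tens Q' m (f y).
Proof.
by move=> /tensor_map_exists[F FP]; rewrite /tensor_map;
  case: xgetP => [G _ //|/(_ F)].
Qed.

End TensorMap.

Arguments tensor_map {R A B M Y Y'} Q Q' f _.

(** * Hilbert C*-modules and correspondences *)

(* Conjugate-linearity of the inner product in its first variable follows
   from hm_inner_linear and hm_inner_sym. *)
Record hilbertModule (R : realType) (B : cstarAlgebra R) := HilbertModule {
  hm_car :> lmodType R[i];
  hm_act : hm_car -> B -> hm_car;
  hm_inner : hm_car -> hm_car -> B;
  hm_act_bilinear : is_bilinear hm_act;
  hm_actA : forall e b c, hm_act e (cs_mul b c) = hm_act (hm_act e b) c;
  hm_inner_linear : forall e, linear (hm_inner e);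
  hm_innerM : forall e f b, hm_inner e (hm_act f b) = cs_mul (hm_inner e f) b;
  hm_inner_sym : forall e f, cs_star (hm_inner e f) = hm_inner f e;
  hm_inner_ge0 : forall e, cs_positive (hm_inner e e);
  hm_inner_eq0 : forall e, hm_inner e e = 0 -> e = 0;
  hm_complete : norm_complete (fun e => Num.sqrt (cs_norm (hm_inner e e))) }.

Section HilbertModules.
Variables (R : realType) (B : cstarAlgebra R) (E : hilbertModule B).

Definition hm_norm (e : E) : R := Num.sqrt (cs_norm (hm_inner e e)).

Definition hm_mxinner (n : nat) (e f : 'M[E]_n) : 'M[B]_n :=
  \matrix_(i, j) \sum_(k < n) hm_inner (e k i) (f k j).

Definition hm_mxnorm (n : nat) (e : 'M[E]_n) : R :=
  Num.sqrt (cs_mxnorm (hm_mxinner e e)).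

Lemma hm_mxnorm_ge0 (n : nat) (e : 'M[E]_n) : 0 <= hm_mxnorm e.
Proof. exact: sqrtr_ge0. Qed.

Definition hm_space : matNormed R := MatNormed hm_mxnorm_ge0.

Definition bounded_module_map (T : E -> E) : Prop :=
  [/\ linear T, exists c : R, forall e, hm_norm (T e) <= c * hm_norm e
    & forall e b, T (hm_act e b) = hm_act (T e) b].

Definition hm_adjoint (T S : E -> E) : Prop :=
  forall e f, hm_inner (T e) f = hm_inner e (S f).

(* T is an operator-norm limit of finite sums of operators
   e |-> u <v, e>; scalar coefficients are absorbed in u. *)
Definition hm_compact (T : E -> E) : Prop :=
  forall eps : R, 0 < eps -> exists (n : nat) (u v : 'I_n -> E),
    forall e, hm_norm (T e - \sum_(i < n) hm_act (u i) (hm_inner (v i) e))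
                <= eps * hm_norm e.

End HilbertModules.

Record correspondence (R : realType) (A B : cstarAlgebra R) :=
    Correspondence {
  co_module :> hilbertModule B;
  co_act : A -> co_module -> co_module;
  co_act_bilinear : is_bilinear co_act;
  co_actM : forall a b e, co_act (cs_mul a b) e = co_act a (co_act b e);
  co_act_bounded : forall a, bounded_module_map (co_act a);
  co_act_star : forall a, hm_adjoint (co_act a) (co_act (cs_star a));
  co_nondegenerate : total_set (@hm_norm R B co_module)
    [set co_act p.1 p.2 | p in [set: A * co_module]] }.

Arguments co_act {R A B} c _ _.

Definition corr_bimodule (R : realType) (A B : cstarAlgebra R)
    (E : correspondence A B) : matBimodule A B :=
  @MatBimodule R A B (hm_space E) (co_act E) (@hm_act R B E).

(** * The adjoint of a correspondence *)

Definition conj_space (R : realType) (V : lmodType R[i]) : Type := V.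

Section ConjSpace.
Variables (R : realType) (V : lmodType R[i]).

HB.instance Definition _ := GRing.Zmodule.on (conj_space V).

Let conj_scale (c : R[i]) (v : conj_space V) : conj_space V :=
  (c^* *: (v : V)).

Let conj_scaleA (a b : R[i]) v :
  conj_scale a (conj_scale b v) = conj_scale (a * b) v.
Proof. by rewrite /conj_scale scalerA rmorphM. Qed.

Let conj_scale1 : left_id 1 conj_scale.
Proof. by move=> v; rewrite /conj_scale rmorph1 scale1r. Qed.

Let conj_scaleDr : right_distributive conj_scale +%R.
Proof. by move=> c u v; rewrite /conj_scale; exact: scalerDr. Qed.

Let conj_scaleDl v : {morph conj_scale^~ v : a b / a + b}.
Proof. by move=> a b; rewrite /conj_scale rmorphD; exact: scalerDl. Qed.

HB.instance Definition _ := GRing.Zmodule_isLmodule.Build R[i] (conj_space V)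
  conj_scaleA conj_scale1 conj_scaleDr conj_scaleDl.

End ConjSpace.

Section Adjoint.
Variables (R : realType) (A B : cstarAlgebra R) (E : correspondence A B).

Definition adj_mxnorm (n : nat) (x : 'M[conj_space E]_n) : R :=
  hm_mxnorm (x^T : 'M[E]_n).

Lemma adj_mxnorm_ge0 (n : nat) (x : 'M[conj_space E]_n) : 0 <= adj_mxnorm x.
Proof. exact: sqrtr_ge0. Qed.

Definition adj_space : matNormed R := MatNormed adj_mxnorm_ge0.

Definition adj_bimodule : matBimodule B A :=
  @MatBimodule R B A adj_space
    (fun b (e : E) => hm_act e (cs_star b))
    (fun (e : E) a => co_act E (cs_star a) e).

End Adjoint.

(* Main.v *)
Require Import Defs.
From HB Require Import structures.
From mathcomp Require Import all_boot all_order all_algebra.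
From mathcomp Require Import complex.
From mathcomp Require Import all_classical all_reals all_analysis.
From mathcomp Require Import ring lra.

(* The counit [e^* (x) f (x) y |-> <e, f> y] makes [S] on [E^* (x)_hA X] and [T]
   on [X] mates when [S (e^* (x) x) = <e, T x>] for all [e].  Everything rests on
   frames: given finitely many [f] in [E] there are rows [g], [h] over [E], with
   norms at most an absolute constant, such that [\sum_l g_l <h_l, f>] is close
   to [f].  They give [q ~ \sum_l g_l (x) <h_l, q>] in [E (x)_hB Y], so the norm
   of [q] is equivalent to that of the columns [(<h_l, q>)_l]; hence the pairing
   [(e, q) |-> <e, q>] is completely bounded and separates points, which yields
   [S] from [T].  Conversely [T x] is the solution [q] of the equations
   [<e, q> = S (e^* (x) x)]: if [x = a x'] and [a] is close to
   [\sum_i u_i <v_i, .>], then [\sum_i u_i (x) S (v_i^* (x) x')] is an approximate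
   solution, and approximate solutions converge by the frame estimate.

   The C*-algebraic input is kept at the level of norms: dropping terms from a
   sum of elements [b^* b] decreases the norm, and a log-convex sequence of
   powers removes dimension-dependent constants.  Complete boundedness is all
   that is needed, so the frames may have norm [3] instead of [1]. *)

Set Implicit Arguments.
Unset Strict Implicit.
Unset Printing Implicit Defensive.

Import Order.TTheory GRing.Theory Num.Theory.
Import numFieldNormedType.Exports.
Local Open Scope classical_set_scope.
Local Open Scope ring_scope.

(** The obstacle is that [E] need not have an exact finite frame, and that approximate ones usually
    come from functional calculus in the compact operators. Here they are made of polynomials: scale
    the given vectors to a contractive row [u], put [th = u u^*] and [D = 1 - th], and use the
    vectors [D^k u_j]. The identity [1 + th^2 = 2 th + D^2], summed along orbits of [D], takes over
    the role of the spectral bounds [0 <= th <= 1]. The vectors [h] carry an extra factor [1 + D],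
    of norm at most [1 + 2], which is the origin of the constant 3; a bound 9 is [3 * 3], one factor
    for the row [g] and one for the column [h].

    The sums [\sum_l g_l (x) S (h_l^* (x) x)] need not converge along frames of a general
    correspondence. Compactness replaces the frame by a finite-rank operator close to [a] in norm,
    which controls all rows over [E] at once. Accordingly an approximate solution is measured by a
    defect uniform over rows: smallness of each single equation would not make approximate solutions
    Cauchy. *)

Section Preliminaries.
Variable R : realType.
Local Notation C := R[i].

Section LinearMaps.
Variables (U V : lmodType C) (f : U -> V).
Hypothesis linf : linear f.

Let fl : {linear U -> V} := HB.pack f (GRing.isLinear.Build _ _ _ _ f linf).

Lemma lin0 : f 0 = 0. Proof. exact: (linear0 fl). Qed.

Lemma linD x y : f (x + y) = f x + f y. Proof. exact: (linearD fl). Qed.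

Lemma linN x : f (- x) = - f x. Proof. exact: (linearN fl). Qed.

Lemma linB x y : f (x - y) = f x - f y. Proof. exact: (linearB fl). Qed.

Lemma linZ c x : f (c *: x) = c *: f x. Proof. exact: (linearZ_LR fl). Qed.

Lemma linMn x n : f (x *+ n) = f x *+ n. Proof. exact: (linearMn fl). Qed.

Lemma lin_sum (I : Type) (r : seq I) (P : pred I) (F : I -> U) :
  f (\sum_(i <- r | P i) F i) = \sum_(i <- r | P i) f (F i).
Proof. exact: (linear_sum fl). Qed.

End LinearMaps.

Lemma normc_real (r : R) : 0 <= r -> Normc.normc (r%:C)%C = r.
Proof. by move=> r0; rewrite /= expr0n addr0 sqrtr_sqr ger0_norm. Qed.

Lemma normcN1 : Normc.normc (-1 : C) = 1.
Proof. by rewrite /= sqrrN expr1n oppr0 expr0n addr0 sqrtr1. Qed.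

Lemma eq_ler (x y : R) : x = y -> x <= y. Proof. by move=> ->. Qed.

Lemma sqr_le_mul (x a b : R) : 0 <= a -> 0 <= b -> x ^+ 2 <= a ^+ 2 * b ^+ 2 ->
  x <= a * b.
Proof.
move=> a0 b0; rewrite -exprMn => h.
have [x0|/ltW x0] := leP x 0; first exact: le_trans x0 (mulr_ge0 a0 b0).
by rewrite -ler_sqr ?nnegrE ?mulr_ge0.
Qed.

(* A log-convex sequence with geometric bound [K * c ^+ k] grows by a factor at
   most [c] at its first step. *)
Lemma logconvex_le (a : nat -> R) (c K : R) :
  (forall k, 0 <= a k) -> (forall k, a k.+1 ^+ 2 <= a k * a k.+2) ->
  0 <= c -> (forall k, a k <= K * c ^+ k) -> a 1%N <= c * a 0%N.
Proof.
move=> a0 alc c0 ab.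
have [a00|a00] := eqVneq (a 0%N) 0.
  rewrite a00 mulr0 (_ : a 1%N = 0)//; apply/eqP.
  rewrite -sqrf_eq0 eq_le sqr_ge0.
  by rewrite andbT (le_trans (alc 0%N))// a00 mul0r.
have {}a00 : 0 < a 0%N by rewrite lt_neqAle eq_sym a00 a0.
(* Otherwise log-convexity keeps every later ratio at least [r > c], and by Bernoulli's inequality
   [r ^+ k * a 0] outgrows [K * c ^+ k]. *)
rewrite leNgt; apply/negP => hlt.
pose r := a 1%N / a 0%N.
have rc : c < r by rewrite ltr_pdivlMr.
have r0 : 0 < r by exact: le_lt_trans c0 rc.
have step k : 0 < a k /\ r * a k <= a k.+1.
  elim: k => [|k [ak IH]]; first by rewrite /r divfK ?gt_eqF.
  have ak1 : 0 < a k.+1 by apply: lt_le_trans IH; rewrite mulr_gt0.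
  split=> //; rewrite -(ler_pM2l ak) (le_trans _ (alc k))//.
  by rewrite mulrCA mulrA expr2 ler_wpM2r ?(ltW ak1).
have pow k : r ^+ k * a 0%N <= a k.
  elim: k => [|k IH]; first by rewrite mul1r.
  by rewrite exprS -mulrA (le_trans _ (step k).2)// ler_wpM2l ?(ltW r0).
have [c00|c00] := eqVneq c 0.
  have := le_trans (pow 1%N) (ab 1%N); rewrite c00 mulr0 leNgt => /negP; apply.
  by rewrite mulr_gt0.
have cp : 0 < c by rewrite lt_neqAle eq_sym c00.
pose q := r / c; pose d := q - 1.
have d0 : 0 < d by rewrite subr_gt0 ltr_pdivlMr// mul1r.
have bern k : 1 + k%:R * d <= q ^+ k.
  elim: k => [|k IH]; first by rewrite mul0r addr0.
  have qE : q = 1 + d by rewrite /d; lra.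
  rewrite exprS; apply: (@le_trans _ _ (q * (1 + k%:R * d))).
    rewrite qE -natr1; have : 0 <= k%:R * d * d by rewrite !mulr_ge0// ltW.
    by nra.
  by rewrite ler_wpM2l// qE addr_ge0// ltW.
have bnd k : k%:R * d * a 0%N <= K.
  have := le_trans (pow k) (ab k).
  have -> : r = q * c by rewrite /q divfK.
  rewrite exprMn mulrAC ler_pM2r ?exprn_gt0// => h.
  apply: le_trans h; rewrite ler_pM2r//; apply: le_trans (bern k).
  by rewrite lerDr.
pose N := Num.bound (K / (d * a 0%N)).
have da : 0 < d * a 0%N by rewrite mulr_gt0.
have := bnd N; rewrite -mulrA -ler_pdivlMr// leNgt => /negP; apply.
apply: archi_boundP; rewrite divr_ge0 ?(ltW da)//.
by have := bnd 0%N; rewrite !mul0r.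
Qed.

Section BanachNorm.
Variables (V : zmodType) (scale : C -> V -> V) (N : V -> R).
Hypothesis NB : is_banach_norm scale N.
Hypothesis scale0 : forall x, scale 0 x = 0.
Hypothesis scaleN1 : forall x, scale (-1) x = - x.

(** With an explicit [scale], these facts apply both to [B] and to matrices scaled by [mxscale]. *)
Lemma bnorm0 : N 0 = 0.
Proof. by case: NB => _ _ NZ _; rewrite -(scale0 0) NZ Normc.normc0 mul0r. Qed.

Lemma bnormN x : N (- x) = N x.
Proof. by case: NB => _ _ NZ _; rewrite -scaleN1 NZ normcN1 mul1r. Qed.

Lemma bnormD x y : N (x + y) <= N x + N y.
Proof. by case: NB. Qed.

Lemma bnormB x y : N (x - y) <= N x + N y.
Proof. by rewrite (le_trans (bnormD _ _))// bnormN. Qed.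

Lemma bnorm_ge0 x : 0 <= N x.
Proof. by have := bnormB x x; rewrite subrr bnorm0; lra. Qed.

Lemma bnorm_eq0 x : N x = 0 -> x = 0.
Proof. by case: NB => h _ _ _; exact: h. Qed.

Lemma bnorm_sum (I : Type) (r : seq I) (P : pred I) (F : I -> V) :
  N (\sum_(i <- r | P i) F i) <= \sum_(i <- r | P i) N (F i).
Proof.
elim/big_rec2: _ => [|i y1 y2 _ h]; first by rewrite bnorm0.
by rewrite (le_trans (bnormD _ _))// lerD2l.
Qed.

End BanachNorm.

(** The C*-identity gives [N a ^+ 2 <= N (star a) * N a]; cancel [N a], then exchange [a] and
    [star a]. *)
Lemma cstar_norm_star (V : zmodType) (scale : C -> V -> V) (mul : V -> V -> V)
    (star : V -> V) (N : V -> R) : involutive star ->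
  (forall x, scale 0 x = 0) -> (forall x, scale (-1) x = - x) ->
  is_cstar_norm scale mul star N -> forall a, N (star a) = N a.
Proof.
move=> starK s0 s1 [NB NM Nst].
have n0 := bnorm_ge0 NB s0 s1.
have le a : N a <= N (star a).
  have [a0|a0] := eqVneq (N a) 0; first by rewrite a0.
  have {}a0 : 0 < N a by rewrite lt_neqAle eq_sym a0 n0.
  by rewrite -(ler_pM2r a0) -expr2 -Nst NM.
by move=> a; apply/eqP; rewrite eq_le le andbT -{2}(starK a) le.
Qed.

End Preliminaries.

Local Notation "a ** b" := (cs_mul a b) (at level 40, left associativity).
Local Notation st := (@cs_star _ _).
Local Notation rs r := ( *:%R (r%:C)%C).

(** * Norms of vectors and matrices over a C*-algebra *)

Section CstarBasics.
Variables (R : realType) (B : cstarAlgebra R).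
Implicit Types a b c x y : B.

Let mull a : linear (cs_mul a). Proof. exact: (@cs_mul_bilinear R B).1. Qed.
Let mulr b : linear (fun a => a ** b).
Proof. exact: (@cs_mul_bilinear R B).2. Qed.

Lemma cmul0l a : 0 ** a = 0. Proof. exact: (lin0 (mulr a)). Qed.

Lemma cmul0r a : a ** 0 = 0. Proof. exact: (lin0 (mull a)). Qed.

Lemma cmulZl s a b : (s *: a) ** b = s *: (a ** b).
Proof. exact: (linZ (mulr b)). Qed.

Lemma cmulZr s a b : a ** (s *: b) = s *: (a ** b).
Proof. exact: (linZ (mull a)). Qed.

Lemma cmulMnl a b n : (a *+ n) ** b = (a ** b) *+ n.
Proof. exact: (linMn (mulr b)). Qed.

Lemma cmulMnr a b n : a ** (b *+ n) = (a ** b) *+ n.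
Proof. exact: (linMn (mull a)). Qed.

Lemma cmul_suml (I : Type) (r : seq I) (P : pred I) (F : I -> B) b :
  (\sum_(i <- r | P i) F i) ** b = \sum_(i <- r | P i) F i ** b.
Proof. exact: (lin_sum (mulr b)). Qed.

Lemma cmul_sumr (I : Type) (r : seq I) (P : pred I) (F : I -> B) a :
  a ** (\sum_(i <- r | P i) F i) = \sum_(i <- r | P i) a ** F i.
Proof. exact: (lin_sum (mull a)). Qed.

Lemma cstar0 : st (0 : B) = 0.
Proof.
by apply: (addrI (st (0 : B))); rewrite -cs_starD !addr0.
Qed.

Lemma cstar_sum (I : Type) (r : seq I) (P : pred I) (F : I -> B) :
  st (\sum_(i <- r | P i) F i) = \sum_(i <- r | P i) st (F i).
Proof. by rewrite (big_morph st (@cs_starD R B) cstar0). Qed.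

Lemma cstarMn a n : st (a *+ n) = st a *+ n.
Proof.
by elim: n => [|n IH]; rewrite ?mulr0n ?cstar0// !mulrS cs_starD IH.
Qed.

Lemma cstarZr (r : R) a : st (rs r a) = rs r (st a).
Proof. by rewrite cs_starZ; congr (_ *: _); exact: conjc_real. Qed.

Lemma cs_banach : is_banach_norm *:%R (@cs_norm R B).
Proof. by case: (@cs_normP R B). Qed.

Let s0 x : 0 *: x = 0. Proof. exact: scale0r. Qed.
Let s1 x : (-1) *: x = - x. Proof. exact: scaleN1r. Qed.

Lemma cnorm0 : cs_norm (0 : B) = 0. Proof. exact: (bnorm0 cs_banach s0). Qed.

Lemma cnormD a b : cs_norm (a + b) <= cs_norm a + cs_norm b.
Proof. exact: (bnormD cs_banach). Qed.

Lemma cnorm_ge0 a : 0 <= cs_norm a.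
Proof. exact: (bnorm_ge0 cs_banach s0 s1). Qed.

Lemma cnorm_eq0 a : cs_norm a = 0 -> a = 0.
Proof. exact: (bnorm_eq0 cs_banach). Qed.

Lemma cnorm_sum (I : Type) (r : seq I) (P : pred I) (F : I -> B) :
  cs_norm (\sum_(i <- r | P i) F i) <= \sum_(i <- r | P i) cs_norm (F i).
Proof. exact: (bnorm_sum cs_banach s0). Qed.

Lemma cnormZr (r : R) a : 0 <= r -> cs_norm (rs r a) = r * cs_norm a.
Proof. by case: cs_banach => _ _ NZ _ r0; rewrite NZ normc_real. Qed.

Lemma cnormM a b : cs_norm (a ** b) <= cs_norm a * cs_norm b.
Proof. by case: (@cs_normP R B). Qed.

Lemma cnorm_sq a : cs_norm (st a ** a) = cs_norm a ^+ 2.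
Proof. by case: (@cs_normP R B). Qed.

Lemma cnorm_star a : cs_norm (st a) = cs_norm a.
Proof. exact: (cstar_norm_star (@cs_starK R B) s0 s1 (@cs_normP R B)). Qed.

(** Stands in for positivity: that a sum of elements [b^* b] is again of this form would require
    square roots. The index type ['I_n.+1] provides the column [ord0] used by [colm]. *)
Definition sumsq x := exists n (a : 'I_n.+1 -> B), x = \sum_i st (a i) ** a i.

Lemma sumsq_sq a : sumsq (st a ** a).
Proof. by exists 0, (fun=> a); rewrite big_ord1. Qed.

Lemma sumsq0 : sumsq 0.
Proof. by rewrite -(cmul0r (st 0)); exact: sumsq_sq. Qed.

Lemma sumsqD x y : sumsq x -> sumsq y -> sumsq (x + y).
Proof.
move=> [m [a ->]] [n [b ->]].
exists (m + n.+1)%N, (fun i : 'I_(m.+1 + n.+1) =>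
  match fintype.split i with inl j => a j | inr j => b j end).
rewrite (@big_split_ord _ _ _ m.+1 n.+1) /=; congr (_ + _);
  apply: eq_bigr => i _; first by rewrite (unsplitK (inl i)).
by rewrite (unsplitK (inr i)).
Qed.

Lemma sumsq_sum (I : Type) (r : seq I) (P : pred I) (F : I -> B) :
  (forall i, P i -> sumsq (F i)) -> sumsq (\sum_(i <- r | P i) F i).
Proof. by move=> h; apply: big_ind => //; [exact: sumsq0|exact: sumsqD]. Qed.

Lemma sumsq_positive x : cs_positive x -> sumsq x.
Proof. by move=> [b ->]; exact: sumsq_sq. Qed.

Lemma sumsqZ (r : R) x : 0 <= r -> sumsq x -> sumsq (rs r x).
Proof.
move=> r0 [n [a ->]]; exists n, (fun i => rs (Num.sqrt r) (a i)).
rewrite scaler_sumr; apply: eq_bigr => i _.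
rewrite cstarZr cmulZl cmulZr scalerA -rmorphM/= -expr2 sqr_sqrtr//.
Qed.

Section MatrixNorm.
Hypothesis HB : forall n, is_cs_mxnorm (@cs_mxnorm R B n).
Variable n : nat.
Local Notation N := (@cs_mxnorm R B n).
Local Notation mm := (mxbil (@cs_mul R B)).
Implicit Types p q : 'M[B]_n.

Lemma mxscale0 p : mxscale 0 p = 0.
Proof. by apply/matrixP => i j; rewrite !mxE scale0r. Qed.

Lemma mxscaleN1 p : mxscale (-1) p = - p.
Proof. by apply/matrixP => i j; rewrite !mxE scaleN1r. Qed.

Lemma mxstarK : involutive (@cs_mxstar R B n).
Proof. by move=> p; apply/matrixP => i j; rewrite !mxE cs_starK. Qed.

Lemma mxstarM p q : cs_mxstar (mm p q) = mm (cs_mxstar q) (cs_mxstar p).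
Proof.
apply/matrixP => i j; rewrite !mxE cstar_sum; apply: eq_bigr => k _.
by rewrite cs_starM !mxE.
Qed.

Lemma mmA p q r : mm p (mm q r) = mm (mm p q) r.
Proof.
apply/matrixP => i j; rewrite !mxE.
under eq_bigr do rewrite mxE cmul_sumr.
under [RHS]eq_bigr do rewrite mxE cmul_suml.
rewrite exchange_big; do 2!apply: eq_bigr => ? _.
by rewrite cs_mulA.
Qed.

Let NC : is_cstar_norm (@mxscale R B n) (fun p q => mm p q)
  (@cs_mxstar R B n) N.
Proof. by case: (HB n). Qed.

Let NB : is_banach_norm (@mxscale R B n) N. Proof. by case: NC. Qed.

Lemma mxnorm_ge0 p : 0 <= N p.
Proof. exact: (bnorm_ge0 NB mxscale0 mxscaleN1). Qed.

Lemma mxnormM p q : N (mm p q) <= N p * N q.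
Proof. by case: NC. Qed.

Lemma mxnorm_sq p : N (mm (cs_mxstar p) p) = N p ^+ 2.
Proof. by case: NC. Qed.

Lemma mxnorm_star p : N (cs_mxstar p) = N p.
Proof. exact: (cstar_norm_star mxstarK mxscale0 mxscaleN1 NC). Qed.

Definition mxsingle (i j : 'I_n) a : 'M[B]_n :=
  \matrix_(k, l) (a *+ ((k == i) && (l == j))).

(** By the C*-identity the position [(i, j)] reduces to the diagonal position [(j, j)] with entry
    [a^* a], where [is_cs_mxnorm] prescribes the norm. *)
Lemma mxnorm_single i j a : N (mxsingle i j a) = cs_norm a.
Proof.
apply/eqP; rewrite -(@eqrXn2 _ 2) ?cnorm_ge0 ?mxnorm_ge0//; apply/eqP.
rewrite -mxnorm_sq -cnorm_sq -((HB n).2 j); congr N.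
apply/matrixP => k l; rewrite !mxE.
rewrite (bigD1 i)//= big1 ?addr0 => [|m mi].
  by rewrite !mxE eqxx/= cstarMn cmulMnl cmulMnr -mulrnA mulnb andbC.
by rewrite !mxE (negPf mi) mulr0n cmul0r.
Qed.

(** The loss depends on [n], but [mxnorm_le] uses this inside a geometric bound, where
    [logconvex_le] discards constant factors. *)
Lemma mxnorm_le_sum p : N p <= \sum_i \sum_j cs_norm (p i j).
Proof.
have {1}-> : p = \sum_i \sum_j mxsingle i j (p i j).
  apply/matrixP => k l; rewrite summxE (bigD1 k)//= summxE (bigD1 l)//=.
  rewrite mxE !eqxx mulr1n !big1 ?addr0// => [i ik|j jl].
    by rewrite summxE big1// => j _; rewrite mxE eq_sym (negPf ik).
  by rewrite mxE eqxx eq_sym (negPf jl).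
rewrite (le_trans (bnorm_sum NB mxscale0 _ _ _))//; apply: ler_sum => i _.
rewrite (le_trans (bnorm_sum NB mxscale0 _ _ _))//; apply: ler_sum => j _.
by rewrite mxnorm_single.
Qed.
End MatrixNorm.
End CstarBasics.

(* This always holds, but is not proved: where it fails [cs_mxnorm] is the junk
   value [0], and then the tensor products below are zero. *)
Definition has_mxnorms (R : realType) (B : cstarAlgebra R) : Prop :=
  forall n, is_cs_mxnorm (@cs_mxnorm R B n).

(** * Columns over [B], and dropping squares from a sum *)

Section ColumnMatrices.
Variables (R : realType) (B : cstarAlgebra R).
Hypothesis HB : has_mxnorms B.
Local Notation mm := (mxbil (@cs_mul R B)).

(** [cs_mxnorm] lives on square matrices, so a column is stored with zeros beside it. *)
Definition colm (n : nat) (v : 'I_n.+1 -> B) : 'M[B]_n.+1 :=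
  \matrix_(i, j) (v i *+ (j == ord0)).

Lemma mul_colm n (w v : 'I_n.+1 -> B) :
  mm (cs_mxstar (colm w)) (colm v) =
  mxsingle ord0 ord0 (\sum_i st (w i) ** v i).
Proof.
apply/matrixP => i j; rewrite !mxE -sumrMnl; apply: eq_bigr => k _.
by rewrite !mxE cstarMn cmulMnl cmulMnr -mulrnA mulnb andbC.
Qed.

Lemma colm_norm n (v : 'I_n.+1 -> B) :
  cs_mxnorm (colm v) ^+ 2 = cs_norm (\sum_i st (v i) ** v i).
Proof. by rewrite -mxnorm_sq// mul_colm mxnorm_single. Qed.

(* With [V] the column of all the terms and [P V] its truncation,
   [P V^* P V = V^* P V], so [|P V|^2 <= |V| |P V|]. *)
Lemma sumsq_le (x y : B) : sumsq x -> sumsq y -> cs_norm x <= cs_norm (x + y).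
Proof.
move=> [m [a ->]] [n [b ->]].
pose v (i : 'I_(m.+1 + n.+1)) :=
  match fintype.split i with inl j => a j | inr j => b j end.
pose w (i : 'I_(m.+1 + n.+1)) :=
  match fintype.split i with inl j => a j | inr j => 0 end.
have vE : \sum_i st (v i) ** v i =
    \sum_i st (a i) ** a i + \sum_i st (b i) ** b i.
  rewrite (@big_split_ord _ _ _ m.+1 n.+1) /=; congr (_ + _);
    apply: eq_bigr => i _; first by rewrite /v (unsplitK (inl i)).
  by rewrite /v (unsplitK (inr i)).
have wE : \sum_i st (w i) ** w i = \sum_i st (a i) ** a i.
  rewrite (@big_split_ord _ _ _ m.+1 n.+1) /= [X in _ + X]big1 ?addr0.
    by apply: eq_bigr => i _; rewrite /w (unsplitK (inl i)).
  by move=> i _; rewrite /w (unsplitK (inr i)) cmul0r.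
have vwE : \sum_i st (v i) ** w i = \sum_i st (w i) ** w i.
  apply: eq_bigr => i _; rewrite /v /w; case: (fintype.split i) => // j.
  by rewrite !cmul0r.
have Vn := @colm_norm (m + n.+1) v; have Wn := @colm_norm (m + n.+1) w.
have WVn := @mul_colm (m + n.+1) v w.
set V := colm v in Vn WVn; set W := colm w in Wn WVn.
rewrite -vE -wE -Vn -Wn; have n0 p : 0 <= cs_mxnorm p := mxnorm_ge0 HB p.
rewrite ler_sqr ?nnegrE//.
have [->//|W0] := eqVneq (cs_mxnorm W) 0.
have {}W0 : 0 < cs_mxnorm W by rewrite lt_neqAle eq_sym W0 n0.
rewrite -(ler_pM2r W0) -expr2 Wn -vwE.
rewrite -(mxnorm_single HB (@ord0 (m + n.+1)) (@ord0 (m + n.+1))) -WVn.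
by rewrite (le_trans (mxnormM HB _ _))// (mxnorm_star HB).
Qed.

Lemma sumsq_ler (x y : B) : sumsq x -> sumsq y -> cs_norm y <= cs_norm (x + y).
Proof. by rewrite addrC => ? ?; exact: sumsq_le. Qed.

End ColumnMatrices.

Section SelfModule.
Variables (R : realType) (B : cstarAlgebra R).

Let innerlin (a : B) : linear (fun b => st a ** b).
Proof. exact: (@cs_mul_bilinear R B).1. Qed.

Let actA (e b c : B) : e ** (b ** c) = (e ** b) ** c.
Proof. exact: cs_mulA. Qed.

Let innerM (e f b : B) : st e ** (f ** b) = (st e ** f) ** b.
Proof. exact: cs_mulA. Qed.

Let innersym (e f : B) : st (st e ** f) = st f ** e.
Proof. by rewrite cs_starM cs_starK. Qed.

Let inner_ge0 (e : B) : cs_positive (st e ** e).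
Proof. by exists e. Qed.

Let inner_eq0 (e : B) : st e ** e = 0 -> e = 0.
Proof.
move=> h; apply: cnorm_eq0; apply/eqP; rewrite -sqrf_eq0 -cnorm_sq h.
by rewrite cnorm0.
Qed.

Let complete : norm_complete (fun e : B => Num.sqrt (cs_norm (st e ** e))).
Proof.
have -> : (fun e : B => Num.sqrt (cs_norm (st e ** e))) = @cs_norm R B.
  by apply/funext => e; rewrite cnorm_sq sqrtr_sqr ger0_norm// cnorm_ge0.
by case: (@cs_banach R B).
Qed.

(** With [B] as a Hilbert module over itself, vectors over [B] and over [E] share one theory of
    [vn]. *)
Definition self_module : hilbertModule B :=
  HilbertModule (@cs_mul_bilinear R B) actA innerlin innerM innersym
    inner_ge0 inner_eq0 complete.

End SelfModule.

(** * Vectors over a Hilbert module and the Cauchy-Schwarz inequality *)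

Section HilbertVectors.
Variables (R : realType) (B : cstarAlgebra R) (E : hilbertModule B).
Implicit Types (e f : E) (I : finType).
Local Notation "<< e , f >>" := (hm_inner e f).

Let innl e : linear (hm_inner e). Proof. exact: hm_inner_linear. Qed.

Lemma innerDr e f g : << e, f + g >> = << e, f >> + << e, g >>.
Proof. exact: (linD (innl e)). Qed.

Lemma innerNr e f : << e, - f >> = - << e, f >>.
Proof. exact: (linN (innl e)). Qed.

Lemma inner0r e : << e, 0 >> = 0. Proof. exact: (lin0 (innl e)). Qed.

Lemma innerZr e c f : << e, c *: f >> = c *: << e, f >>.
Proof. exact: (linZ (innl e)). Qed.

Lemma inner_sumr (I : Type) (r : seq I) (P : pred I) (F : I -> E) e :
  << e, \sum_(i <- r | P i) F i >> = \sum_(i <- r | P i) << e, F i >>.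
Proof. exact: (lin_sum (innl e)). Qed.

Lemma innerDl e f g : << e + f, g >> = << e, g >> + << f, g >>.
Proof. by rewrite -!(hm_inner_sym g) innerDr cs_starD. Qed.

Lemma inner0l e : << 0, e >> = 0.
Proof. by rewrite -(hm_inner_sym e) inner0r cstar0. Qed.

Lemma innerNl e f : << - e, f >> = - << e, f >>.
Proof.
by apply/eqP; rewrite -subr_eq0 opprK -innerDl addNr inner0l.
Qed.

Lemma innerZl c e f : << c *: e, f >> = c^* *: << e, f >>.
Proof. by rewrite -!(hm_inner_sym f) innerZr cs_starZ. Qed.

Lemma inner_suml (I : Type) (r : seq I) (P : pred I) (F : I -> E) e :
  << \sum_(i <- r | P i) F i, e >> = \sum_(i <- r | P i) << F i, e >>.
Proof.
rewrite -hm_inner_sym inner_sumr cstar_sum.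
by apply: eq_bigr => i _; rewrite hm_inner_sym.
Qed.

Lemma innerMl e b f : << hm_act e b, f >> = st b ** << e, f >>.
Proof. by rewrite -!(hm_inner_sym f) hm_innerM cs_starM. Qed.

Lemma actDl e f b : hm_act (e + f) b = hm_act e b + hm_act f b.
Proof. exact: (linD ((@hm_act_bilinear R B E).2 b)). Qed.

Lemma actDr e b c : hm_act e (b + c) = hm_act e b + hm_act e c.
Proof. exact: (linD ((@hm_act_bilinear R B E).1 e)). Qed.

Lemma act0l b : hm_act (0 : E) b = 0.
Proof. exact: (lin0 ((@hm_act_bilinear R B E).2 b)). Qed.

Lemma actZl c e b : hm_act (c *: e) b = c *: hm_act e b.
Proof. exact: (linZ ((@hm_act_bilinear R B E).2 b)). Qed.

Lemma actZr c e b : hm_act e (c *: b) = c *: hm_act e b.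
Proof. exact: (linZ ((@hm_act_bilinear R B E).1 e)). Qed.

Lemma act_suml (I : Type) (r : seq I) (P : pred I) (F : I -> E) b :
  hm_act (\sum_(i <- r | P i) F i) b = \sum_(i <- r | P i) hm_act (F i) b.
Proof. exact: (lin_sum ((@hm_act_bilinear R B E).2 b)). Qed.

Lemma sumsq_inner e : sumsq << e, e >>.
Proof. exact/sumsq_positive/hm_inner_ge0. Qed.

Definition vip I (z w : I -> E) : B := \sum_i << z i, w i >>.

(** The norm of the direct sum Hilbert module [E^I]. *)
Definition vn I (z : I -> E) : R := Num.sqrt (cs_norm (vip z z)).

Lemma vn_ge0 I (z : I -> E) : 0 <= vn z. Proof. exact: sqrtr_ge0. Qed.

Lemma vn_sq I (z : I -> E) : vn z ^+ 2 = cs_norm (vip z z).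
Proof. by rewrite sqr_sqrtr// cnorm_ge0. Qed.

Lemma sumsq_vip I (z : I -> E) : sumsq (vip z z).
Proof. by apply: sumsq_sum => i _; exact: sumsq_inner. Qed.

Lemma vip_sym I (z w : I -> E) : st (vip z w) = vip w z.
Proof. by rewrite cstar_sum; apply: eq_bigr => i _; rewrite hm_inner_sym. Qed.

Hypothesis HB : has_mxnorms B.

(* Expand [<z a - w, z a - w>] at [a = u / t], where [u = <z, w>] and
   [|<z, z>| <= t]; it is a sum of squares, so dropping it from the right-hand
   side of [a^* <z, z> a + <w, w> = 2 u^* u / t + <z a - w, z a - w>] gives
   [2 |u|^2 / t <= |u|^2 / t + |<w, w>|]. *)
Lemma vip_le I (z w : I -> E) : cs_norm (vip z w) <= vn z * vn w.
Proof.
apply: sqr_le_mul; rewrite ?vn_ge0// !vn_sq.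
set u := vip z w; set G := vip z z; set W := vip w w.
(* A positive [t] replaces [cs_norm G], which has to be inverted and may be 0; afterwards [t] tends
   to [cs_norm G]. *)
suff key t : 0 < t -> cs_norm G <= t -> cs_norm u ^+ 2 <= t * cs_norm W.
  have [W0|W0] := eqVneq (cs_norm W) 0.
    rewrite W0 mulr0; have := key (cs_norm G + 1).
    by rewrite W0 mulr0; apply; rewrite ?lerDl// ltr_wpDl// cnorm_ge0.
  have {}W0 : 0 < cs_norm W by rewrite lt_neqAle eq_sym W0 cnorm_ge0.
  rewrite -ler_pdivrMr//; apply/ler_addgt0Pr => d d0; rewrite ler_pdivrMr//.
  by apply: key; rewrite ?ltr_wpDl ?cnorm_ge0// lerDl ltW.
move=> t0 Gt; pose s := t^-1; have s0 : 0 < s by rewrite invr_gt0.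
pose a := rs s u; pose y i := hm_act (z i) a - w i.
have yE : rs (s ^+ 2) (st u ** G ** u) + W = rs (2 * s) (st u ** u) + vip y y.
  have -> : vip y y = st a ** G ** a - st a ** u - st u ** a + W.
    rewrite [st u]vip_sym /G /u /W /vip !cmul_sumr !cmul_suml.
    rewrite -!sumrB -big_split.
    apply: eq_bigr => i _ /=; rewrite /y innerDr innerNr !innerDl !innerNl.
    rewrite !hm_innerM !innerMl opprB addrA addrAC; congr (_ + _).
    exact: addrAC.
  have -> : st a ** G ** a = rs (s ^+ 2) (st u ** G ** u).
    by rewrite /a cstarZr cmulZl cmulZl cmulZr scalerA -rmorphM.
  have -> : st a ** u = rs s (st u ** u) by rewrite /a cstarZr cmulZl.
  have -> : st u ** a = rs s (st u ** u) by rewrite /a cmulZr.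
  have -> : rs (2 * s) (st u ** u) = rs s (st u ** u) + rs s (st u ** u).
    by rewrite -scalerDl -rmorphD mulrDl !mul1r.
  rewrite addrA; congr (_ + _).
  by rewrite -[_ - _ - rs s _]addrA -opprD [RHS]addrC subrK.
have u0 : 0 <= cs_norm u := cnorm_ge0 u.
have h1 : 2 * s * cs_norm u ^+ 2 <= s * cs_norm u ^+ 2 + cs_norm W.
  rewrite -cnorm_sq -cnormZr ?mulr_ge0 ?(ltW s0)//.
  apply: (le_trans (sumsq_le HB _ (sumsq_vip y))).
    by apply: sumsqZ; rewrite ?mulr_ge0 ?(ltW s0)//; exact: sumsq_sq.
  rewrite -yE (le_trans (cnormD _ _))// lerD2r cnormZr ?sqr_ge0// cnorm_sq.
  apply: (@le_trans _ _ (s ^+ 2 * (cs_norm u * t * cs_norm u))).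
    rewrite ler_wpM2l ?sqr_ge0// (le_trans (cnormM _ _))// ler_wpM2r//.
    rewrite (le_trans (cnormM _ _))// cnorm_star ler_wpM2l//.
  have st1 : s * t = 1 by rewrite mulVf ?gt_eqF.
  rewrite (_ : s ^+ 2 * _ = (s * t) * (s * cs_norm u ^+ 2)); last by ring.
  by rewrite st1 mul1r.
have : s * cs_norm u ^+ 2 <= cs_norm W by lra.
by rewrite mulrC ler_pdivrMr// mulrC.
Qed.

End HilbertVectors.

Lemma sqr_le_cancel (R : realType) (x k : R) :
  0 <= k -> x ^+ 2 <= k * x -> x <= k.
Proof.
move=> k0 h; have [x0|x0] := leP x 0; first exact: le_trans x0 k0.
by rewrite -(ler_pM2r x0) -expr2.
Qed.

Section VectorNorms.
Variables (R : realType) (B : cstarAlgebra R) (E : hilbertModule B).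
Hypothesis HB : has_mxnorms B.
Implicit Types (e f : E) (I : finType).
Local Notation "<< e , f >>" := (hm_inner e f).

Lemma eq_vip I (z z' w w' : I -> E) : z =1 z' -> w =1 w' -> vip z w = vip z' w'.
Proof. by move=> zz ww; apply: eq_bigr => i _; rewrite zz ww. Qed.

Lemma eq_vn I (z w : I -> E) : z =1 w -> vn z = vn w.
Proof. by move=> zw; rewrite /vn (eq_vip zw zw). Qed.

Lemma vn0 I : vn (fun _ : I => 0 : E) = 0.
Proof.
by rewrite /vn /vip big1 ?cnorm0 ?sqrtr0// => i _; rewrite inner0l.
Qed.

Lemma vnD I (z w : I -> E) : vn (fun i => z i + w i) <= vn z + vn w.
Proof.
rewrite -ler_sqr ?nnegrE ?addr_ge0 ?vn_ge0// vn_sq.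
have -> : vip (fun i => z i + w i) (fun i => z i + w i) =
    (vip z z + vip z w) + (vip w z + vip w w).
  by rewrite /vip -!big_split; apply: eq_bigr => i _; rewrite innerDl !innerDr.
rewrite (le_trans (cnormD _ _))//.
have le1 := cnormD (vip z z) (vip z w); have le2 := cnormD (vip w z) (vip w w).
have l3 := vip_le HB z w; have l4 := vip_le HB w z.
have := vn_sq z; have := vn_sq w; move: le1 le2 l3 l4; nra.
Qed.

Lemma vn_sum I (J : Type) (r : seq J) (z : J -> I -> E) :
  vn (fun i => \sum_(j <- r) z j i) <= \sum_(j <- r) vn (z j).
Proof.
elim: r => [|j r IH].
  by rewrite big_nil (eq_vn (w := fun=> 0)) ?vn0// => i; rewrite big_nil.
rewrite big_cons (eq_vn (w := fun i => z j i + \sum_(k <- r) z k i)).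
  by rewrite (le_trans (vnD _ _))// lerD2l.
by move=> i; rewrite big_cons.
Qed.

Lemma vnZ I (r : R) (z : I -> E) : 0 <= r ->
  vn (fun i => rs r (z i)) = r * vn z.
Proof.
move=> r0; rewrite /vn (_ : vip _ _ = rs (r ^+ 2) (vip z z)).
  by rewrite cnormZr ?sqr_ge0// sqrtrM ?sqr_ge0// sqrtr_sqr ger0_norm.
rewrite /vip scaler_sumr; apply: eq_bigr => i _.
rewrite innerZl innerZr scalerA.
by congr (_ *: _); rewrite expr2 rmorphM/=; congr (_ * _); exact: conjc_real.
Qed.

(** The terms outside the image of [h] are squares, which [sumsq_le] drops. *)
Lemma vn_sub I (J : finType) (h : I -> J) (z : J -> E) : injective h ->
  vn (fun i => z (h i)) <= vn z.
Proof.
move=> hinj; rewrite -ler_sqr ?nnegrE ?vn_ge0// !vn_sq.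
rewrite {2}/vip (bigID (mem (codom h)))/=.
have -> : vip (fun i => z (h i)) (fun i => z (h i)) =
    \sum_(j in codom h) << z j, z j >>.
  rewrite -big_filter /vip; set s := [seq i <- _ | _].
  have /(perm_big _)-> : perm_eq s (codom h).
    apply: uniq_perm; rewrite ?filter_uniq ?index_enum_uniq//.
      by rewrite map_inj_uniq ?enum_uniq.
    by move=> j; rewrite mem_filter mem_index_enum andbT.
  by rewrite big_map big_enum.
by apply: sumsq_le => //; apply: sumsq_sum => i _; exact: sumsq_inner.
Qed.

Lemma vn_pad I (L : finType) (l0 : L) (z : I -> E) :
  vn (fun p : I * L => z p.1 *+ (p.2 == l0)) = vn z.
Proof.
congr (Num.sqrt (cs_norm _)); rewrite /vip.
rewrite -(pair_bigA _ (fun i l => << z i *+ (l == l0), z i *+ (l == l0) >>))/=.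
apply: eq_bigr => i _; rewrite (bigD1 l0)//= eqxx mulr1n big1 ?addr0// => l.
by move=> /negPf->; rewrite mulr0n inner0l.
Qed.

Lemma hm_norm_ge0 e : 0 <= hm_norm e. Proof. exact: sqrtr_ge0. Qed.

Lemma hm_norm_sq e : hm_norm e ^+ 2 = cs_norm << e, e >>.
Proof. by rewrite sqr_sqrtr// cnorm_ge0. Qed.

Lemma hm_normE e : hm_norm e = vn (fun _ : 'I_1 => e).
Proof. by rewrite /vn /vip big_ord1. Qed.

Lemma hm_norm0 : hm_norm (0 : E) = 0.
Proof. by rewrite hm_normE vn0. Qed.

Lemma hm_normN e : hm_norm (- e) = hm_norm e.
Proof. by rewrite /hm_norm innerNl innerNr opprK. Qed.

Lemma hm_normD e f : hm_norm (e + f) <= hm_norm e + hm_norm f.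
Proof. by rewrite !hm_normE; exact: vnD. Qed.

Lemma hm_norm_sum (J : Type) (r : seq J) (P : pred J) (F : J -> E) :
  hm_norm (\sum_(j <- r | P j) F j) <= \sum_(j <- r | P j) hm_norm (F j).
Proof.
elim/big_rec2: _ => [|j y1 y2 _ h]; first by rewrite hm_norm0.
by rewrite (le_trans (hm_normD _ _))// lerD2l.
Qed.

Lemma hm_normZr (r : R) e : 0 <= r -> hm_norm (rs r e) = r * hm_norm e.
Proof. by move=> r0; rewrite !hm_normE vnZ. Qed.

Lemma inner_le e f : cs_norm << e, f >> <= hm_norm e * hm_norm f.
Proof.
have := vip_le HB (fun _ : 'I_1 => e) (fun _ : 'I_1 => f).
by rewrite -!hm_normE /vip big_ord1.
Qed.

Lemma hm_norm_le_vn I (z : I -> E) i : hm_norm (z i) <= vn z.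
Proof.
rewrite hm_normE (eq_vn (w := fun k : 'I_1 => z ((fun=> i) k)))//.
by apply: (@vn_sub _ _ (fun _ : 'I_1 => i)) => k l; rewrite !ord1.
Qed.

Lemma vn_le_sum I (z : I -> E) : vn z <= \sum_i hm_norm (z i).
Proof.
apply: sqr_le_cancel; first by apply: sumr_ge0 => i _; exact: hm_norm_ge0.
rewrite vn_sq (le_trans (cnorm_sum _ _ _))// mulr_suml; apply: ler_sum => i _.
by rewrite -hm_norm_sq expr2 ler_wpM2l ?hm_norm_ge0 ?hm_norm_le_vn.
Qed.

Section Amplification.
Variables (T S : E -> E) (c : R).
Hypotheses (TS : hm_adjoint T S) (c0 : 0 <= c).

Lemma adjoint_bound : (forall e, hm_norm (T e) <= c * hm_norm e) ->
  forall e, hm_norm (S e) <= c * hm_norm e.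
Proof.
move=> Tc e; apply: sqr_le_cancel; rewrite ?mulr_ge0 ?hm_norm_ge0//.
rewrite hm_norm_sq -TS (le_trans (inner_le _ _))//.
by rewrite mulrAC ler_wpM2r ?hm_norm_ge0.
Qed.

(** For the self-adjoint [H = S T] the norms of [H^k w] form a log-convex sequence by [vip_le].
    Entry by entry they are at most [c^(2k)] times a constant depending on [w], which [logconvex_le]
    removes, so [E^I] inherits the bound of [E]. Finally [|T z|^2 = |<z, H z>|]. *)
Lemma vn_adjoint I (z : I -> E) : (forall e, hm_norm (T e) <= c * hm_norm e) ->
  vn (fun i => T (z i)) <= c * vn z.
Proof.
move=> Tc; pose H e := S (T e).
have Hs e f : << H e, f >> = << e, H f >>.
  by rewrite -[LHS]hm_inner_sym -TS hm_inner_sym TS.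
have Hc e : hm_norm (H e) <= c ^+ 2 * hm_norm e.
  rewrite (le_trans (adjoint_bound Tc _))// expr2 -mulrA.
  by rewrite ler_wpM2l.
have HH (w : I -> E) : vn (fun i => H (w i)) <= c ^+ 2 * vn w.
  pose a k := vn (fun i => iter k H (w i)).
  apply: (@logconvex_le _ a _ (\sum_i hm_norm (w i))).
  - by move=> k; exact: vn_ge0.
  - move=> k; rewrite vn_sq (le_trans _ (vip_le HB _ _))//.
    by apply: eq_ler; congr cs_norm;
      apply: eq_bigr => i _; rewrite !iterS Hs.
  - exact: sqr_ge0.
  - move=> k; apply: (le_trans (vn_le_sum _)); rewrite mulr_suml.
    apply: ler_sum => i _; elim: k => [|k IH]; first by rewrite expr0 mulr1.
    rewrite iterS (le_trans (Hc _))// [_ ^+ k.+1]exprS mulrCA ler_wpM2l//.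
    exact: sqr_ge0.
have cv : 0 <= c * vn z by rewrite mulr_ge0 ?vn_ge0.
rewrite -ler_sqr ?nnegrE ?vn_ge0// vn_sq.
rewrite (_ : vip _ _ = vip z (fun i => H (z i))).
  rewrite (le_trans (vip_le HB _ _))// exprMn [vn z ^+ 2]expr2 mulrCA.
  by rewrite ler_wpM2l ?vn_ge0.
by apply: eq_bigr => i _; rewrite TS.
Qed.

End Amplification.
End VectorNorms.

Local Notation bn := (@vn _ _ (self_module _) _).

(** * Matrix norms as operator norms on columns *)

Section Kernels.
Variables (R : realType) (B : cstarAlgebra R) (E : hilbertModule B).

Definition kact (I J : finType) (x : I -> J -> E) (v : J -> B) (i : I) : E :=
  \sum_j hm_act (x i j) (v j).

(** The matrix [x^* y] over [B]; [kact_vip] then reads [<x v, y w> = <v, (x^* y) w>]. *)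
Definition gram (I J K : finType) (x : I -> J -> E) (y : I -> K -> E)
    (j : J) (k : K) : B := \sum_i hm_inner (x i j) (y i k).

Lemma kact_vip (I J K : finType) (x : I -> J -> E) (y : I -> K -> E) v w :
  vip (kact x v) (kact y w) =
  @vip _ _ (self_module B) _ v (fun j => \sum_k gram x y j k ** w k).
Proof.
rewrite /vip; under eq_bigr => i _.
  rewrite inner_suml; under eq_bigr => j _.
    rewrite inner_sumr; under eq_bigr do rewrite innerMl hm_innerM.
    over.
  over.
rewrite exchange_big; apply: eq_bigr => j _ /=; rewrite cmul_sumr exchange_big.
apply: eq_bigr => k _ /=; rewrite /gram cmul_suml cmul_sumr.
by apply: eq_bigr => i _; rewrite cs_mulA.
Qed.

End Kernels.

Section MatrixNorms.
Variables (R : realType) (B : cstarAlgebra R).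
Hypothesis HB : has_mxnorms B.
Local Notation mm := (mxbil (@cs_mul R B)).
Local Notation bv := (@kact R B (self_module B) _ _).

Lemma mm_colm n (a : 'M[B]_n.+1) (v : 'I_n.+1 -> B) :
  mm a (colm v) = colm (bv a v).
Proof.
apply/matrixP => i j; rewrite !mxE /kact -sumrMnl.
by apply: eq_bigr => k _; rewrite mxE cmulMnr.
Qed.

Lemma bn_colm n (v : 'I_n.+1 -> B) : bn v = cs_mxnorm (colm v).
Proof.
by rewrite /vn -colm_norm// sqrtr_sqr ger0_norm// mxnorm_ge0.
Qed.

Lemma mxnorm_act n (a : 'M[B]_n) (v : 'I_n -> B) :
  bn (bv a v) <= cs_mxnorm a * bn v.
Proof.
case: n a v => [|n] a v.
  by rewrite /vn /vip !big_ord0 cnorm0 sqrtr0 mulr0.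
by rewrite !bn_colm -mm_colm mxnormM.
Qed.

Lemma bv_star n (a : 'M[B]_n) (v w : 'I_n -> B) :
  @vip _ _ (self_module B) _ v (bv a w) = vip (bv (cs_mxstar a) v) w.
Proof.
rewrite /vip /kact /=; under eq_bigr do rewrite cmul_sumr.
rewrite exchange_big; apply: eq_bigr => j _ /=; rewrite cstar_sum cmul_suml.
by apply: eq_bigr => i _; rewrite !mxE cs_starM cs_starK cs_mulA.
Qed.

Lemma bv_mm n (a b : 'M[B]_n) (v : 'I_n -> B) : bv (mm a b) v =1 bv a (bv b v).
Proof.
move=> i; rewrite /kact /=; under eq_bigr do rewrite mxE cmul_suml.
rewrite exchange_big; apply: eq_bigr => k _ /=; rewrite cmul_sumr.
by apply: eq_bigr => j _; rewrite cs_mulA.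
Qed.

(** Together with [mxnorm_act] this identifies the C*-norm with the operator norm on [B^n]. For
    [h = a^* a] the norms of [h^k p] are log-convex by the C*-identity, and column by column they
    are at most [c^(2k)] times a constant, so [|h p| <= c^2 |p|]; take [p = h]. *)
Lemma mxnorm_le n (a : 'M[B]_n) (c : R) : 0 <= c ->
  (forall v : 'I_n -> B, bn (bv a v) <= c * bn v) -> cs_mxnorm a <= c.
Proof.
move=> c0 ac; pose h := mm (cs_mxstar a) a.
have hs : cs_mxstar h = h by rewrite mxstarM mxstarK.
have asc v : bn (bv (cs_mxstar a) v) <= c * bn v.
  apply: sqr_le_cancel; rewrite ?mulr_ge0 ?vn_ge0// vn_sq -bv_star.
  by rewrite (le_trans (vip_le HB _ _))// mulrC mulrAC ler_wpM2r ?vn_ge0.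
have hc v : bn (bv h v) <= c ^+ 2 * bn v.
  rewrite (eq_vn (bv_mm _ _ _)) (le_trans (asc _))// expr2 -mulrA.
  by rewrite ler_wpM2l.
have hle p : cs_mxnorm (mm h p) <= c ^+ 2 * cs_mxnorm p.
  pose s k := cs_mxnorm (iter k (mm h) p).
  apply: (@logconvex_le _ s _ (\sum_i \sum_j bn (fun k => p k j))).
  - by move=> k; exact: mxnorm_ge0.
  - move=> k; rewrite /s -mxnorm_sq// !iterS mxstarM hs -mmA.
    by rewrite (le_trans (mxnormM HB _ _))// mxnorm_star.
  - exact: sqr_ge0.
  - move=> k; rewrite (le_trans (mxnorm_le_sum HB _))// mulr_suml.
    apply: ler_sum => i _; rewrite mulr_suml; apply: ler_sum => j _.
    pose col k : 'I_n -> B := fun m => iter k (mm h) p m j.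
    apply: (@le_trans _ _ (bn (col k))).
      have := @hm_norm_le_vn _ _ (self_module B) HB _ (col k) i.
      by rewrite /hm_norm /= cnorm_sq sqrtr_sqr ger0_norm// cnorm_ge0.
    elim: k => [|k IH]; first by rewrite expr0 mulr1.
    rewrite (@eq_vn _ _ (self_module B) _ (col k.+1) (bv h (col k)))
      => [|m]; last by rewrite /col iterS mxE.
    rewrite (le_trans (hc _))// [_ ^+ k.+1]exprS mulrCA ler_wpM2l//.
    exact: sqr_ge0.
have h2 : cs_mxnorm h <= c ^+ 2.
  apply: sqr_le_cancel; rewrite ?sqr_ge0// -mxnorm_sq// hs.
  exact: hle.
by rewrite -ler_sqr ?nnegrE ?mxnorm_ge0// -mxnorm_sq.
Qed.

Section Hilbert.
Variable E : hilbertModule B.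

Lemma mxinnerE n (x y : 'M[E]_n) i j : hm_mxinner x y i j = gram x y i j.
Proof. by rewrite mxE. Qed.

Lemma gram_bv n (x y : 'M[E]_n) v i :
  \sum_k gram x y i k ** v k = bv (hm_mxinner x y) v i.
Proof. by apply: eq_bigr => k _; rewrite mxinnerE. Qed.

Lemma hm_mxnorm_act n (x : 'M[E]_n) (v : 'I_n -> B) :
  vn (kact x v) <= hm_mxnorm x * bn v.
Proof.
rewrite -ler_sqr ?nnegrE ?mulr_ge0 ?vn_ge0 ?hm_mxnorm_ge0// exprMn.
rewrite [hm_mxnorm x ^+ 2]sqr_sqrtr ?mxnorm_ge0// vn_sq kact_vip.
rewrite (le_trans (vip_le HB _ _))// expr2 mulrCA ler_wpM2l ?vn_ge0//.
by rewrite (@eq_vn _ _ (self_module B) _ _ _ (gram_bv x x v)) mxnorm_act.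
Qed.

(** By [mxnorm_le] it is enough to bound [w = x^* x v], and [<w, w> = <x w, x v>] gives
    [|w|^2 <= c |w| * c |v|]. *)
Lemma hm_mxnorm_le n (x : 'M[E]_n) (c : R) : 0 <= c ->
  (forall v : 'I_n -> B, vn (kact x v) <= c * bn v) -> hm_mxnorm x <= c.
Proof.
move=> c0 xc; rewrite -ler_sqr ?nnegrE ?hm_mxnorm_ge0//.
rewrite sqr_sqrtr ?mxnorm_ge0//; apply: mxnorm_le => [|v]; first exact: sqr_ge0.
apply: sqr_le_cancel; rewrite ?mulr_ge0 ?sqr_ge0 ?vn_ge0// vn_sq.
set w := bv _ v; rewrite (_ : vip w w = vip (kact x w) (kact x v)).
  rewrite (le_trans (vip_le HB _ _))//.
  apply: (@le_trans _ _ ((c * bn w) * (c * bn v))).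
    by rewrite ler_pM ?vn_ge0 ?xc.
  by apply: eq_ler; ring.
by rewrite kact_vip; apply: eq_bigr => i _; rewrite gram_bv.
Qed.

End Hilbert.
End MatrixNorms.

(** * Square matrices indexed by a finite type *)

Section FinMatrix.

(* Naming the cardinal and the two coercions keeps the collective predicate
   hidden in [#|I|] syntactically canonical when [I] is a product. *)
Definition fcard (I : finType) : nat := #|I|.

Definition fval (I : finType) (a : 'I_(fcard I)) : I := enum_val a.

Definition frank (I : finType) (i : I) : 'I_(fcard I) := enum_rank i.

Lemma fvalK (I : finType) : cancel (@fval I) (@frank I).
Proof. exact: enum_valK. Qed.

Lemma frankK (I : finType) : cancel (@frank I) (@fval I).
Proof. exact: enum_rankK. Qed.

Definition fm (V : Type) (I : finType) (x : I -> I -> V) : 'M[V]_(fcard I) :=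
  \matrix_(i, j) x (fval i) (fval j).

Lemma sum_fval (V : nmodType) (I : finType) (F : I -> V) :
  \sum_(i < fcard I) F (fval i) = \sum_i F i.
Proof.
by rewrite [RHS](reindex _ (onW_bij _ (Bijective (@fvalK I) (@frankK I)))).
Qed.

Lemma mxbil_fm (U V : Type) (W : zmodType) (Phi : U -> V -> W) (I : finType)
    (x : I -> I -> U) (y : I -> I -> V) :
  mxbil Phi (fm x) (fm y) = fm (fun i j => \sum_k Phi (x i k) (y k j)).
Proof.
apply/matrixP => i j; rewrite !mxE -[RHS]sum_fval.
by apply: eq_bigr => k _; rewrite !mxE.
Qed.

Lemma map_fm (U V : Type) (f : U -> V) (I : finType) (x : I -> I -> U) :
  map_mx f (fm x) = fm (fun i j => f (x i j)).
Proof. by apply/matrixP => i j; rewrite !mxE. Qed.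

Lemma eq_fm (V : Type) (I : finType) (x y : I -> I -> V) :
  (forall i j, x i j = y i j) -> fm x = fm y.
Proof. by move=> h; apply/matrixP => i j; rewrite !mxE. Qed.

Variables (R : realType) (B : cstarAlgebra R) (E : hilbertModule B).

Lemma vn_fval (I : finType) (z : I -> E) :
  vn (fun i : 'I_(fcard I) => z (fval i)) = vn z.
Proof.
congr (Num.sqrt (cs_norm _)).
exact: (sum_fval (fun i => hm_inner (z i) (z i))).
Qed.

Lemma kact_fm (I : finType) (x : I -> I -> E) (v : 'I_(fcard I) -> B) :
  vn (kact (fm x) v) = vn (kact x (fun i => v (frank i))).
Proof.
rewrite -[RHS]vn_fval; apply: eq_vn => i; rewrite /kact.
rewrite -[RHS]sum_fval; apply: eq_bigr => j _.
by rewrite mxE fvalK.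
Qed.

End FinMatrix.

Section FinMatrixNorms.
Variables (R : realType) (B : cstarAlgebra R).
Hypothesis HB : has_mxnorms B.

Lemma bn_frank (I : finType) (v : 'I_(fcard I) -> B) :
  bn (fun i : I => v (frank i)) = bn v.
Proof.
rewrite -[LHS](@vn_fval _ _ (self_module B)); apply: eq_vn => i.
by rewrite fvalK.
Qed.

Lemma hm_mxnorm_fm_le (E : hilbertModule B) (I : finType) (x : I -> I -> E)
    (c : R) : 0 <= c ->
  (forall v : I -> B, vn (kact x v) <= c * bn v) -> hm_mxnorm (fm x) <= c.
Proof.
move=> c0 xc; apply: hm_mxnorm_le => // v.
by rewrite kact_fm -(bn_frank v).
Qed.

Lemma mxnorm_fm_le (I : finType) (a : I -> I -> B) (c : R) : 0 <= c ->
  (forall v : I -> B, bn (@kact _ _ (self_module B) _ _ a v) <= c * bn v) ->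
  cs_mxnorm (fm a) <= c.
Proof.
move=> c0 ac; apply: mxnorm_le => // v.
by rewrite (@kact_fm _ _ (self_module B)) -(bn_frank v).
Qed.

End FinMatrixNorms.

(** * Rows over [E] and their adjoint columns *)

Section RowsAndColumns.
Variables (R : realType) (B : cstarAlgebra R) (E : hilbertModule B).
Hypothesis HB : has_mxnorms B.
Variable L : finType.
Implicit Types (h : L -> E) (K : R).

(** Concerns the operator [v |-> \sum_l h_l v_l] from [B^L] to [E], and [col_bound] its adjoint; [I]
    ranges over the amplifications that matrix norms call for. *)
Definition row_bound K h := forall (I : finType) (v : I -> L -> B),
  vn (fun i => \sum_l hm_act (h l) (v i l)) <=
  K * bn (fun p : I * L => v p.1 p.2).

Definition col_bound K h := forall (I : finType) (z : I -> E),
  bn (fun p : I * L => hm_inner (h p.2) (z p.1)) <= K * vn z.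

Lemma row_col_vip h (I : finType) (z : I -> E) (v : I -> L -> B) :
  vip z (fun i => \sum_l hm_act (h l) (v i l)) =
  @vip _ _ (self_module B) _ (fun p : I * L => hm_inner (h p.2) (z p.1))
    (fun p : I * L => v p.1 p.2).
Proof.
rewrite /vip -(pair_bigA _ (fun i l => st (hm_inner (h l) (z i)) ** v i l))/=.
apply: eq_bigr => i _; rewrite inner_sumr; apply: eq_bigr => l _.
by rewrite hm_innerM hm_inner_sym.
Qed.

Lemma row_to_col K h : 0 <= K -> row_bound K h -> col_bound K h.
Proof.
move=> K0 hr I z; apply: sqr_le_cancel; rewrite ?mulr_ge0 ?vn_ge0// vn_sq.
rewrite -(row_col_vip h z (fun i l => hm_inner (h l) (z i))).
rewrite (le_trans (vip_le HB _ _))// mulrAC [leRHS]mulrC ler_wpM2l ?vn_ge0//.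
Qed.

Lemma col_to_row K h : 0 <= K -> col_bound K h -> row_bound K h.
Proof.
move=> K0 hc I v; set z := fun i : I => _.
apply: sqr_le_cancel; rewrite ?mulr_ge0 ?vn_ge0// vn_sq.
rewrite {2}/z row_col_vip (le_trans (vip_le HB _ _))// [leRHS]mulrAC.
by rewrite ler_wpM2r ?vn_ge0.
Qed.

Lemma row_bound_adjoint K h (T S : E -> E) (c : R) : 0 <= c -> 0 <= K ->
  linear T -> (forall e b, T (hm_act e b) = hm_act (T e) b) ->
  hm_adjoint T S -> (forall e, hm_norm (T e) <= c * hm_norm e) ->
  row_bound K h -> row_bound (c * K) (fun l => T (h l)).
Proof.
move=> c0 K0 linT Tact TS Tc hr I v.
rewrite (eq_vn (w := fun i => T (\sum_l hm_act (h l) (v i l)))).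
  by rewrite (le_trans (vn_adjoint HB TS c0 _ Tc))// -mulrA ler_wpM2l.
by move=> i; rewrite (lin_sum linT); apply: eq_bigr => l _; rewrite Tact.
Qed.

End RowsAndColumns.

Section SmallRows.
Variables (R : realType) (B : cstarAlgebra R) (E : hilbertModule B).
Hypothesis HB : has_mxnorms B.

(** [<e v, e v> = <v, <e, e> v>], and left multiplication by the self-adjoint [<e, e>] passes to
    [B^I] with the same bound by [vn_adjoint]. *)
Lemma vn_act (I : finType) (e : E) (v : I -> B) :
  vn (fun i => hm_act e (v i)) <= hm_norm e * bn v.
Proof.
have p0 : hm_adjoint (E := self_module B) (cs_mul (hm_inner e e))
    (cs_mul (hm_inner e e)).
  by move=> a b; rewrite /= cs_starM hm_inner_sym cs_mulA.
have pn (a : self_module B) : hm_norm (hm_inner e e ** a : self_module B) <=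
    cs_norm (hm_inner e e) * hm_norm a.
  rewrite /hm_norm /= !cnorm_sq !sqrtr_sqr !ger0_norm ?cnorm_ge0//.
  exact: cnormM.
rewrite -ler_sqr ?nnegrE ?mulr_ge0 ?vn_ge0 ?hm_norm_ge0// exprMn hm_norm_sq.
rewrite vn_sq (_ : vip _ _ =
    @vip _ _ (self_module B) _ v (fun i => hm_inner e e ** v i)).
  rewrite (le_trans (vip_le HB _ _))// expr2 mulrCA ler_wpM2l ?vn_ge0//.
  by apply: (vn_adjoint HB p0); rewrite ?cnorm_ge0.
by apply: eq_bigr => i _; rewrite innerMl hm_innerM.
Qed.

(** Too weak for frames, but it serves for single vectors and for scaling a family to a contractive
    row. *)
Lemma row_bound_crude (L : finType) (h : L -> E) :
  row_bound (\sum_l hm_norm (h l)) h.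
Proof.
move=> I v; rewrite (le_trans (vn_sum HB _ _))// mulr_suml.
apply: ler_sum => l _; rewrite (le_trans (vn_act _ _))//.
rewrite ler_wpM2l ?hm_norm_ge0//.
by apply: (@vn_sub _ _ (self_module B) HB _ _ (fun i => (i, l))
  (fun p => v p.1 p.2)) => i j [].
Qed.

Lemma row_bound_le (L : finType) (h : L -> E) (K K' : R) : K <= K' ->
  row_bound K h -> row_bound K' h.
Proof.
by move=> KK hK I v; rewrite (le_trans (hK _ _))// ler_wpM2r ?vn_ge0.
Qed.

End SmallRows.

(** * Frames *)

Lemma sum_pair (V : nmodType) (I J : finType) (F : I * J -> V) :
  \sum_p F p = \sum_i \sum_j F (i, j).
Proof. by rewrite pair_bigA; apply: eq_bigr => -[]. Qed.

(** Abel summation. In [frame_rho] it turns weighted differences of powers of [D] into [1] minus a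
    Cesaro mean. *)
Lemma sum_abel (V : zmodType) (x : nat -> V) (M : nat) :
  \sum_(j < M) (x j - x j.+1) *+ (M - j) = x 0%N *+ M - \sum_(j < M) x j.+1.
Proof.
have tele k : \sum_(j < k) (x j - x j.+1) = x 0%N - x k.
  elim: k => [|k IH]; first by rewrite big_ord0 subrr.
  by rewrite big_ord_recr/= IH addrA subrK.
elim: M => [|M IH]; first by rewrite !big_ord0 mulr0n subr0.
have -> : \sum_(j < M.+1) (x j - x j.+1) *+ (M.+1 - j) =
    \sum_(j < M) (x j - x j.+1) *+ (M - j) + \sum_(j < M.+1) (x j - x j.+1).
  rewrite [LHS]big_ord_recr [X in _ = _ + X]big_ord_recr /= subSnn [RHS]addrA.
  congr (_ + _); rewrite -big_split; apply: eq_bigr => j _ /=.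
  by rewrite subSn ?mulrSr// ltnW.
by rewrite IH tele big_ord_recr/= mulrSr opprD addrACA.
Qed.

Section FiniteRank.
Variables (R : realType) (B : cstarAlgebra R) (E : hilbertModule B).
Variables (J : finType) (u v : J -> E).
Local Notation "<< e , f >>" := (hm_inner e f).

Definition finrank (e : E) : E := \sum_j hm_act (u j) << v j, e >>.

Lemma finrank_linear : linear finrank.
Proof.
move=> c e f; rewrite /finrank scaler_sumr -big_split; apply: eq_bigr => j _.
by rewrite /= innerDr innerZr actDr actZr.
Qed.

Lemma finrank_act e b : finrank (hm_act e b) = hm_act (finrank e) b.
Proof.
rewrite /finrank act_suml; apply: eq_bigr => j _.
by rewrite hm_innerM hm_actA.
Qed.

End FiniteRank.

Lemma finrank_adjoint (R : realType) (B : cstarAlgebra R)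
    (E : hilbertModule B) (J : finType) (u v : J -> E) :
  hm_adjoint (finrank u v) (finrank v u).
Proof.
move=> e f; rewrite /finrank inner_suml inner_sumr; apply: eq_bigr => j _.
by rewrite innerMl hm_innerM hm_inner_sym.
Qed.

Section Frames.
Variables (R : realType) (B : cstarAlgebra R) (E : hilbertModule B).
Hypothesis HB : has_mxnorms B.
Local Notation "<< e , f >>" := (hm_inner e f).

Section Contractive.
Variables (J : finType) (u : J -> E).
Hypothesis u1 : row_bound 1 u.

(** This is [u u^*]. As [u] is a contractive row, both [th] and [D = 1 - th] lie between 0 and 1 as
    operators; only norm consequences of this are derived. *)
Let th := finrank u u.
Let D (e : E) := e - th e.

Let thlin : linear th. Proof. exact: finrank_linear. Qed.
Let ths e f : << th e, f >> = << e, th f >>. Proof. exact: finrank_adjoint. Qed.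

Let Dlin : linear D.
Proof. by move=> c e f; rewrite /D thlin scalerBr opprD addrACA. Qed.

Let Ds e f : << D e, f >> = << e, D f >>.
Proof. by rewrite /D innerDl innerNl innerDr innerNr ths. Qed.

Let Dn k := iter k D.

Let DnS k e : Dn k.+1 e = D (Dn k e). Proof. by []. Qed.

Let Dnlin k : linear (Dn k).
Proof. by elim: k => [//|k IH] c e f; rewrite !DnS IH Dlin. Qed.

Let Dns k e f : << Dn k e, f >> = << e, Dn k f >>.
Proof.
by elim: k e f => [//|k IH] e f; rewrite DnS Ds IH /Dn -iterSr.
Qed.

Let thD e : th (D e) = D (th e). Proof. by rewrite /D (linB thlin). Qed.

Let thDn k e : th (Dn k e) = Dn k (th e).
Proof. by elim: k => [//|k IH]; rewrite !DnS thD IH. Qed.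

Let sq e := << e, th e >>.

Let sqE e : sq e = \sum_j st << u j, e >> ** << u j, e >>.
Proof.
rewrite /sq inner_sumr; apply: eq_bigr => j _.
by rewrite hm_innerM hm_inner_sym.
Qed.

(** The operator identity [1 + th^2 = 2 th + D^2], which [orbitE] iterates. *)
Let stepE e : << e, e >> + << th e, th e >> = sq e + sq e + << D e, D e >>.
Proof.
rewrite /D innerDl innerNl !innerDr !innerNr !ths -/(sq e) opprB.
by rewrite [X in _ = _ + X]addrACA -opprD [RHS]addrC subrK.
Qed.

Section Orbit.
Variables (I : finType) (z : I -> E) (m : nat).

Let W (q : I * 'I_m) := Dn q.2 (z q.1).
Let a (p : I * 'I_m * J) : B := << u p.2, W p.1 >>.
Let S : B := vip (E := self_module B) a a.

Let SE : S = \sum_i \sum_(j < m) sq (Dn j (z i)).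
Proof.
rewrite /S /vip sum_pair sum_pair.
by do 2!apply: eq_bigr => ? _; rewrite sqE.
Qed.

(* [1 + \sum_j D^j th^2 D^j = 2 \sum_j D^j th D^j + D^(2m)], where both sums are
   over [j < m]. As [|th w|^2 <= |<w, th w>|] for contractive rows, dropping
   squares bounds [\sum_j D^j th D^j] and [D^m] without functional calculus. *)
Let orbitE : vip z z + vip (th \o W) (th \o W) =
  S + S + vip (Dn m \o z) (Dn m \o z).
Proof.
rewrite SE /vip sum_pair -!big_split.
apply: eq_bigr => i _ /=.
have : forall k, << z i, z i >> +
      \sum_(j < k) << th (Dn j (z i)), th (Dn j (z i)) >> =
    \sum_(j < k) sq (Dn j (z i)) + \sum_(j < k) sq (Dn j (z i)) +
    << Dn k (z i), Dn k (z i) >>; last by apply.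
elim=> [|k IH]; first by rewrite !big_ord0 !add0r addr0.
rewrite !big_ord_recr/= addrA IH -addrA stepE addrA; congr (_ + _).
by rewrite addrACA.
Qed.

Let thW : vn (th \o W) <= bn a.
Proof.
have := u1 (I := (I * 'I_m)%type) (fun q l => << u l, W q >>).
by rewrite mul1r.
Qed.

Let sumsqS : sumsq S. Proof. exact: sumsq_vip. Qed.

Let aS : bn a ^+ 2 = cs_norm S. Proof. exact: vn_sq. Qed.

Let thW2 : cs_norm (vip (th \o W) (th \o W)) <= cs_norm S.
Proof. by rewrite -vn_sq -aS ler_sqr ?nnegrE ?vn_ge0. Qed.

Let bound : cs_norm (S + S + vip (Dn m \o z) (Dn m \o z)) <=
  vn z ^+ 2 + cs_norm S.
Proof.
by rewrite -orbitE vn_sq (le_trans (cnormD _ _))// lerD2l.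
Qed.

(** Dropping the last term of [orbitE] leaves [2 |S| <= |z|^2 + |S|], whatever the length [m] of the
    orbit. *)
Lemma orbit_col : bn a <= vn z.
Proof.
rewrite -ler_sqr ?nnegrE ?vn_ge0// aS -(lerD2r (cs_norm S)).
apply: le_trans bound; rewrite (le_trans _ (sumsq_le HB _ (sumsq_vip _)))//.
  have -> : S + S = rs 2 S by rewrite -[in LHS](scale1r S) -scalerDl -rmorphD.
  by rewrite cnormZr// mulrDl mul1r.
exact: sumsqD.
Qed.

(** Dropping [S + S] instead leaves [|z|^2 + |S| <= 2 |z|^2]; the constant 2 in place of its square
    root is a convenience. *)
Lemma orbit_iter : vn (Dn m \o z) <= 2 * vn z.
Proof.
rewrite -ler_sqr ?nnegrE ?mulr_ge0 ?vn_ge0// vn_sq.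
rewrite (le_trans (sumsq_ler HB _ _) (le_trans bound _))//.
- exact: sumsqD.
- exact: sumsq_vip.
- have := orbit_col; rewrite -ler_sqr ?nnegrE ?vn_ge0// aS => h.
  by rewrite exprMn; have := sqr_ge0 (vn z); lra.
Qed.

End Orbit.

Variable M : nat.
Local Notation N := M.+1.

(* As [th (1 + D) = 1 - D^2], the Cesaro weights [wt] turn the sum of the
   [g_p <h_p, .>] into [1 - rho], with [rho] the mean of [D^2, .., D^(2N)];
   and [rho u_j] tends to [0] because [rho th] is at most [2 / N]. *)
Let G (p : 'I_N * J) := Dn p.1 (u p.2).
Let wt (j : 'I_N) : R := (N - j)%:R / N%:R.
Let g (p : 'I_N * J) := rs (wt p.1) (G p).
Let h (p : 'I_N * J) := G p + Dn p.1.+1 (u p.2).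
Let rho e := rs (N%:R^-1) (\sum_(j < N) Dn j.+1.*2 e).

Let Dnorm k e : hm_norm (Dn k e) <= 2 * hm_norm e.
Proof. by rewrite !hm_normE; exact: (orbit_iter (fun _ : 'I_1 => e)). Qed.

Let Dadd k l e : Dn k (Dn l e) = Dn (k + l) e.
Proof. by rewrite /Dn iterD. Qed.

Let Dact k e b : Dn k (hm_act e b) = hm_act (Dn k e) b.
Proof.
elim: k => [//|k IH]; rewrite !DnS IH /D /th finrank_act.
by rewrite -[- _]scaleN1r -actZl scaleN1r -actDl.
Qed.

Let Gcol : col_bound 1 G.
Proof.
move=> I z; rewrite mul1r; apply: le_trans (orbit_col z N).
pose f (p : I * ('I_N * J)) := (p.1, p.2.1, p.2.2).
pose b (p : I * 'I_N * J) : self_module B := << u p.2, Dn p.1.2 (z p.1.1) >>.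
rewrite (@eq_vn _ _ (self_module B) _ _ (fun p => b (f p))).
  by apply: (vn_sub HB) => -[i [j l]] [i' [j' l']] [-> -> ->].
by move=> -[i [j l]]; rewrite /G /= Dns.
Qed.

Let wt01 p : 0 <= wt p <= 1.
Proof.
by rewrite /wt divr_ge0//= ler_pdivrMr// mul1r ler_nat leq_subr.
Qed.

(** The weights lie in [[0, 1]], so passing from [G] to [g] removes squares with coefficients
    [1 - wt^2] from the sum. *)
Lemma frame_colg : col_bound 1 g.
Proof.
move=> I z; apply: le_trans (Gcol z).
rewrite -ler_sqr ?nnegrE ?vn_ge0// !vn_sq.
set x := vip _ _; set y := vip _ _.
suff [t [tS ->]] : exists t : B, sumsq t /\ y = x + t.
  by apply: sumsq_le => //; exact: sumsq_vip.
exists (\sum_p rs (1 - wt p.2.1 ^+ 2)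
  (st << G p.2, z p.1 >> ** << G p.2, z p.1 >>)).
split.
  apply: sumsq_sum => p _; apply: sumsqZ; last exact: sumsq_sq.
  by case/andP: (wt01 p.2.1) => ? ?; rewrite subr_ge0 expr_le1.
rewrite /x /y /vip -big_split; apply: eq_bigr => p _ /=.
rewrite /g innerZl (_ : _^* = ((wt p.2.1)%:C)%C); last exact: conjc_real.
rewrite cstarZr cmulZl cmulZr scalerA -rmorphM -expr2 -scalerDl -rmorphD/=.
by rewrite addrC subrK scale1r.
Qed.

(** [<h_p, z> = <G_p, z + D z>], and [|z + D z| <= (1 + 2) |z|] by [orbit_iter]. *)
Lemma frame_colh : col_bound 3 h.
Proof.
move=> I z.
rewrite (@eq_vn _ _ (self_module B) _ _
  (fun p => << G p.2, z p.1 + D (z p.1) >>)).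
  rewrite (le_trans (Gcol (fun i => z i + D (z i))))// mul1r.
  rewrite (le_trans (vnD HB _ _))//.
  by have := orbit_iter z 1; rewrite /Dn /= /comp; lra.
by move=> p; rewrite /h /G innerDl DnS Ds innerDr.
Qed.

Let frameE p e : hm_act (g p) << h p, e >> =
  rs (wt p.1) (Dn p.1 (hm_act (u p.2) << u p.2, Dn p.1 (e + D e) >>)).
Proof.
rewrite Dact -[RHS]actZl; congr hm_act.
by rewrite /h innerDl DnS Ds !Dns -innerDr (linD (Dnlin _)).
Qed.

(** The terms with first index [j] add up to [(N - j) / N] times
    [D^j th D^j (1 + D) = D^(2j) - D^(2j+2)]. *)
Lemma frame_rho e : e - \sum_p hm_act (g p) << h p, e >> = rho e.
Proof.
have -> : \sum_p hm_act (g p) << h p, e >> =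
    rs (N%:R^-1) (\sum_(j < N) (Dn j.*2 e - Dn j.+1.*2 e) *+ (N - j)).
  rewrite sum_pair scaler_sumr; apply: eq_bigr => j _.
  under eq_bigr do rewrite frameE /=.
  rewrite -scaler_sumr -(lin_sum (Dnlin j)) -[\sum_i _]/(th (Dn j (e + D e))).
  rewrite thDn Dadd addnn.
  rewrite (_ : th _ = e - D (D e)); last first.
    by rewrite (linD thlin) {3}/D opprB addrCA /D subKr addrC.
  rewrite (linB (Dnlin _)) -[D (D e)]/(Dn 2 e) Dadd addn2 -doubleS.
  rewrite -[X in _ = _ *: X]scaler_nat scalerA /wt mulrC rmorphM/=.
  by rewrite rmorph_nat.
rewrite (sum_abel (fun j => Dn j.*2 e)) scalerBr.
have -> : rs (N%:R^-1) (Dn 0.*2 e *+ N) = e.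
  rewrite -[Dn _ e *+ N]scaler_nat scalerA.
  rewrite -(rmorph_nat (real_complex R)) -rmorphM.
  by rewrite mulVf ?pnatr_eq0// scale1r.
by rewrite subKr.
Qed.

Let rhos e f : << rho e, f >> = << e, rho f >>.
Proof.
rewrite /rho innerZl innerZr (_ : _^* = (N%:R^-1)%:C%C); last exact: conjc_real.
rewrite inner_suml inner_sumr; congr (_ *: _).
by apply: eq_bigr => j _; rewrite Dns.
Qed.

Let rho_th e : rho (th e) = th (rho e).
Proof.
rewrite /rho (linZ thlin) (lin_sum thlin); congr (_ *: _).
by apply: eq_bigr => j _; rewrite thDn.
Qed.

Let rho_bound e : hm_norm (rho e) <= 2 * hm_norm e.
Proof.
rewrite /rho hm_normZr ?invr_ge0// mulrC ler_pdivrMr// .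
rewrite (le_trans (hm_norm_sum HB _ _ _))//.
apply: (@le_trans _ _ (\sum_(j < N) 2 * hm_norm e)).
  by apply: ler_sum => j _; exact: Dnorm.
by rewrite sumr_const card_ord mulr_natr.
Qed.

(** [rho th = D^2 G G^* / N], where [G G^*] has norm at most 1 by [Gcol] and [D^2] at most 2 by
    [orbit_iter]. *)
Let rho_th_bound e : hm_norm (rho (th e)) <= 2 / N%:R * hm_norm e.
Proof.
have -> : rho (th e) = rs (N%:R^-1)
    (Dn 2 (\sum_p hm_act (G p) << G p, e >>)).
  rewrite /rho; congr (_ *: _); rewrite sum_pair (lin_sum (Dnlin 2)).
  apply: eq_bigr => j _.
  under eq_bigr do rewrite /G Dns -Dact.
  rewrite -(lin_sum (Dnlin j)) -[\sum_i _]/(th (Dn j e)) thDn !Dadd.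
  by rewrite -addnA addnn add2n -doubleS.
rewrite hm_normZr ?invr_ge0// (mulrC 2) -mulrA ler_wpM2l ?invr_ge0//.
rewrite (le_trans (Dnorm _ _))// ler_wpM2l//.
have := col_to_row HB ler01 Gcol (fun _ : 'I_1 => (fun p => << G p, e >>)).
rewrite -hm_normE mul1r => /le_trans; apply.
have := Gcol (fun _ : 'I_1 => e).
by rewrite -hm_normE mul1r.
Qed.

(** [th] dominates each [u_j]: [|<u_j, w>|^2 <= |<w, th w>|], by dropping squares. For [y = rho u_j]
    and [w = rho y] the left-hand side is [|y|^4], and since [rho] commutes with [th] the right-hand
    side is at most [2 |y| * (2 / N) |y|]. *)
Lemma frame_rho_le j : hm_norm (rho (u j)) ^+ 2 <= 4 / N%:R.
Proof.
set y := rho (u j); have y0 := hm_norm_ge0 y.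
have h1 : hm_norm y ^+ 2 <= cs_norm << u j, rho y >>.
  by rewrite hm_norm_sq /y rhos.
have h2 : cs_norm << u j, rho y >> ^+ 2 <= cs_norm (sq (rho y)).
  rewrite -cnorm_sq sqE (bigD1 j)//=; apply: sumsq_le => //.
    exact: sumsq_sq.
  by apply: sumsq_sum => k _; exact: sumsq_sq.
have h3 : cs_norm (sq (rho y)) <= 4 / N%:R * hm_norm y ^+ 2.
  rewrite /sq -rho_th (le_trans (inner_le HB _ _))//.
  rewrite (_ : _ * _ ^+ 2 = (2 * hm_norm y) * (2 / N%:R * hm_norm y));
    last by ring.
  by rewrite ler_pM ?hm_norm_ge0.
apply: sqr_le_cancel; first by rewrite divr_ge0.
apply: le_trans h3; apply: le_trans h2.
by rewrite ler_sqr ?nnegrE ?sqr_ge0 ?cnorm_ge0.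
Qed.

Lemma frame_contractive : exists g h : 'I_N * J -> E,
  [/\ col_bound 1 g, col_bound 3 h & forall j,
    hm_norm (u j - \sum_p hm_act (g p) << h p, u j >>) ^+ 2 <= 4 / N%:R].
Proof.
exists g, h; split; [exact: frame_colg|exact: frame_colh|move=> j].
by rewrite frame_rho frame_rho_le.
Qed.

End Contractive.

Lemma frame_exists (J : finType) (f : J -> E) (d : R) : 0 < d ->
  exists (L : finType) (l0 : L) (g h : L -> E),
    [/\ col_bound 3 g, col_bound 3 h & forall j,
      hm_norm (f j - \sum_l hm_act (g l) << h l, f j >>) <= d].
Proof.
(* The index [None], with vector 0, provides [l0] even when [J] is empty. *)
move=> d0; pose f' (o : option J) := if o is Some j then f j else 0.
pose s := 1 + \sum_o hm_norm (f' o).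
have s1 : 1 <= s by rewrite lerDl sumr_ge0// => o _; exact: hm_norm_ge0.
have s0 : 0 < s by exact: lt_le_trans s1.
pose u o := rs (s^-1) (f' o).
have u1 : row_bound 1 u.
  apply: row_bound_le (row_bound_crude HB u).
  under eq_bigr do rewrite hm_normZr ?invr_ge0 ?(ltW s0)//.
  by rewrite -mulr_sumr mulrC ler_pdivrMr// mul1r lerDr.
have fE o : f' o = rs s (u o).
  by rewrite /u scalerA -rmorphM divff ?gt_eqF// scale1r.
(* Undoing the scaling multiplies the error by [s], so [s^2 * 4 / M.+1 <= d^2] is required. *)
pose M := Num.bound (4 * s ^+ 2 / d ^+ 2).
have [g [h [g1 h3 gh]]] := frame_contractive u1 M.
exists ('I_M.+1 * option J)%type, (ord0, None), g, h; split=> //.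
  by move=> I z; rewrite (le_trans (g1 I z))// ler_wpM2r ?vn_ge0// ler1n.
move=> j; have /= := gh (Some j); set y := u _ - _ => hy.
have -> : f j - \sum_l hm_act (g l) << h l, f j >> = rs s y.
  rewrite /y scalerBr -fE scaler_sumr; congr (_ - _); apply: eq_bigr => l _.
  by rewrite -[f j]/(f' (Some j)) fE innerZr actZr.
rewrite hm_normZr ?(ltW s0)// -ler_sqr ?nnegrE ?(ltW d0)//;
  last by rewrite mulr_ge0 ?hm_norm_ge0 ?(ltW s0).
rewrite exprMn (@le_trans _ _ (s ^+ 2 * (4 / M.+1%:R)))//.
  by rewrite ler_wpM2l ?sqr_ge0.
rewrite mulrA ler_pdivrMr// mulrC -ler_pdivrMl ?exprn_gt0//.
apply: (@le_trans _ _ M%:R); last by rewrite ler_nat.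
rewrite [leLHS]mulrC; apply/ltW; apply: archi_boundP.
by apply: divr_ge0; [apply: mulr_ge0; rewrite ?sqr_ge0|exact: sqr_ge0].
Qed.

End Frames.

Local Notation normc := Normc.normc.

(** * Operator spaces *)

Section ScalarMatrices.
Variable R : realType.
Local Notation C := R[i].

Lemma l2norm_ge0 n (v : 'cV[C]_n) : 0 <= l2norm v.
Proof. exact: sqrtr_ge0. Qed.

Lemma l2norm_sq n (v : 'cV[C]_n) : l2norm v ^+ 2 = \sum_i normc (v i 0) ^+ 2.
Proof. by rewrite sqr_sqrtr// sumr_ge0// => i _; exact: sqr_ge0. Qed.

Lemma normc_ge0 (c : C) : 0 <= normc c.
Proof. by case: c => a b; exact: sqrtr_ge0. Qed.

Lemma l2normZ n (c : C) (v : 'cV[C]_n) : l2norm (c *: v) = normc c * l2norm v.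
Proof.
apply/eqP; rewrite -(@eqrXn2 _ 2) ?mulr_ge0 ?l2norm_ge0 ?normc_ge0// exprMn.
rewrite !l2norm_sq mulr_sumr; apply/eqP; apply: eq_bigr => i _.
by rewrite mxE Normc.normcM exprMn.
Qed.

Lemma normc_le_l2norm n (v : 'cV[C]_n) i : normc (v i 0) <= l2norm v.
Proof.
rewrite -ler_sqr ?nnegrE ?normc_ge0 ?l2norm_ge0// l2norm_sq (bigD1 i)//=.
by rewrite lerDl sumr_ge0// => j _; exact: sqr_ge0.
Qed.

Lemma l2norm_le_sum n (v : 'cV[C]_n) : l2norm v <= \sum_i normc (v i 0).
Proof.
apply: sqr_le_cancel; first by rewrite sumr_ge0// => i _; exact: normc_ge0.
rewrite l2norm_sq mulr_suml ler_sum// => i _.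
by rewrite expr2 ler_wpM2l ?normc_ge0 ?normc_le_l2norm.
Qed.

Lemma normc_sum (I : Type) (r : seq I) (P : pred I) (F : I -> C) :
  normc (\sum_(i <- r | P i) F i) <= \sum_(i <- r | P i) normc (F i).
Proof.
elim/big_rec2: _ => [|i y1 y2 _ h]; first by rewrite Normc.normc0.
by apply: le_trans (le_normcD _ _) _; rewrite lerD2l.
Qed.

Let opset n (a : 'M[C]_n) :=
  [set l2norm (a *m v) | v in [set v | l2norm v <= 1]].

Let opset_has_sup n (a : 'M[C]_n) : has_sup (opset a).
Proof.
split.
  exists (l2norm (a *m 0)); exists 0 => //=.
  by rewrite /l2norm big1 ?sqrtr0// => i _; rewrite mxE Normc.normc0 expr0n.
exists (\sum_i \sum_j normc (a i j)) => _ [v /= v1 <-].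
rewrite (le_trans (l2norm_le_sum _))//; apply: ler_sum => i _; rewrite mxE.
rewrite (le_trans (normc_sum _ _ _))//; apply: ler_sum => j _.
rewrite Normc.normcM ler_piMr ?normc_ge0//.
exact: le_trans (normc_le_l2norm _ _) v1.
Qed.

Lemma mxopnormP n (a : 'M[C]_n) (v : 'cV[C]_n) :
  l2norm (a *m v) <= mxopnorm a * l2norm v.
Proof.
have [v0|v0] := eqVneq (l2norm v) 0.
  have -> : v = 0.
    apply/colP => i; rewrite mxE; apply: Normc.eq0_normc; apply/eqP.
    by rewrite eq_le normc_ge0 andbT -v0 normc_le_l2norm.
  rewrite mulmx0 (_ : l2norm 0 = 0) ?mulr0//.
  by rewrite /l2norm big1 ?sqrtr0// => i _; rewrite mxE Normc.normc0 expr0n.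
have {}v0 : 0 < l2norm v by rewrite lt_neqAle eq_sym v0 l2norm_ge0.
rewrite -ler_pdivrMr// -[X in _ / X]/(l2norm v) mulrC.
rewrite -(normc_real (_ : 0 <= (l2norm v)^-1)) ?invr_ge0 ?(ltW v0)//.
rewrite -l2normZ scalemxAr; apply: ub_le_sup; first by case: (opset_has_sup a).
exists (((l2norm v)^-1)%:C%C *: v) => //=.
by rewrite l2normZ normc_real ?invr_ge0 ?(ltW v0)// mulVf ?gt_eqF.
Qed.

Lemma mxopnorm_le n (a : 'M[C]_n) (c : R) : 0 <= c ->
  (forall v, l2norm (a *m v) <= c * l2norm v) -> mxopnorm a <= c.
Proof.
move=> c0 ac; apply: ge_sup; first by case: (opset_has_sup a).
by move=> _ [v /= v1 <-]; rewrite (le_trans (ac v))// ler_piMr.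
Qed.

Lemma mxopnorm_ge0 n (a : 'M[C]_n) : 0 <= mxopnorm a.
Proof.
apply: (@le_trans _ _ (l2norm (a *m 0))); first exact: l2norm_ge0.
apply: ub_le_sup; first by case: (opset_has_sup a).
exists 0 => //=.
by rewrite /l2norm big1 ?sqrtr0// => i _; rewrite mxE Normc.normc0 expr0n.
Qed.

(* [r] is the graph of an injective partial function. *)
Definition partial_inj (I J : Type) (r : I -> J -> bool) :=
  (forall i j j', r i j -> r i j' -> j = j') /\
  (forall i i' j, r i j -> r i' j -> i = i').

Lemma partial_inj_tr (I J : Type) (r : I -> J -> bool) :
  partial_inj r -> partial_inj (fun j i => r i j).
Proof. by move=> [r1 r2]; split=> [j i i'|j j' i]; [exact: r2|exact: r1]. Qed.

Lemma mxopnorm_partial_inj n (r : 'I_n -> 'I_n -> bool) : partial_inj r ->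
  mxopnorm (\matrix_(i, j) (r i j)%:R : 'M[C]_n) <= 1.
Proof.
move=> [r1 r2]; apply: mxopnorm_le => // v; rewrite mul1r.
rewrite -ler_sqr ?nnegrE ?l2norm_ge0// !l2norm_sq.
have h i : normc (((\matrix_(i, j) (r i j)%:R : 'M[C]_n) *m v) i 0) ^+ 2 =
    \sum_j (normc (v j 0) ^+ 2) *+ r i j.
  rewrite mxE; have [j rij|r0] := pickP (r i).
    rewrite (bigD1 j)//= [RHS](bigD1 j)//= rij !big1 ?addr0 => [|k kj|k kj].
    - by rewrite mxE rij mul1r.
    - by case: (boolP (r i k)) => // rik; rewrite (r1 _ _ _ rij rik) eqxx in kj.
    - rewrite mxE; case: (boolP (r i k)) => [rik|]; last by rewrite mul0r.
      by rewrite (r1 _ _ _ rij rik) eqxx in kj.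
  rewrite !big1 ?Normc.normc0 ?expr0n// => j _; rewrite ?mxE r0 ?mulr0n//.
  by rewrite mul0r.
under eq_bigr do rewrite h.
rewrite exchange_big; apply: ler_sum => j _ /=.
have [i rij|r0] := pickP (r^~ j).
  rewrite (bigD1 i)//= rij big1 ?addr0// => k ki.
  by case: (boolP (r k j)) => // rkj; rewrite (r2 _ _ _ rij rkj) eqxx in ki.
by rewrite big1 ?sqr_ge0// => i _; rewrite r0.
Qed.

(** [a (x) 1] acts on each slice [vl l] of a vector separately, and the squared norms of the slices
    add up. *)
Lemma mxopnorm_ampl n (L : finType) (a : 'M[C]_n) :
  mxopnorm (fm (fun p q : 'I_n * L => a p.1 q.1 *+ (p.2 == q.2))) <= mxopnorm a.
Proof.
apply: mxopnorm_le => [|v]; first exact: mxopnorm_ge0.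
rewrite -ler_sqr ?nnegrE ?mulr_ge0 ?l2norm_ge0 ?mxopnorm_ge0// exprMn.
rewrite !l2norm_sq; pose vl (l : L) : 'cV[C]_n := \col_i v (frank (i, l)) 0.
have -> : \sum_i normc (v i 0) ^+ 2 = \sum_l l2norm (vl l) ^+ 2.
  under [RHS]eq_bigr do rewrite l2norm_sq.
  rewrite exchange_big -(sum_pair (fun p => normc (vl p.2 p.1 0) ^+ 2)).
  rewrite -[RHS]sum_fval; apply: eq_bigr => k _.
  by rewrite mxE -surjective_pairing fvalK.
rewrite mulr_sumr.
rewrite (_ : \sum_i _ = \sum_l l2norm (a *m vl l) ^+ 2).
  apply: ler_sum => l _; rewrite -exprMn ler_sqr ?nnegrE ?mxopnormP//;
  by rewrite ?mulr_ge0 ?l2norm_ge0 ?mxopnorm_ge0.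
under [RHS]eq_bigr do rewrite l2norm_sq.
rewrite exchange_big -(sum_pair (fun p => normc ((a *m vl p.2) p.1 0) ^+ 2)).
rewrite -[RHS]sum_fval; apply: eq_bigr => k _.
congr (normc _ ^+ 2); rewrite !mxE.
pose F q := (a (fval k).1 q.1 *+ ((fval k).2 == q.2)) *
  v (frank q) 0.
rewrite (eq_bigr (fun k' => F (fval k'))) => [|k' _]; last first.
  by rewrite /F mxE fvalK.
rewrite (sum_fval F) sum_pair; apply: eq_bigr => i _.
rewrite (bigD1 (fval k).2)//= /F eqxx mulr1n big1 ?addr0 ?mxE// => l.
by rewrite eq_sym => /negPf->; rewrite mulr0n mul0r.
Qed.

End ScalarMatrices.

Section OperatorSpaceNorms.
Variables (R : realType) (Y : operatorSpace R).
Local Notation C := R[i].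

Let YB n : is_banach_norm (@mxscale R Y n) (@mn_norm R Y n).
Proof. by case: (os_axioms Y). Qed.

Let s0 n (x : 'M[Y]_n) : mxscale 0 x = 0.
Proof. by apply/matrixP => i j; rewrite !mxE scale0r. Qed.

Let s1 n (x : 'M[Y]_n) : mxscale (-1) x = - x.
Proof. by apply/matrixP => i j; rewrite !mxE scaleN1r. Qed.

Lemma mn_norm0 n : mn_norm (0 : 'M[Y]_n) = 0.
Proof. exact: (bnorm0 (YB n) (@s0 n)). Qed.

Lemma mn_normN n (x : 'M[Y]_n) : mn_norm (- x) = mn_norm x.
Proof. exact: (bnormN (YB n) (@s1 n)). Qed.

Lemma mn_normD n (x y : 'M[Y]_n) : mn_norm (x + y) <= mn_norm x + mn_norm y.
Proof. exact: (bnormD (YB n)). Qed.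

Lemma mn_norm_eq0 n (x : 'M[Y]_n) : mn_norm x = 0 -> x = 0.
Proof. exact: (bnorm_eq0 (YB n)). Qed.

Lemma mn_normZ n c (x : 'M[Y]_n) : mn_norm (mxscale c x) = normc c * mn_norm x.
Proof. by case: (YB n). Qed.

Lemma mn_norm_sum n (I : Type) (r : seq I) (P : pred I) (F : I -> 'M[Y]_n) :
  mn_norm (\sum_(i <- r | P i) F i) <= \sum_(i <- r | P i) mn_norm (F i).
Proof. exact: (bnorm_sum (YB n) (@s0 n)). Qed.

Lemma norm10 : norm1 (0 : Y) = 0.
Proof. exact: mn_norm0. Qed.

Lemma norm1_ge0 (y : Y) : 0 <= norm1 y. Proof. exact: mn_ge0. Qed.

Lemma norm1N (y : Y) : norm1 (- y) = norm1 y.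
Proof.
rewrite /norm1 (_ : const_mx (- y) = - const_mx y) ?mn_normN//.
by apply/matrixP => i j; rewrite !mxE.
Qed.

Lemma norm1D (x y : Y) : norm1 (x + y) <= norm1 x + norm1 y.
Proof. by rewrite -{1}(opprK y) -(norm1N y) norm1B. Qed.

Lemma norm1_sum (I : Type) (r : seq I) (P : pred I) (F : I -> Y) :
  norm1 (\sum_(i <- r | P i) F i) <= \sum_(i <- r | P i) norm1 (F i).
Proof.
elim/big_rec2: _ => [|i y1 y2 _ h]; first by rewrite norm10.
by rewrite (le_trans (norm1D _ _))// lerD2l.
Qed.

Lemma norm1Z (c : C) (y : Y) : norm1 (c *: y) = normc c * norm1 y.
Proof.
rewrite -mn_normZ /norm1; congr mn_norm.
by apply/matrixP => i j; rewrite !mxE.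
Qed.

Lemma norm1_eq0 (y : Y) : norm1 y = 0 -> y = 0.
Proof. by move=> /mn_norm_eq0/matrixP/(_ 0 0); rewrite !mxE. Qed.

Lemma norm1_small0 (y : Y) : (forall d, 0 < d -> norm1 y <= d) -> y = 0.
Proof.
move=> h; apply: norm1_eq0; apply/eqP; rewrite eq_le norm1_ge0 andbT.
by apply/ler_addgt0Pr => e e0; rewrite add0r h.
Qed.

Lemma mn_norm_mul n (a b : 'M[C]_n) (x : 'M[Y]_n) :
  mn_norm (mxbil (fun y c => c *: y) (mxbil *:%R a x) b)
    <= mxopnorm a * mn_norm x * mxopnorm b.
Proof. by case: (os_axioms Y). Qed.

Lemma mn_norm_block m n (x : 'M[Y]_m) (y : 'M[Y]_n) :
  mn_norm (block_mx x 0 0 y) = Num.max (mn_norm x) (mn_norm y).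
Proof. by case: (os_axioms Y). Qed.

(** The axioms multiply by square matrices of the size of [x]. To change the size, [x] is put in the
    lower right block of a matrix of size [m + n], and the partial permutations [ext] carry it to
    the upper left block. Submatrices, paddings and single entries are instances. *)
Lemma mn_norm_partial_inj m n (r s : 'I_m -> 'I_n -> bool) (x : 'M[Y]_n) :
  partial_inj r -> partial_inj s ->
  mn_norm (\matrix_(i, j) \sum_k \sum_l x k l *+ (r i k && s j l))
    <= mn_norm x.
Proof.
move=> rP sP; set y := \matrix_(i, j) _.
pose ext (t : 'I_m -> 'I_n -> bool) (i j : 'I_(m + n)) :=
  match fintype.split i, fintype.split j with
  | inl i', inr j' => t i' j' | _, _ => false end.
have extP t : partial_inj t -> partial_inj (ext t).
  move=> [r1 r2]; split=> [i j j'|i i' j]; rewrite /ext.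
    rewrite -(splitK i) unsplitK -{2}(splitK j) -{2}(splitK j').
    case: (fintype.split i) => // a; case: (fintype.split j) => // b.
    by case: (fintype.split j') => // c h h'; rewrite (r1 _ _ _ h h').
  rewrite -{2}(splitK i) -{2}(splitK i').
  case: (fintype.split i) => // a; case: (fintype.split i') => // b.
  by case: (fintype.split j) => // c h h'; rewrite (r2 _ _ _ h h').
have yE : mxbil (fun y c => c *: y)
    (mxbil *:%R (\matrix_(i, j) (ext r i j)%:R : 'M[C]_(m + n))
      (block_mx 0 0 0 x))
    (\matrix_(i, j) (ext s j i)%:R) = block_mx y 0 0 0.
  apply/matrixP => i j; rewrite mxE; under eq_bigr do rewrite !mxE.
  rewrite -(splitK i) -(splitK j) big_split_ord/= [X in X + _]big1 ?add0r.
    case: (fintype.split i) => [i'|i'] /=.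
      case: (fintype.split j) => [j'|j'] /=.
        rewrite block_mxEul mxE exchange_big; apply: eq_bigr => l _ /=.
        rewrite scaler_sumr big_split_ord/= [X in X + _]big1 ?add0r.
          apply: eq_bigr => k _.
          rewrite block_mxEdr mxE /ext (unsplitK (inl i')) (unsplitK (inr k)).
          rewrite (unsplitK (inl j')) (unsplitK (inr l)) -mulnb mulrnA.
          by case: (r i' k); case: (s j' l); rewrite ?scale1r ?scale0r ?mulr1n
            ?mulr0n ?mul0rn ?scaler0.
        by move=> k _; rewrite block_mxEur !mxE !scaler0.
      rewrite block_mxEur mxE big1// => l _.
      by rewrite /ext (unsplitK (inr j')) scale0r.
    rewrite big1 => [|l _]; last first.
      rewrite big1 ?scaler0// => k _.
      by rewrite mxE /ext (unsplitK (inr i')) scale0r.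
    by case: (fintype.split j) => j' /=; rewrite ?block_mxEdl ?block_mxEdr mxE.
  move=> k _; rewrite /ext (unsplitK (inl k)).
  by case: (fintype.split _); rewrite ?scale0r.
have := mn_norm_block y (0 : 'M[Y]_n); rewrite -yE => yn.
apply: (@le_trans _ _ (Num.max (mn_norm y) (mn_norm (0 : 'M[Y]_n)))).
  by rewrite le_max lexx.
rewrite -yn (le_trans (mn_norm_mul _ _ _))//.
have -> : mn_norm x = 1 * mn_norm (block_mx (0 : 'M[Y]_m) 0 0 x) * 1.
  rewrite mul1r mulr1 mn_norm_block mn_norm0.
  by apply/esym/max_idPr; exact: mn_ge0.
apply: ler_pM; rewrite ?mxopnorm_ge0//.
- by apply: mulr_ge0; [exact: mxopnorm_ge0|exact: mn_ge0].
- apply: ler_wpM2r; first exact: mn_ge0.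
  exact: (mxopnorm_partial_inj R (extP _ rP)).
- exact: (mxopnorm_partial_inj R (partial_inj_tr (extP _ sP))).
Qed.

Lemma mn_norm_compress m n (f : 'I_m -> 'I_n) (x : 'M[Y]_n) : injective f ->
  mn_norm (\matrix_(i, j) x (f i) (f j)) <= mn_norm x.
Proof.
move=> finj; pose r i j := j == f i.
have rP : partial_inj r.
  split=> [i j j' /eqP-> /eqP->//|i i' j /eqP-> /eqP]; exact: finj.
apply: le_trans (mn_norm_partial_inj x rP rP); apply: eq_ler.
congr mn_norm; apply/matrixP => i j; rewrite !mxE.
rewrite (bigD1 (f i))//= (bigD1 (f j))//= /r !eqxx mulr1n !big1 ?addr0//.
  by move=> k /negPf ki; rewrite big1// => l _; rewrite ki.
by move=> l /negPf ->.
Qed.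

Lemma mn_norm_corner n (K : finType) (f : 'I_n -> K) (x : K -> K -> Y) :
  injective f -> mn_norm (\matrix_(i, j) x (f i) (f j)) <= mn_norm (fm x).
Proof.
move=> finj.
have fi : injective (fun i => frank (f i)).
  by move=> i j /(can_inj (@frankK _)); exact: finj.
apply: le_trans (mn_norm_compress (fm x) fi).
apply: eq_ler; congr mn_norm.
by apply/matrixP => i j; rewrite !mxE !frankK.
Qed.

Lemma mn_norm_pad n (L : finType) (l0 : L) (x : 'M[Y]_n) :
  mn_norm (fm (fun p q : 'I_n * L =>
    x p.1 q.1 *+ ((p.2 == l0) && (q.2 == l0)))) <= mn_norm x.
Proof.
pose r (a : 'I_(fcard ('I_n * L)%type)) i := fval a == (i, l0).
have rP : partial_inj r.
  rewrite /r; split=> [a i j /eqP-> /eqP[]//|a b i /eqP ai /eqP bi].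
  by apply: (can_inj (@fvalK _)); rewrite ai bi.
apply: le_trans (mn_norm_partial_inj x rP rP); apply: eq_ler.
congr mn_norm; apply/matrixP => a b; rewrite !mxE /r.
case: (fval a) => i l; case: (fval b) => j m /=.
rewrite (bigD1 i)//= (bigD1 j)//= !xpair_eqE !eqxx !big1 ?addr0//.
  move=> k ki; rewrite big1// => h _.
  by rewrite xpair_eqE eq_sym (negPf ki).
by move=> h hj; rewrite xpair_eqE [j == h]eq_sym (negPf hj) andbF.
Qed.

Lemma norm1_entry n (x : 'M[Y]_n) i j : norm1 (x i j) <= mn_norm x.
Proof.
pose r (i : 'I_n) (_ : 'I_1) k := k == i.
have rP k : partial_inj (r k).
  by split=> [a l l' /eqP-> /eqP->|a b l _ _]; rewrite ?(ord1 a) ?(ord1 b).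
apply: le_trans (mn_norm_partial_inj x (rP i) (rP j)).
apply: eq_ler; congr mn_norm.
apply/matrixP => a b; rewrite !mxE (bigD1 i)//= (bigD1 j)//= /r !eqxx.
rewrite !big1 ?addr0// => [k /negPf ki|l /negPf ->//].
by rewrite big1// => l _; rewrite ki.
Qed.

Lemma mn_norm_le_sum n (x : 'M[Y]_n) :
  mn_norm x <= \sum_i \sum_j norm1 (x i j).
Proof.
pose single i j y : 'M[Y]_n := \matrix_(k, l) (y *+ ((k == i) && (l == j))).
have single_le i j y : mn_norm (single i j y) <= norm1 y.
  pose r (i k : 'I_n) (_ : 'I_1) := k == i.
  have rP k : partial_inj (r k).
    by split=> [a l l' _ _|a b l /eqP-> /eqP->]; rewrite ?(ord1 l) ?(ord1 l').
  apply: le_trans (mn_norm_partial_inj (const_mx y) (rP i) (rP j)).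
  apply: eq_ler; congr mn_norm.
  by apply/matrixP => a b; rewrite !mxE !big_ord1 mxE.
have {1}-> : x = \sum_i \sum_j single i j (x i j).
  apply/matrixP => k l; rewrite summxE (bigD1 k)//= summxE (bigD1 l)//=.
  rewrite mxE !eqxx mulr1n !big1 ?addr0// => [i ik|j jl].
    by rewrite summxE big1// => j _; rewrite mxE eq_sym (negPf ik).
  by rewrite mxE eqxx eq_sym (negPf jl).
rewrite (le_trans (mn_norm_sum _ _ _))//; apply: ler_sum => i _.
by rewrite (le_trans (mn_norm_sum _ _ _))//; apply: ler_sum => j _.
Qed.

End OperatorSpaceNorms.

(** * The operator space of matrices over [Y] indexed by [L] *)

Section MatrixSpace.
Variables (R : realType) (Y : operatorSpace R) (L : finType).
Local Notation C := R[i].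
Local Notation Z := {ffun L * L -> Y}.

(** The identification of [M_n(M_L(Y))] with matrices over [Y] indexed by pairs. *)
Definition ampl n (z : 'M[Z]_n) : 'M[Y]_(fcard ('I_n * L)%type) :=
  fm (fun p q : 'I_n * L => z p.1 q.1 (p.2, q.2)).

Lemma amplE n (z : 'M[Z]_n) a b :
  ampl z a b = z (fval a).1 (fval b).1 ((fval a).2, (fval b).2).
Proof. by rewrite mxE. Qed.

Definition unampl n (y : 'M[Y]_(fcard ('I_n * L)%type)) : 'M[Z]_n :=
  \matrix_(i, j) [ffun p => y (frank (i, p.1)) (frank (j, p.2))].

Lemma unamplK n : cancel (@unampl n) (@ampl n).
Proof.
move=> y; apply/matrixP => a b; rewrite !mxE ffunE /=.
by rewrite -!surjective_pairing !fvalK.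
Qed.

Lemma amplK n : cancel (@ampl n) (@unampl n).
Proof.
move=> z; apply/matrixP => i j; rewrite !mxE; apply/ffunP => -[l m].
by rewrite ffunE mxE !frankK.
Qed.

Definition matspace_norm n (z : 'M[Z]_n) : R := mn_norm (ampl z).

Lemma matspace_norm_ge0 n (z : 'M[Z]_n) : 0 <= matspace_norm z.
Proof. exact: mn_ge0. Qed.

Definition matspace : matNormed R := MatNormed matspace_norm_ge0.

Let amplB n (z w : 'M[Z]_n) : ampl (z - w) = ampl z - ampl w.
Proof. by apply/matrixP => a b; rewrite !mxE !ffunE. Qed.

Let amplD n (z w : 'M[Z]_n) : ampl (z + w) = ampl z + ampl w.
Proof. by apply/matrixP => a b; rewrite !mxE !ffunE. Qed.

Let amplZ n c (z : 'M[Z]_n) : ampl (mxscale c z) = mxscale c (ampl z).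
Proof. by apply/matrixP => a b; rewrite !mxE !ffunE. Qed.

Let banach n : is_banach_norm (@mxscale R Z n) (@matspace_norm n).
Proof.
case: (os_axioms Y) => /(_ (fcard ('I_n * L)%type))[N0 ND NZ NC] _ _; split.
- move=> z /N0 z0; apply: (can_inj (@amplK n)); rewrite z0.
  by apply/matrixP => a b; rewrite !mxE ffunE.
- by move=> z w; rewrite /matspace_norm amplD ND.
- by move=> c z; rewrite /matspace_norm amplZ NZ.
- move=> u uC; have [|l ul] := NC (fun k => ampl (u k)).
    move=> e e0; have [n0 h] := uC e e0; exists n0 => a b na nb.
    by rewrite -amplB; exact: h.
  exists (unampl l); rewrite /matspace_norm.
  by under eq_fun do rewrite amplB unamplK.
Qed.

Let mulbound n (a b : 'M[C]_n) (z : 'M[Z]_n) :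
  matspace_norm (mxbil (fun y c => c *: y) (mxbil *:%R a z) b)
    <= mxopnorm a * matspace_norm z * mxopnorm b.
Proof.
pose t (a : 'M[C]_n) := fm (fun p q : 'I_n * L => a p.1 q.1 *+ (p.2 == q.2)).
have -> : matspace_norm (mxbil (fun y c => c *: y) (mxbil *:%R a z) b) =
    mn_norm (mxbil (fun y c => c *: y) (mxbil *:%R (t a) (ampl z)) (t b)).
  congr mn_norm; rewrite /t /ampl !mxbil_fm; apply: eq_fm => -[i l] [j m] /=.
  rewrite mxE sum_ffunE sum_pair; apply: eq_bigr => k _.
  rewrite (bigD1 m)//= eqxx mulr1n [X in _ = _ + X]big1 ?addr0 => [|h hm].
    rewrite !ffunE mxE sum_ffunE sum_pair; congr (_ *: _).
    apply: eq_bigr => h _.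
    rewrite (bigD1 l)//= eqxx mulr1n ffunE big1 ?addr0// => g gl.
    by rewrite eq_sym (negPf gl) mulr0n scale0r.
  by rewrite (negPf hm) mulr0n scale0r.
apply: (le_trans (mn_norm_mul _ _ _)).
rewrite ler_pM ?mulr_ge0 ?mxopnorm_ge0 ?mn_ge0 ?mxopnorm_ampl//.
by rewrite ler_wpM2r ?mn_ge0 ?mxopnorm_ampl.
Qed.

(** The index sets of the two sides are in bijection; [mn_norm_compress] along the bijection and
    along its inverse gives the two inequalities. *)
Let blocknorm m n (x : 'M[Z]_m) (y : 'M[Z]_n) :
  matspace_norm (block_mx x 0 0 y) =
  Num.max (matspace_norm x) (matspace_norm y).
Proof.
rewrite /matspace_norm -mn_norm_block.
pose f (k : 'I_(fcard ('I_m * L)%type + fcard ('I_n * L)%type)) :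
    'I_(fcard ('I_(m + n) * L)%type) :=
  match fintype.split k with
  | inl a => frank (lshift n (fval a).1, (fval a).2)
  | inr a => frank (rshift m (fval a).1, (fval a).2) end.
pose g (k : 'I_(fcard ('I_(m + n) * L)%type)) :
    'I_(fcard ('I_m * L)%type + fcard ('I_n * L)%type) :=
  match fintype.split (fval k).1 with
  | inl i => lshift _ (frank (i, (fval k).2))
  | inr i => rshift _ (frank (i, (fval k).2)) end.
have fK : cancel f g.
  move=> k; rewrite /f /g -[RHS]splitK; case: (fintype.split k) => a /=.
    by rewrite frankK (unsplitK (inl _)) -surjective_pairing fvalK.
  by rewrite frankK (unsplitK (inr _)) -surjective_pairing fvalK.
have gK : cancel g f.
  move=> k; rewrite /f /g -[RHS]fvalK; case: (fval k) => i l /=.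
  move: (splitK i); case: (fintype.split i) => a <- /=.
    by rewrite (unsplitK (inl _)) frankK.
  by rewrite (unsplitK (inr _)) frankK.
have fE a b : block_mx (ampl x) 0 0 (ampl y) a b =
    ampl (block_mx x 0 0 y) (f a) (f b).
  rewrite /f -{1}(splitK a) -{1}(splitK b).
  case: (fintype.split a) => a'; case: (fintype.split b) => b' /=;
    rewrite ?block_mxEul ?block_mxEur ?block_mxEdl ?block_mxEdr !amplE;
    rewrite ?frankK /= ?block_mxEul ?block_mxEur ?block_mxEdl ?block_mxEdr //;
    by rewrite !mxE ffunE.
apply/eqP; rewrite eq_le; apply/andP; split.
  apply: le_trans (mn_norm_compress _ (can_inj gK)).
  apply: eq_ler; congr mn_norm.
  by apply/matrixP => a b; rewrite [RHS]mxE fE !gK.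
apply: le_trans (mn_norm_compress _ (can_inj fK)).
apply: eq_ler; congr mn_norm.
by apply/matrixP => a b; rewrite [RHS]mxE fE.
Qed.

Lemma matspace_axioms : is_operator_space matspace.
Proof. by split; [exact: banach|exact: mulbound|exact: blocknorm]. Qed.

(** A target for [ht_universal] that can hold a whole column over [Y]. *)
Definition mat_space : operatorSpace R := OperatorSpace matspace_axioms.

End MatrixSpace.

(** * The Haagerup tensor product *)

Lemma ht_extend (R : realType) (A B : cstarAlgebra R) (M : matBimodule A B)
    (Y : opModule B) (Q : haagerupTensor M Y) (Z : operatorSpace R)
    (Phi : M -> Y -> Z) (c : R) : 0 < c ->
  is_bilinear Phi ->
  (forall m b y, Phi (mb_ract m b) y = Phi m (om_act b y)) ->
  (forall n (x : 'M[M]_n) (y : 'M[Y]_n),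
    mn_norm (mxbil Phi x y) <= c * (mn_norm x * mn_norm y)) ->
  exists F : Q -> Z, [/\ linear F,
    forall n (q : 'M[Q]_n), mn_norm (map_mx F q) <= c * mn_norm q
    & forall m y, F (ht_tens Q m y) = Phi m y].
Proof.
move=> c0 [bl br] bal bound.
have NZ n (a : R) (x : 'M[Z]_n) : 0 <= a ->
    mn_norm (mxscale (a%:C)%C x) = a * mn_norm x.
  by move=> a0; rewrite mn_normZ normc_real.
pose Psi m y := rs (c^-1) (Phi m y).
have [F0 [F0l F0c F0E]] : exists F : Q -> Z,
    [/\ linear F, completely_contractive F
      & forall m y, F (ht_tens Q m y) = Psi m y].
  apply: ht_universal.
  - split=> [m a u v|y a u v]; rewrite /Psi.
      by rewrite (bl m) scalerDr !scalerA mulrC.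
    by rewrite /= (br y) scalerDr !scalerA mulrC.
  - by move=> m b y; rewrite /Psi bal.
  - move=> n x y; rewrite (_ : mxbil Psi x y =
        mxscale ((c^-1)%:C)%C (mxbil Phi x y)); last first.
      by apply/matrixP => i j; rewrite !mxE scaler_sumr.
    by rewrite NZ ?invr_ge0 ?(ltW c0)// mulrC ler_pdivrMr// mulrC.
exists (fun q => rs c (F0 q)); split.
- by move=> a u v; rewrite F0l scalerDr !scalerA mulrC.
- move=> n q; rewrite (_ : map_mx _ q = mxscale (c%:C)%C (map_mx F0 q)).
    by rewrite NZ ?(ltW c0)// ler_wpM2l ?(ltW c0).
  by apply/matrixP => i j; rewrite !mxE.
- by move=> m y; rewrite F0E /Psi scalerA -rmorphM divff ?gt_eqF// scale1r.
Qed.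

Lemma ht_ext (R : realType) (A B : cstarAlgebra R) (M : matBimodule A B)
    (Y : opModule B) (Q : haagerupTensor M Y) (Z : operatorSpace R)
    (F G : Q -> Z) (c d : R) :
  linear F -> (forall q, norm1 (F q) <= c * norm1 q) ->
  linear G -> (forall q, norm1 (G q) <= d * norm1 q) ->
  (forall m y, F (ht_tens Q m y) = G (ht_tens Q m y)) -> F =1 G.
Proof.
move=> linF Fc linG Gd FG.
pose D v := F v - G v.
suff D0 v : D v = 0 by move=> v; apply/eqP; rewrite -subr_eq0; apply/eqP/D0.
move: v; apply: (@total_linear_eq0 _ Q Z _ D (c + d) (@ht_dense R A B _ Y Q)).
- by move=> a u v; rewrite /D linF linG scalerBr opprD addrACA.
- by move=> v; rewrite (le_trans (norm1B _ _))// mulrDl lerD.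
- by move=> _ [[m y] _ <-] /=; rewrite /D FG subrr.
Qed.

Section OpModules.
Variables (R : realType) (B : cstarAlgebra R) (Y : opModule B).

Lemma om_act0r b : om_act b (0 : Y) = 0.
Proof. exact: (lin0 ((@om_act_bilinear R B Y).1 b)). Qed.

Lemma om_actMnr b (y : Y) n : om_act b (y *+ n) = om_act b y *+ n.
Proof. exact: (linMn ((@om_act_bilinear R B Y).1 b)). Qed.

End OpModules.

Lemma sum_select (V : nmodType) (I L : finType) (l0 : L) (F : I * L -> V) :
  (forall i l, l != l0 -> F (i, l) = 0) -> \sum_p F p = \sum_i F (i, l0).
Proof.
move=> F0; rewrite sum_pair; apply: eq_bigr => i _.
by rewrite (bigD1 l0)//= big1 ?addr0// => l; exact: F0.
Qed.

Section ColumnNorm.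
Variables (V : zmodType) (n : nat) (L : finType) (l0 : L).

(* The column [(y i j l)_l] of each entry, embedded in square matrices. *)
Definition colmx (y : 'I_n -> 'I_n -> L -> V) : 'M[V]_(fcard ('I_n * L)%type) :=
  fm (fun p r : 'I_n * L => y p.1 r.1 p.2 *+ (r.2 == l0)).

(** The row [g] amplified by the identity of [M_n] and made square, so that it multiplies
    [colmx]. *)
Definition rowker (g : L -> V) (p r : 'I_n * L) : V :=
  g r.2 *+ ((p.1 == r.1) && (p.2 == l0)).

End ColumnNorm.

(** * Evaluation maps, and frames in [E (x)_hB Y] *)

Section Evaluation.
Variables (R : realType) (A B : cstarAlgebra R) (E : correspondence A B).
Hypothesis HB : has_mxnorms B.
Local Notation "<< e , f >>" := (hm_inner e f).

Lemma hm_space_norm1 (e : E) : norm1 (e : hm_space E) <= hm_norm e.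
Proof.
apply: (hm_mxnorm_le HB (hm_norm_ge0 e)) => v.
rewrite (eq_vn (w := fun i => hm_act e (v i))) ?vn_act// => i.
by rewrite /kact big_ord1 mxE (ord1 i).
Qed.

Lemma rowker_norm n (L : finType) (l0 : L) (g : L -> E) (K : R) : 0 <= K ->
  row_bound K g -> hm_mxnorm (fm (rowker (n := n) l0 g)) <= K.
Proof.
move=> K0 gK; apply: (hm_mxnorm_fm_le HB K0) => v.
apply: le_trans (_ : K * bn (fun p : 'I_n * L => v (p.1, p.2)) <= _).
  apply: le_trans (gK _ (fun i l => v (i, l))).
  rewrite -[leRHS](vn_pad l0); apply: eq_ler.
  apply: eq_vn => -[i l].
  rewrite /kact /rowker /= sum_pair (bigD1 i)//= eqxx/=.
  rewrite [X in _ + X]big1 ?addr0 => [|k ki].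
    by rewrite -sumrMnl; apply: eq_bigr => m _; case: (l == l0); rewrite ?act0l.
  by rewrite big1// => m _; rewrite eq_sym (negPf ki) act0l.
rewrite ler_wpM2l//; apply: eq_ler.
by apply: (@eq_vn _ _ (self_module B)) => -[].
Qed.

Section OnTensor.
Variables (Y : opModule B) (Q : haagerupTensor (corr_bimodule E) Y).

Lemma tensB (f g : E) y : ht_tens Q (f - g) y = ht_tens Q f y - ht_tens Q g y.
Proof. exact: (linB ((ht_bilinear Q).2 y)). Qed.

Lemma tens_suml (I : Type) (r : seq I) (P : pred I) (F : I -> E) y :
  ht_tens Q (\sum_(i <- r | P i) F i) y = \sum_(i <- r | P i) ht_tens Q (F i) y.
Proof. exact: (lin_sum ((ht_bilinear Q).2 y)). Qed.

Lemma tens_sumr (I : Type) (r : seq I) (P : pred I) (F : I -> Y) (e : E) :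
  ht_tens Q e (\sum_(i <- r | P i) F i) = \sum_(i <- r | P i) ht_tens Q e (F i).
Proof. exact: (lin_sum ((ht_bilinear Q).1 e)). Qed.

Lemma norm1_tens (e : E) y : norm1 (ht_tens Q e y) <= hm_norm e * norm1 y.
Proof.
apply: (@le_trans _ _ (norm1 (e : hm_space E) * norm1 y)).
  rewrite /norm1 (_ : const_mx _ = mxbil (ht_tens Q)
    (const_mx e : 'M[hm_space E]_1) (const_mx y)); first exact: ht_cc.
  by apply/matrixP => i j; rewrite !mxE big_ord1 !mxE.
by rewrite ler_wpM2r ?norm1_ge0// hm_space_norm1.
Qed.

(** The matrix is a corner of the product of [rowker l0 g] and [colmx l0 y], which [ht_cc]
    bounds. *)
Lemma row_tens_le n (L : finType) (l0 : L) (g : L -> E) (K : R)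
    (y : 'I_n -> 'I_n -> L -> Y) : 0 <= K -> row_bound K g ->
  mn_norm (\matrix_(i, j) \sum_l ht_tens Q (g l) (y i j l))
    <= K * mn_norm (colmx l0 y).
Proof.
move=> K0 gK.
apply: (@le_trans _ _ (hm_mxnorm (fm (rowker (n := n) l0 g)) *
    mn_norm (colmx l0 y))); last first.
  by rewrite ler_wpM2r ?mn_ge0// rowker_norm.
apply: le_trans (ht_cc Q (fm (rowker (n := n) l0 g)
  : 'M[hm_space E]_(fcard ('I_n * L)%type)) (colmx l0 y)).
rewrite mxbil_fm.
apply: le_trans (mn_norm_corner (f := fun i => (i, l0)) _ _); last first.
  by move=> i j [].
apply: eq_ler; congr mn_norm.
apply/matrixP => i j; rewrite !mxE sum_pair (bigD1 i)//= /rowker /= !eqxx/=.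
rewrite [X in _ + X]big1 ?addr0 => [|k ki].
  by apply: eq_bigr => l _; rewrite !mulr1n.
rewrite big1// => l _.
by rewrite eq_sym (negPf ki) (lin0 ((ht_bilinear Q).2 _)).
Qed.

End OnTensor.
End Evaluation.

Section EvaluationMaps.
Variables (R : realType) (A B : cstarAlgebra R) (E : correspondence A B).
Hypothesis HB : has_mxnorms B.
Local Notation "<< e , f >>" := (hm_inner e f).
Variables (Y : opModule B) (Q : haagerupTensor (corr_bimodule E) Y).

Lemma colker_norm n (L : finType) (l0 : L) (h : L -> E) (K : R)
    (x : 'M[E]_n) : 0 <= K -> col_bound K h ->
  cs_mxnorm (fm (fun p r : 'I_n * L =>
    << h p.2, x p.1 r.1 >> *+ (r.2 == l0))) <= K * hm_mxnorm x.
Proof.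
move=> K0 hK; apply: (mxnorm_fm_le HB) => [|v].
  by rewrite mulr_ge0 ?hm_mxnorm_ge0.
pose w k := v (k, l0).
rewrite (@eq_vn _ _ (self_module B) _ _
    (fun p : 'I_n * L => << h p.2, kact x w p.1 >>)); last first.
  move=> [i l]; rewrite /kact inner_sumr (sum_select (l0 := l0)) /=.
    by apply: eq_bigr => k _; rewrite eqxx mulr1n hm_innerM.
  by move=> k m /negPf ml; rewrite ml mulr0n cmul0l.
rewrite (le_trans (hK _ _))// -mulrA ler_wpM2l//.
rewrite (le_trans (hm_mxnorm_act HB _ _))// ler_wpM2l ?hm_mxnorm_ge0//.
by apply: (@vn_sub _ _ (self_module B) HB _ _ (fun k => (k, l0))) => i j [].
Qed.

(** The universal property is applied to the whole column at once, which keeps the constant [K];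
    bounding the entries separately would cost a factor depending on [L]. *)
Lemma column_map (L : finType) (l0 : L) (h : L -> E) (K : R) : 0 < K ->
  col_bound K h ->
  exists F : Q -> mat_space Y L, [/\ linear F,
    forall n (q : 'M[Q]_n), mn_norm (map_mx F q) <= K * mn_norm q
    & forall f y l m,
      F (ht_tens Q f y) (l, m) = om_act << h l, f >> y *+ (m == l0)].
Proof.
move=> K0 hK.
pose Phi (f : corr_bimodule E) (y : Y) : mat_space Y L :=
  [ffun p => om_act << h p.1, f >> y *+ (p.2 == l0)].
have PhiE f y l m : Phi f y (l, m) = om_act << h l, f >> y *+ (m == l0).
  by rewrite ffunE.
suff [F [linF FK FE]] : exists F : Q -> mat_space Y L, [/\ linear F,
    forall n (q : 'M[Q]_n), mn_norm (map_mx F q) <= K * mn_norm q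
    & forall f y, F (ht_tens Q f y) = Phi f y].
  by exists F; split=> // f y l m; rewrite FE PhiE.
apply: ht_extend => //.
- split=> [f c y z|y c f g]; apply/ffunP => -[l m]; rewrite !ffunE /=.
    by rewrite ((@om_act_bilinear R B Y).1 _) mulrnDl scalerMnr.
  by rewrite hm_inner_linear ((@om_act_bilinear R B Y).2 y) mulrnDl scalerMnr.
- move=> f b y; apply/ffunP => -[l m]; rewrite !ffunE /=.
  by rewrite hm_innerM om_actA.
- move=> n x y; pose a := fm (fun p r : 'I_n * L =>
    << h p.2, x p.1 r.1 >> *+ (r.2 == l0)).
  pose y' := fm (fun p r : 'I_n * L =>
    y p.1 r.1 *+ ((p.2 == l0) && (r.2 == l0))).
  apply: (@le_trans _ _ (mn_norm (mxbil (@om_act R B Y) a y'))).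
    rewrite -[leLHS]/(mn_norm (ampl (mxbil Phi x y))).
    apply: eq_ler; congr mn_norm.
    rewrite mxbil_fm; apply: eq_fm => -[i l] [j m] /=.
    rewrite (sum_select (l0 := l0)) /= => [|k g /negPf gl]; last first.
      by rewrite gl om_act0r.
    rewrite mxE sum_ffunE; apply: eq_bigr => k _.
    by rewrite !ffunE /= eqxx /= mulr1n om_actMnr.
  rewrite (le_trans (om_act_cc _ _))// mulrA; apply: ler_pM.
  - exact: mxnorm_ge0.
  - exact: mn_ge0.
  - exact: colker_norm (ltW K0) hK.
  - exact: mn_norm_pad.
Qed.

Definition is_eval (e : E) (F : Q -> Y) := [/\ linear F,
  exists c, forall q, norm1 (F q) <= c * norm1 q
  & forall f y, F (ht_tens Q f y) = om_act << e, f >> y].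

Lemma is_eval_unique e (F G : Q -> Y) : is_eval e F -> is_eval e G -> F = G.
Proof.
move=> [linF [c Fc] FE] [linG [d Gd] GE]; apply/funext.
by apply: (ht_ext linF Fc linG Gd) => f y; rewrite FE GE.
Qed.

Lemma norm1_mat (L : finType) (z : mat_space Y L) l m :
  norm1 (z (l, m)) <= norm1 z.
Proof.
pose a : 'I_(fcard ('I_1 * L)%type) := frank (ord0, l).
pose b : 'I_(fcard ('I_1 * L)%type) := frank (ord0, m).
apply: le_trans (norm1_entry (ampl (const_mx z : 'M[mat_space Y L]_1)) a b).
by rewrite amplE !mxE !frankK.
Qed.

Lemma norm1_map_mx (X Z : matNormed R) (F : X -> Z) (x : X) :
  norm1 (F x) = mn_norm (map_mx F (const_mx x : 'M[_]_1)).
Proof.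
by rewrite /norm1; congr mn_norm; apply/matrixP => i j; rewrite !mxE.
Qed.

Lemma column_map_eval (L : finType) (l0 : L) (h : L -> E) (K : R)
    (F : Q -> mat_space Y L) : linear F ->
  (forall n (q : 'M[Q]_n), mn_norm (map_mx F q) <= K * mn_norm q) ->
  (forall f y l m,
      F (ht_tens Q f y) (l, m) = om_act << h l, f >> y *+ (m == l0)) ->
  forall l, is_eval (h l) (fun q => F q (l, l0)).
Proof.
move=> linF FK FE l; split=> [c u v||f y].
- by rewrite linF !ffunE.
- exists K => q; rewrite (le_trans (norm1_mat _ _ _))//.
  by rewrite norm1_map_mx FK.
- by rewrite FE eqxx.
Qed.

Lemma eval_exists e : exists F, is_eval e F.
Proof.
(* The summand 1 keeps the constant positive when [e = 0], as [column_map] requires. *)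
have r1 : row_bound (hm_norm e + 1) (fun _ : 'I_1 => e).
  apply: row_bound_le (row_bound_crude HB _).
  by rewrite big_ord1 lerDl.
have c1 := row_to_col HB (addr_ge0 (hm_norm_ge0 e) ler01) r1.
have [|F [linF FK FE]] := column_map ord0 _ c1.
  by rewrite ltr_wpDl ?hm_norm_ge0.
by exists (fun q => F q (ord0, ord0)); exact: (column_map_eval linF FK FE ord0).
Qed.

(* The operator [f \otimes y |-> <e, f> y]. *)
Definition eval (e : E) : Q -> Y := xget (fun=> 0) [set F | is_eval e F].

Lemma evalP e : is_eval e (eval e).
Proof.
by rewrite /eval; case: xgetP => // h; have [F /h] := eval_exists e.
Qed.

Lemma eval_linear e : linear (eval e). Proof. by case: (evalP e). Qed.

Lemma eval_tens e f y : eval e (ht_tens Q f y) = om_act << e, f >> y.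
Proof. by case: (evalP e). Qed.

Lemma eval_unique e F : is_eval e F -> F = eval e.
Proof. by move=> /is_eval_unique/(_ (evalP e)). Qed.

Lemma eval_column n (L : finType) (l0 : L) (h : L -> E) (K : R) (q : 'M[Q]_n) :
  0 < K -> col_bound K h ->
  mn_norm (colmx l0 (fun i j l => eval (h l) (q i j))) <= K * mn_norm q.
Proof.
move=> K0 hK; have [F [linF FK FE]] := column_map l0 K0 hK.
have Feval l p : F p (l, l0) = eval (h l) p.
  by rewrite -(eval_unique (column_map_eval linF FK FE l)).
have F0 l m p : m != l0 -> F p (l, m) = 0.
  move=> ml; pose D p := F p (l, m).
  have DK v : norm1 (D v) <= K * norm1 v.
    by rewrite (le_trans (norm1_mat _ _ _))// norm1_map_mx FK.
  apply: (@total_linear_eq0 _ Q Y _ D K (@ht_dense R A B _ Y Q) _ DK).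
    by move=> c u v; rewrite /D linF !ffunE.
  by move=> _ [[f y] _ <-] /=; rewrite /D FE (negPf ml).
apply: le_trans (FK n q).
rewrite -[leRHS]/(mn_norm (ampl (map_mx F q))); apply: eq_ler.
congr mn_norm; apply: eq_fm => -[i l] [j m] /=; rewrite mxE -Feval.
by case: (eqVneq m l0) => [->|ml]; [rewrite mulr1n|rewrite mulr0n F0].
Qed.

Lemma eval_norm1 e q : norm1 (eval e q) <= (hm_norm e + 1) * norm1 q.
Proof.
have r1 : row_bound (hm_norm e + 1) (fun _ : 'I_1 => e).
  apply: row_bound_le (row_bound_crude HB _).
  by rewrite big_ord1 lerDl.
have e1 : 0 < hm_norm e + 1 by rewrite ltr_wpDl ?hm_norm_ge0.
have c1 := row_to_col HB (ltW e1) r1.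
apply: le_trans (eval_column ord0 (const_mx q : 'M[_]_1) e1 c1).
apply: le_trans (norm1_entry _ (frank (ord0, ord0)) (frank (ord0, ord0))).
by rewrite [colmx _ _ _ _]mxE !frankK /= mxE.
Qed.

(** Here and in the next lemmas [is_eval] determines [eval], so the identity is checked on
    elementary tensors once the candidate is known to be bounded. *)
Lemma evalD e f q : eval (e + f) q = eval e q + eval f q.
Proof.
rewrite -(@eval_unique (e + f) (fun q => eval e q + eval f q))//.
split=> [c u v||g y].
- by rewrite !eval_linear scalerDr addrACA.
- exists ((hm_norm e + 1) + (hm_norm f + 1)) => p.
  by rewrite (le_trans (norm1D _ _))// mulrDl lerD ?eval_norm1.
- by rewrite !eval_tens innerDl ((linD ((@om_act_bilinear R B Y).2 y))).
Qed.

Lemma evalZ c e q : eval (c *: e) q = c^* *: eval e q.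
Proof.
rewrite -(@eval_unique (c *: e) (fun q => c^* *: eval e q))//.
split=> [d u v||g y].
- by rewrite !eval_linear scalerDr !scalerA mulrC.
- exists (Normc.normc (c^*) * (hm_norm e + 1)) => p.
  by rewrite norm1Z -mulrA ler_wpM2l ?normc_ge0 ?eval_norm1.
- by rewrite !eval_tens innerZl (linZ ((@om_act_bilinear R B Y).2 y)).
Qed.

Lemma eval_act e b q : eval (hm_act e b) q = om_act (st b) (eval e q).
Proof.
rewrite -(@eval_unique (hm_act e b) (fun q => om_act (st b) (eval e q)))//.
split=> [d u v||g y].
- by rewrite eval_linear ((@om_act_bilinear R B Y).1 _).
- exists (cs_mxnorm (const_mx (st b) : 'M[B]_1) * (hm_norm e + 1)) => p.
  rewrite (le_trans (norm1_act _ _))// -mulrA.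
  by rewrite ler_wpM2l ?eval_norm1 ?mxnorm_ge0.
- by rewrite !eval_tens innerMl om_actA.
Qed.

Lemma eval_co_act e a q : eval (co_act E (st a) e) q = eval e (om_act a q).
Proof.
rewrite -(@eval_unique (co_act E (st a) e) (fun q => eval e (om_act a q)))//.
split=> [d u v||g y].
- by rewrite ((@om_act_bilinear R A Q).1 _) eval_linear.
- exists ((hm_norm e + 1) * cs_mxnorm (const_mx a : 'M[A]_1)) => p.
  rewrite (le_trans (eval_norm1 _ _))// -mulrA ler_wpM2l ?norm1_act//.
  by rewrite addr_ge0 ?hm_norm_ge0.
- rewrite ht_lact eval_tens; congr om_act.
  by rewrite /= co_act_star cs_starK.
Qed.

Lemma frame_tens_norm1 (L : finType) (l0 : L) (g h : L -> E) (K K' : R) q :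
  0 <= K -> 0 < K' -> row_bound K g -> col_bound K' h ->
  norm1 (\sum_l ht_tens Q (g l) (eval (h l) q)) <= K * K' * norm1 q.
Proof.
move=> K0 K'0 gK hK'.
have := row_tens_le HB Q l0 (fun (i j : 'I_1) l => eval (h l) q) K0 gK.
rewrite (_ : \matrix_(_, _) _ =
  const_mx (\sum_l ht_tens Q (g l) (eval (h l) q))); last first.
  by apply/matrixP => i j; rewrite !mxE.
move=> /le_trans; apply; rewrite -mulrA ler_wpM2l//.
have := eval_column l0 (const_mx q : 'M[_]_1) K'0 hK'.
rewrite (_ : colmx _ _ = colmx l0 (fun (i j : 'I_1) l => eval (h l) q))//.
by apply: eq_fm => p r; rewrite mxE.
Qed.

Lemma tens_dense (q : Q) (d : R) : 0 < d -> exists s : seq (E * Y),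
  norm1 (q - \sum_(p <- s) ht_tens Q p.1 p.2) < d.
Proof.
move=> /(ht_dense q)[n [c [s [sS sd]]]].
have ex i : exists p : E * Y, ht_tens Q p.1 p.2 = s i.
  by have [p _ <-] := sS i; exists p.
have [f fE] := choice ex.
exists [seq (c i *: (f i).1, (f i).2) | i <- index_enum 'I_n].
rewrite big_map (eq_bigr (fun i => c i *: s i))// => i _ /=.
by rewrite (linZ ((ht_bilinear Q).2 _)) fE.
Qed.

(** A frame for the first factors reproduces finitely many elementary tensors, because
    [g <h, f> (x) y = g (x) <h, f> y]. Density extends this to all of [Q], since the frame sums are
    bounded by [3 * 3] for every frame. *)
Lemma frame_approx (T : finType) (q : T -> Q) (d : R) : 0 < d ->
  exists (L : finType) (l0 : L) (g h : L -> E),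
    [/\ row_bound 3 g, row_bound 3 h, col_bound 3 h & forall t,
      norm1 (q t - \sum_l ht_tens Q (g l) (eval (h l) (q t))) <= d].
Proof.
move=> d0; have d1 : 0 < d / 2 by rewrite divr_gt0.
(* [10 = 1 + 9]: the remainder [q t - q'] counts once for itself and up to 9 times under the frame
   sum. *)
have ex t : exists s : seq (E * Y),
    norm1 (q t - \sum_(p <- s) ht_tens Q p.1 p.2) < d / 2 / 10.
  by apply: tens_dense; rewrite divr_gt0.
have [s sq] := choice ex.
pose S := flatten [seq s t | t <- enum T].
pose W := \sum_t \sum_(p <- s t) norm1 p.2.
have Ws t : \sum_(p <- s t) norm1 p.2 <= W.
  rewrite /W (bigD1 t)//= lerDl sumr_ge0// => i _; rewrite sumr_ge0// => p _.
  exact: norm1_ge0.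
have W0 : 0 <= W.
  by rewrite sumr_ge0// => t _; rewrite sumr_ge0// => p _; exact: norm1_ge0.
have W1 : 0 < 1 + W by rewrite ltr_wpDr.
have [L [l0 [g [h [g3 h3 gh]]]]] := frame_exists HB
  (fun j : 'I_(size S) => (nth (0, 0) S j).1) (divr_gt0 d1 W1).
exists L, l0, g, h; have r3 := col_to_row HB (ler0n R 3) g3.
split=> //; first exact: col_to_row.
move=> t; pose q' := \sum_(p <- s t) ht_tens Q p.1 p.2.
have gh' p : p \in s t ->
    hm_norm (p.1 - \sum_l hm_act (g l) << h l, p.1 >>) <= d / 2 / (1 + W).
  move=> ps; have pS : p \in S.
    by apply/flattenP; exists (s t) => //; apply/map_f; rewrite mem_enum.
  have iS : (index p S < size S)%N by rewrite index_mem.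
  by have := gh (Ordinal iS); rewrite /= nth_index.
pose G q := \sum_l ht_tens Q (g l) (eval (h l) q).
have GD u v : G (u - v) = G u - G v.
  rewrite /G -sumrB; apply: eq_bigr => l _.
  by rewrite (linB (eval_linear _)) (linB ((ht_bilinear Q).1 _)).
have Gt f y : G (ht_tens Q f y) =
    ht_tens Q (\sum_l hm_act (g l) << h l, f >>) y.
  rewrite tens_suml; apply: eq_bigr => l _.
  by rewrite eval_tens -(ht_balanced Q).
have q'G : norm1 (q' - G q') <= d / 2.
  have -> : q' - G q' = \sum_(p <- s t)
      ht_tens Q (p.1 - \sum_l hm_act (g l) << h l, p.1 >>) p.2.
    rewrite /q' /G.
    have -> : \sum_l ht_tens Q (g l) (eval (h l)
        (\sum_(p <- s t) ht_tens Q p.1 p.2)) =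
        \sum_(p <- s t) G (ht_tens Q p.1 p.2).
      rewrite /G exchange_big; apply: eq_bigr => l _ /=.
      by rewrite (lin_sum (eval_linear _)) tens_sumr.
    rewrite -sumrB; apply: eq_bigr => p _.
    by rewrite Gt tensB.
  rewrite (le_trans (norm1_sum _ _ _))//.
  apply: (@le_trans _ _ (\sum_(p <- s t) d / 2 / (1 + W) * norm1 p.2)).
    rewrite big_seq [leRHS]big_seq; apply: ler_sum => p ps.
    by rewrite (le_trans (norm1_tens HB _ _ _))// ler_wpM2r ?norm1_ge0// gh'.
  rewrite -mulr_sumr mulrAC ler_pdivrMr// ler_wpM2l ?(ltW d1)//.
  by rewrite (le_trans (Ws t))// lerDr.
have -> : q t - G (q t) = (q t - q') - G (q t - q') + (q' - G q').
  by rewrite GD opprB addrACA subrK [_ - G _ - _]addrAC subrr add0r.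
rewrite (le_trans (norm1D _ _))// [leRHS](splitr d) lerD//.
rewrite (le_trans (norm1B _ _))//.
have := frame_tens_norm1 l0 (q t - q') (ler0n R 3) (ltr0Sn R 2) r3 h3.
have := ltW (sq t); rewrite -/q' -/(G _).
set x := norm1 _; set y := norm1 (G _); move=> hx hy.
by move: hx hy; lra.
Qed.

(* Haagerup's norm sees [(e, q) |-> <e, q>] as completely bounded: insert a
   frame and factor through the columns [(<h_l, q>)_l]. *)
Lemma eval_cb n (e : 'M[E]_n) (q : 'M[Q]_n) :
  mn_norm (mxbil eval e q) <= 9 * (hm_mxnorm e^T * mn_norm q).
Proof.
(* The frame approximates the entries of [q] one at a time. [W] bounds how much these errors grow
   under [eval] and summation, and the precision [d / (1 + W)] makes up for it. *)
pose W := \sum_i \sum_(j < n) \sum_k (hm_norm (e i k) + 1).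
have W0 : 0 <= W.
  do 3![apply: sumr_ge0 => ? _].
  by rewrite addr_ge0 ?hm_norm_ge0.
have W1 : 0 < 1 + W by rewrite ltr_wpDr.
apply/ler_addgt0Pr => d d0.
have [L [l0 [g [h [g3 h3 h3' gh]]]]] :=
  frame_approx (fun t : 'I_n * 'I_n => q t.1 t.2) (divr_gt0 d0 W1).
pose G p := \sum_l ht_tens Q (g l) (eval (h l) p).
pose y i j := \sum_k eval (e i k) (G (q k j)).
pose b := fm (fun p r : 'I_n * L => << e p.1 r.1, g r.2 >> *+ (p.2 == l0)).
pose z := colmx l0 (fun i j l => eval (h l) (q i j)).
have yE : mn_norm (\matrix_(i, j) y i j) <= 9 * (hm_mxnorm e^T * mn_norm q).
  apply: (@le_trans _ _ (mn_norm (mxbil (@om_act R B Y) b z))).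
    rewrite mxbil_fm.
    apply: le_trans (mn_norm_corner (f := fun i => (i, l0)) _ _); last first.
      by move=> i j [].
    apply: eq_ler; congr mn_norm.
    apply/matrixP => i j; rewrite !mxE sum_pair; apply: eq_bigr => k _.
    rewrite (lin_sum (eval_linear _)); apply: eq_bigr => l _.
    by rewrite eval_tens /= eqxx !mulr1n.
  apply: le_trans (om_act_cc _ _) _.
  rewrite (_ : 9 * _ = (3 * hm_mxnorm e^T) * (3 * mn_norm q)); last by ring.
  apply: ler_pM; [exact: mxnorm_ge0|exact: mn_ge0| |exact: eval_column].
  apply: (mxnorm_fm_le HB) => [|v]; first by rewrite mulr_ge0 ?hm_mxnorm_ge0.
  pose x k := \sum_l hm_act (g l) (v (k, l)).
  (* The transpose in the norm of [E^*] enters here: [<w, w> = <e^T w, x>], so [w] is at most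
     [hm_mxnorm e^T * vn x]. *)
  pose w i := \sum_k << e i k, x k >>.
  apply: (@le_trans _ _ (bn w)).
    rewrite -(@vn_pad _ _ (self_module B) _ _ l0 w).
    apply: eq_ler.
    apply: (@eq_vn _ _ (self_module B)) => -[i l].
    rewrite /kact /= sum_pair /w -sumrMnl; apply: eq_bigr => k _.
    rewrite /x inner_sumr -sumrMnl; apply: eq_bigr => m _.
    by rewrite cmulMnl hm_innerM.
  rewrite mulrC mulrA.
  have xv : vn x <= bn v * 3.
    rewrite mulrC (le_trans (g3 _ (fun k l => v (k, l))))//.
    rewrite ler_wpM2l//; apply: eq_ler.
    by apply: (@eq_vn _ _ (self_module B)) => -[].
  apply: (@le_trans _ _ (vn x * hm_mxnorm e^T)); last first.
    by rewrite ler_wpM2r ?hm_mxnorm_ge0.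
  apply: sqr_le_cancel; first by rewrite mulr_ge0 ?vn_ge0 ?hm_mxnorm_ge0.
  rewrite vn_sq (_ : @vip _ _ (self_module B) _ w w = vip (kact e^T w) x).
    rewrite (le_trans (vip_le HB _ _))// mulrC -mulrA ler_wpM2l ?vn_ge0//.
    exact: hm_mxnorm_act.
  rewrite /vip /kact /=; under eq_bigr => i _ do rewrite {2}/w cmul_sumr.
  rewrite exchange_big; apply: eq_bigr => k _ /=; rewrite inner_suml.
  by apply: eq_bigr => i _; rewrite innerMl mxE.
have -> : mxbil eval e q = (mxbil eval e q - \matrix_(i, j) y i j) +
    \matrix_(i, j) y i j by rewrite subrK.
rewrite (le_trans (mn_normD _ _))// addrC lerD//.
rewrite (le_trans (mn_norm_le_sum _))//.
apply: (@le_trans _ _ (W * (d / (1 + W)))); last first.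
  by rewrite mulrA ler_pdivrMr// mulrC ler_wpM2l ?(ltW d0)// lerDr.
rewrite /W mulr_suml; apply: ler_sum => i _; rewrite mulr_suml.
apply: ler_sum => j _; rewrite !mxE /y -sumrB mulr_suml.
rewrite (le_trans (norm1_sum _ _ _))//; apply: ler_sum => k _.
rewrite -(linB (eval_linear _)) (le_trans (eval_norm1 _ _))//.
by rewrite ler_wpM2l ?addr_ge0 ?hm_norm_ge0//; exact: (gh (k, j)).
Qed.

(** The frame sums approximating [p - q] are built from its evaluations, hence vanish. *)
Lemma eval_inj (p q : Q) : (forall e, eval e p = eval e q) -> p = q.
Proof.
move=> pq; apply/eqP; rewrite -subr_eq0; apply/eqP/norm1_small0 => d d0.
have [L [l0 [g [h [_ _ _ gh]]]]] := frame_approx (fun _ : 'I_1 => p - q) d0.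
have := gh ord0; rewrite big1 ?subr0// => l _.
by rewrite (linB (eval_linear _)) pq subrr (lin0 ((ht_bilinear Q).1 _)).
Qed.

End EvaluationMaps.

Lemma cb_bound (R : realType) (X Y : matNormed R) (T : X -> Y) :
  completely_bounded T -> exists2 c : R, 0 < c &
    forall (n : nat) (x : 'M[X]_n), mn_norm (map_mx T x) <= c * mn_norm x.
Proof.
move=> [c Tc]; exists (Num.max c 1); first by rewrite lt_max ltr01 orbT.
by move=> n x; rewrite (le_trans (Tc _ _))// ler_wpM2r ?mn_ge0// le_max lexx.
Qed.

Lemma cb_comp (R : realType) (A : cstarAlgebra R) (X Y Z : opModule A)
    (S : X -> Y) (T : Y -> Z) :
  cb_module_maps X Y S -> cb_module_maps Y Z T -> cb_module_maps X Z (T \o S).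
Proof.
move=> [linS /cb_bound[c c0 Sc] Sa] [linT /cb_bound[d d0 Td] Ta]; split.
- by move=> k u v; rewrite /= linS linT.
- exists (d * c) => n x; rewrite map_mx_comp (le_trans (Td _ _))// -mulrA.
  by rewrite ler_wpM2l ?(ltW d0).
- by move=> a x; rewrite /= Sa Ta.
Qed.

(** * The adjunction *)

Section Adjunction.
Variables (R : realType) (A B : cstarAlgebra R) (E : correspondence A B).
Hypothesis HB : has_mxnorms B.
Local Notation "<< e , f >>" := (hm_inner e f).
Variables (X : opModule A) (Y : opModule B).
Variables (P : haagerupTensor (adj_bimodule E) X).
Variables (Q : haagerupTensor (corr_bimodule E) Y).

Definition mates (S : P -> Y) (T : X -> Q) :=
  forall (e : E) x, S (ht_tens P e x) = eval e (T x).

Lemma mates_uniquer S T T' : mates S T -> mates S T' -> T = T'.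
Proof.
move=> ST ST'; apply/funext => x; apply: (eval_inj HB) => e.
by rewrite -ST ST'.
Qed.

Lemma mates_uniquel S S' T : cb_module_maps P Y S -> cb_module_maps P Y S' ->
  mates S T -> mates S' T -> S = S'.
Proof.
move=> [linS [c Sc] _] [linS' [d S'd] _] ST S'T; apply/funext.
apply: (ht_ext linS (norm1_map Sc) linS' (norm1_map S'd)) => e x.
by rewrite ST S'T.
Qed.

Lemma mates_existsl T : cb_module_maps X Q T ->
  exists2 S, cb_module_maps P Y S & mates S T.
Proof.
move=> [linT /cb_bound[c c0 Tc] Ta].
pose Phi (e : adj_bimodule E) (x : X) : Y := eval (e : E) (T x).
have [S [linS Sc SE]] : exists S : P -> Y, [/\ linear S,
    forall n (p : 'M[P]_n), mn_norm (map_mx S p) <= (9 * c) * mn_norm p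
    & forall e x, S (ht_tens P e x) = Phi e x].
  apply: ht_extend; first by rewrite mulr_gt0.
  - split=> [e k u v|x k e f]; rewrite /Phi.
      by rewrite linT (eval_linear HB).
    (* Scalars of [conj_space E] act through their conjugates, and [evalZ] conjugates once more. *)
    rewrite (evalD HB) (evalZ HB); congr (_ *: _ + _).
    exact: conjcK.
  - by move=> e a x; rewrite /Phi (eval_co_act HB) Ta.
  - move=> n e x.
    have -> : mxbil Phi e x =
        mxbil (@eval _ _ _ _ _ Q) (e : 'M[E]_n) (map_mx T x).
      by apply/matrixP => i j; rewrite !mxE; apply: eq_bigr => k _; rewrite mxE.
    rewrite (le_trans (eval_cb HB _ _))// -mulrA ler_wpM2l//.
    by rewrite mulrCA ler_wpM2l ?hm_mxnorm_ge0.
have linY b : linear (@om_act R B Y b) by apply: (@om_act_bilinear R B Y).1.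
exists S => //; split=> //; first by exists (9 * c).
move=> b.
apply: (@ht_ext _ _ _ _ _ P Y (fun p => S (om_act b p))
  (fun p => om_act b (S p)) (9 * c * cs_mxnorm (const_mx b : 'M[B]_1))
  (cs_mxnorm (const_mx b : 'M[B]_1) * (9 * c))).
- by move=> k u v; rewrite ((@om_act_bilinear R B P).1 _) linS.
- move=> p; rewrite (le_trans (norm1_map Sc _))// -[leRHS]mulrA.
  rewrite ler_wpM2l ?norm1_act//.
  by rewrite mulr_ge0 ?(ltW c0).
- by move=> k u v; rewrite linS ((@om_act_bilinear R B Y).1 _).
- move=> p; rewrite (le_trans (norm1_act _ _))// -[leRHS]mulrA ler_wpM2l//.
    exact: mxnorm_ge0.
  exact: norm1_map.
- move=> e x; rewrite ht_lact !SE /Phi /= (eval_act HB).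
  by rewrite cs_starK.
Qed.

(** * Construction of [T] from [S] *)

Section FromLeft.
Variable S : P -> Y.
Hypothesis linS : linear S.
Hypothesis Sact : forall b p, S (om_act b p) = om_act b (S p).
Variable c : R.
Hypothesis c0 : 0 < c.
Hypothesis Sc : forall n (p : 'M[P]_n), mn_norm (map_mx S p) <= c * mn_norm p.

Let s (e : E) (x : X) : Y := S (ht_tens P e x).

Let sB e f x : s (e - f) x = s e x - s f x.
Proof. by rewrite /s (linB ((ht_bilinear P).2 x)) (linB linS). Qed.

Let s_suml (I : Type) (r : seq I) (p : pred I) (F : I -> E) x :
  s (\sum_(i <- r | p i) F i) x = \sum_(i <- r | p i) s (F i) x.
Proof. by rewrite /s (lin_sum ((ht_bilinear P).2 x)) (lin_sum linS). Qed.

Let s_lin e : linear (s e).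
Proof. by move=> k u v; rewrite /s ((ht_bilinear P).1 e) linS. Qed.

Let s_act e b x : s (hm_act e b) x = om_act (st b) (s e x).
Proof. by rewrite /s -Sact ht_lact /= cs_starK. Qed.

Let s_co e a x : s (co_act E (st a) e) x = s e (om_act a x).
Proof. exact: (congr1 S (ht_balanced P e a x)). Qed.

(** The matrix is the image under [S] of a product of a column over [E^*] with [x]. The norm of
    [E^*] transposes, so that column has the norm of the row [h] over [E]. *)
Let s_column n (L : finType) (l0 : L) (h : L -> E) (K : R) (x : 'M[X]_n) :
  0 <= K -> row_bound K h ->
  mn_norm (colmx l0 (fun i j l => s (h l) (x i j))) <= c * (K * mn_norm x).
Proof.
move=> K0 hK.
pose hm : 'M[adj_space E]_(fcard ('I_n * L)%type) :=
  fm (fun p r : 'I_n * L => h p.2 *+ ((p.1 == r.1) && (r.2 == l0))).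
pose xp : 'M[X]_(fcard ('I_n * L)%type) :=
  fm (fun p r : 'I_n * L => x p.1 r.1 *+ ((p.2 == l0) && (r.2 == l0))).
have -> : colmx l0 (fun i j l => s (h l) (x i j)) =
    map_mx S (mxbil (ht_tens P) hm xp).
  rewrite mxbil_fm map_fm; apply: eq_fm => -[i l] [j m] /=.
  rewrite (sum_select (l0 := l0)) /= => [|k g /negPf gl]; last first.
    by rewrite gl (lin0 ((ht_bilinear P).1 _)).
  rewrite (bigD1 i)//= big1 ?addr0 => [|k ki].
    rewrite !eqxx /= mulr1n (linMn ((ht_bilinear P).1 _)) (linMn linS).
    by [].
  by rewrite eq_sym (negPf ki) mulr0n (lin0 ((ht_bilinear P).2 _)).
rewrite (le_trans (Sc _))// ler_wpM2l ?(ltW c0)//.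
rewrite (le_trans (ht_cc P _ _))//; apply: ler_pM.
- exact: mn_ge0.
- exact: mn_ge0.
- rewrite /= /adj_mxnorm (_ : (hm^T : 'M[E]__) = fm (rowker (n := n) l0 h)).
    exact: rowker_norm.
  by apply/matrixP => a b; rewrite !mxE /rowker eq_sym.
- exact: mn_norm_pad.
Qed.

(* [q] solves [eval e q = s e x] for all [e] up to the completely bounded
   error [d]. *)
Let defect (x : X) (q : Q) (d : R) :=
  forall (L : finType) (l0 : L) (h : L -> E) (K : R), 0 < K -> row_bound K h ->
  mn_norm (colmx l0 (fun (i j : 'I_1) l => eval (h l) q - s (h l) x)) <= d * K.

Let eval0 e : eval e (0 : Q) = 0. Proof. exact: (lin0 (eval_linear HB e)). Qed.

(** With [defectD], this and [defect_x0] make the defect vary continuously with [x] and with [q]. *)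
Let defect_q0 x : defect x 0 (c * norm1 x).
Proof.
move=> L l0 h K K0 hK.
have := s_column l0 (const_mx x : 'M[X]_1) (ltW K0) hK.
rewrite (_ : colmx l0 (fun (i j : 'I_1) l => eval (h l) 0 - s (h l) x) =
  - colmx l0 (fun (i j : 'I_1) l => s (h l) ((const_mx x : 'M[X]_1) i j))).
  by rewrite mn_normN mulrAC mulrA.
by apply/matrixP => a b; rewrite !mxE eval0 sub0r mulNrn.
Qed.

Let defect_x0 q : defect 0 q (norm1 q).
Proof.
move=> L l0 h K K0 hK; have hK' := row_to_col HB (ltW K0) hK.
have := eval_column HB l0 (const_mx q : 'M[Q]_1) K0 hK'.
rewrite (_ : colmx l0 (fun (i j : 'I_1) l => eval (h l) q - s (h l) 0) =
  colmx l0 (fun (i j : 'I_1) l => eval (h l) ((const_mx q : 'M[Q]_1) i j))).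
  by rewrite mulrC.
by apply: eq_fm => p r; rewrite mxE (lin0 (s_lin _)) subr0.
Qed.

Let defectD x q d x' q' d' : defect x q d -> defect x' q' d' ->
  defect (x + x') (q + q') (d + d').
Proof.
move=> h1 h2 L l0 h K K0 hK; rewrite mulrDl.
apply: le_trans (lerD (h1 L l0 h K K0 hK) (h2 L l0 h K K0 hK)).
apply: le_trans (mn_normD _ _); apply: eq_ler.
congr mn_norm; apply/matrixP => a b; rewrite !mxE -mulrnDl; congr (_ *+ _).
by rewrite (linD (eval_linear HB _)) (linD (s_lin _)) opprD addrACA.
Qed.

Let defectZ k x q d : defect x q d -> defect (k *: x) (k *: q) (normc k * d).
Proof.
move=> h1 L l0 h K K0 hK; rewrite -mulrA.
apply: le_trans (ler_wpM2l (normc_ge0 k) (h1 L l0 h K K0 hK)).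
rewrite -mn_normZ; apply: eq_ler.
congr mn_norm; apply/matrixP => a b; rewrite !mxE -scalerMnr; congr (_ *+ _).
by rewrite (linZ (eval_linear HB _)) (linZ (s_lin _)) scalerBr.
Qed.

Let defect_le x q d d' : d <= d' -> defect x q d -> defect x q d'.
Proof.
move=> dd' h1 L l0 h K K0 hK; rewrite (le_trans (h1 L l0 h K K0 hK))//.
by rewrite ler_wpM2r ?(ltW K0).
Qed.

Let defect_sum n (x : 'I_n -> X) q d : (forall i, defect (x i) (q i) (d i)) ->
  defect (\sum_i x i) (\sum_i q i) (\sum_i d i).
Proof.
move=> h; elim/big_rec3: _ => [|i d1 q1 x1 _ h1]; last exact: defectD.
by apply: defect_le (defect_x0 0); rewrite norm10.
Qed.

(** For [q = \sum_i u_i (x) s v_i x] the error at [h] is [s (T h) x], where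
    [T = \sum_i v_i <u_i, .> - a^*]. Compactness makes the adjoint [T'] small, hence also [T], and
    [row_bound_adjoint] makes the whole row of vectors [T h_l] small. *)
Let defect_act (E_compact : forall a : A, hm_compact (co_act E a)) a x d :
  0 < d -> exists q, defect (om_act a x) q d.
Proof.
(* With [t = d / m] the resulting error [t * c * norm1 x] is at most [d]; the summand 1 keeps [m]
   positive. *)
move=> d0; pose m := c * (norm1 x + 1).
have m0 : 0 < m by rewrite mulr_gt0// ltr_wpDl ?norm1_ge0.
pose t := d / m; have t0 : 0 < t by rewrite divr_gt0.
have [n [u [v uv]]] := E_compact a t t0.
pose T e := finrank v u e - co_act E (st a) e.
pose T' e := finrank u v e - co_act E a e.
have coL b : linear (co_act E b) := (@co_act_bilinear R A B E).1 b.
have T'T : hm_adjoint T' T.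
  move=> e f; rewrite /T /T' innerDl innerNl innerDr innerNr finrank_adjoint.
  by rewrite co_act_star.
have TT' : hm_adjoint T T'.
  by move=> e f; rewrite -[LHS]hm_inner_sym -T'T hm_inner_sym.
have T't e : hm_norm (T' e) <= t * hm_norm e.
  by rewrite -hm_normN opprB; exact: uv.
have Tt := adjoint_bound HB T'T (ltW t0) T't.
have linT : linear T.
  by move=> k e f; rewrite /T finrank_linear coL scalerBr opprD addrACA.
have Tact e b : T (hm_act e b) = hm_act (T e) b.
  rewrite /T finrank_act; have [_ _ ->] := @co_act_bounded R A B E (st a).
  by rewrite -[- _]scaleN1r -actZl scaleN1r -actDl.
exists (\sum_i ht_tens Q (u i) (s (v i) x)) => L l0 h K K0 hK.
have TK := row_bound_adjoint HB (ltW t0) (ltW K0) linT Tact TT' Tt hK.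
have := s_column l0 (const_mx x : 'M[X]_1) (mulr_ge0 (ltW t0) (ltW K0)) TK.
rewrite (_ : colmx _ _ = colmx l0 (fun (i j : 'I_1) l => eval (h l)
    (\sum_i ht_tens Q (u i) (s (v i) x)) - s (h l) (om_act a x))).
  move=> /le_trans; apply; rewrite -[mn_norm _]/(norm1 x).
  rewrite (_ : c * _ = (t * (c * norm1 x)) * K); last by ring.
  rewrite ler_wpM2r ?(ltW K0)// /t mulrAC ler_pdivrMr// ler_wpM2l ?(ltW d0)//.
  by rewrite /m ler_wpM2l ?(ltW c0)// lerDl.
apply: eq_fm => p r; rewrite mxE; congr (_ *+ _).
rewrite /T sB s_co; congr (_ - _); rewrite (lin_sum (eval_linear HB _)) s_suml.
by apply: eq_bigr => i _; rewrite (eval_tens HB) s_act hm_inner_sym.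
Qed.

(** [q] is close to a frame sum, that is, to the row [g] of norm 3 applied to a column of
    evaluations, which the defect at [K = 3] bounds by [3 d]. *)
Let defect_small q d : defect 0 q d -> norm1 q <= 9 * d.
Proof.
move=> qd; apply/ler_addgt0Pr => e e0.
have [L [l0 [g [h [g3 h3 _ gh]]]]] := frame_approx HB (fun _ : 'I_1 => q) e0.
set G := \sum_l ht_tens Q (g l) (eval (h l) q).
have := norm1D (q - G) G; rewrite subrK => /le_trans; apply.
rewrite addrC lerD ?(gh ord0)//.
have := row_tens_le HB Q l0 (fun (i j : 'I_1) l => eval (h l) q - s (h l) 0)
  (ler0n R 3) g3.
rewrite (_ : \matrix_(_, _) _ = const_mx G).
  move=> /le_trans; apply; rewrite (_ : 9 * d = 3 * (d * 3)); last by ring.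
  by rewrite ler_wpM2l//; exact: qd.
apply/matrixP => i j; rewrite !mxE; apply: eq_bigr => l _.
by rewrite (lin0 (s_lin _)) subr0.
Qed.

Hypothesis E_compact : forall a : A, hm_compact (co_act E a).

(** Nondegeneracy of [X] puts [x] close to combinations of elements [a x'], which [defect_act]
    solves; the remainder is solved by 0. *)
Let defect_exists x d : 0 < d -> exists q, defect x q d.
Proof.
move=> d0; have d1 : 0 < d / 2 by rewrite divr_gt0.
have d2 : 0 < d / 2 / c by rewrite divr_gt0.
have [n [k [y [yS yd]]]] := @om_nondegenerate R A X x _ d2.
pose W := \sum_i normc (k i).
have W0 : 0 <= W by rewrite sumr_ge0// => i _; exact: normc_ge0.
have W1 : 0 < 1 + W by rewrite ltr_wpDr.
have ex i : exists q, defect (y i) q (d / 2 / (1 + W)).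
  by have [[a z] _ <-] := yS i; apply: defect_act => //; rewrite divr_gt0.
have [q qP] := choice ex.
exists (\sum_i k i *: q i).
have h1 := defect_sum (fun i => defectZ (k i) (qP i)).
have := defectD (defect_q0 (x - \sum_i k i *: y i)) h1.
rewrite subrK add0r; apply: defect_le.
rewrite [leRHS](splitr d) lerD//.
  by rewrite mulrC -ler_pdivlMr// ltW.
rewrite -mulr_suml -/W mulrA ler_pdivrMr// mulrC ler_wpM2l ?(ltW d1)//.
by rewrite lerDr.
Qed.

(** Two approximate solutions for the same [x] differ by one for 0, so [defect_small] makes a
    sequence of them Cauchy. *)
Let defect_zero x : exists q, forall d, 0 < d -> defect x q d.
Proof.
have ex (n : nat) : exists q, defect x q (n.+1%:R^-1).
  by apply: defect_exists; rewrite invr_gt0.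
have [q qP] := choice ex.
have qB m n : norm1 (q m - q n) <= 9 * (m.+1%:R^-1 + n.+1%:R^-1).
  apply: defect_small; have := defectZ (-1) (qP n).
  rewrite normcN1 mul1r !scaleN1r => /(defectD (qP m)).
  by rewrite subrr.
have small (e : R) : 0 < e -> exists n0 : nat, forall n, (n0 <= n)%N ->
    n.+1%:R^-1 < e.
  move=> e0; exists (Num.bound (e^-1)) => n hn.
  rewrite invf_plt ?posrE//.
  apply: (@lt_le_trans _ _ (Num.bound (e^-1))%:R).
    by apply: archi_boundP; rewrite invr_ge0 ltW.
  by rewrite ler_nat (leq_trans hn).
case: (os_axioms Q) => /(_ 1%N)[_ _ _ QC] _ _.
have [|l lP] := QC (fun n => const_mx (q n)).
  (* [18 = 9 * 2]: [qB] multiplies the sum of two errors by 9. *)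
  move=> e e0; have [n0 n0P] := small (e / 18) (divr_gt0 e0 (ltr0Sn R 17)).
  exists n0 => m n mn nn.
  rewrite (_ : const_mx (q m) - const_mx (q n) = const_mx (q m - q n)).
    apply: le_lt_trans (qB m n) _.
    apply: (@lt_le_trans _ _ (9 * (e / 18 + e / 18))); last by lra.
    by rewrite ltr_pM2l// ltrD ?n0P.
  by apply/matrixP => i j; rewrite !mxE.
exists (l 0 0) => d d0; have d2 : 0 < d / 2 by rewrite divr_gt0.
have [n0 n0P] := small _ d2.
have [n1 n1P] : exists n1 : nat, forall n, (n1 <= n)%N ->
    norm1 (l 0 0 - q n) < d / 2.
  have /cvgrPdist_lt/(_ _ d2)[n1 _ n1P] := lP; exists n1 => n /n1P /=.
  rewrite sub0r normrN ger0_norm ?mn_ge0//.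
  rewrite (_ : const_mx (q n) - l = const_mx (- (l 0 0 - q n))).
    by rewrite -[mn_norm _]/(norm1 (- (l 0 0 - q n))) norm1N.
  by apply/matrixP => i j; rewrite !mxE (ord1 i) (ord1 j) opprB.
pose n := maxn n0 n1.
have := defectD (defect_x0 (l 0 0 - q n)) (qP n).
rewrite add0r subrK; apply: defect_le; rewrite [leRHS](splitr d).
by rewrite lerD// ltW// ?n1P ?n0P ?leq_maxl ?leq_maxr.
Qed.

Let solution_exists x : exists q : Q, forall e, eval e q = s e x.
Proof.
have [q qP] := defect_zero x; exists q => e; apply/eqP; rewrite -subr_eq0.
apply/eqP/norm1_small0 => d d0.
have K0 : 0 < hm_norm e + 1 by rewrite ltr_wpDl ?hm_norm_ge0.
have eK : row_bound (hm_norm e + 1) (fun _ : 'I_1 => e).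
  apply: row_bound_le (row_bound_crude HB _).
  by rewrite big_ord1 lerDl.
have := qP (d / (hm_norm e + 1)) (divr_gt0 d0 K0) _ ord0 _ _ K0 eK.
rewrite divfK ?gt_eqF// => /(le_trans _); apply.
apply: le_trans (norm1_entry _ (frank (ord0, ord0)) (frank (ord0, ord0))).
by rewrite [colmx _ _ _ _]mxE !frankK.
Qed.

Lemma mate_of_left : exists2 T, cb_module_maps X Q T & mates S T.
Proof.
have [T TP] := choice solution_exists.
exists T; last by move=> e x; rewrite TP.
split.
- move=> k x y; apply: (eval_inj HB) => e.
  by rewrite (eval_linear HB) !TP s_lin.
(* In the frame sum for [T x] the row [g] costs 3 and the column [eval (h l) (T x) = s (h l) x]
   costs [3 * c] by [s_column]. The error is shared among the [n * n] entries. *)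
- exists (9 * c) => n x; apply/ler_addgt0Pr => d d0.
  have n1 : 0 < 1 + (n * n)%:R :> R by rewrite ltr_wpDr.
  have [L [l0 [g [h [g3 h3 _ gh]]]]] :=
    frame_approx HB (fun t : 'I_n * 'I_n => T (x t.1 t.2)) (divr_gt0 d0 n1).
  pose G := \matrix_(i, j) \sum_l ht_tens Q (g l) (eval (h l) (T (x i j))).
  rewrite -[map_mx T x](subrK G) (le_trans (mn_normD _ _))// addrC lerD//.
    apply: le_trans (row_tens_le HB Q l0 _ (ler0n R 3) g3) _.
    rewrite (_ : colmx _ _ = colmx l0 (fun i j l => s (h l) (x i j))).
      rewrite (_ : 9 * c = 3 * (c * 3)); last by ring.
      by rewrite -mulrA ler_wpM2l// -mulrA s_column.
    by apply: eq_fm => p r; rewrite TP.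
  rewrite (le_trans (mn_norm_le_sum _))//.
  apply: (@le_trans _ _ (\sum_(i < n) \sum_(j < n) d / (1 + (n * n)%:R))).
    apply: ler_sum => i _; apply: ler_sum => j _; rewrite !mxE.
    exact: (gh (i, j)).
  rewrite !sumr_const !card_ord -mulrnA -[leLHS]mulr_natl mulrA ler_pdivrMr//.
  by rewrite mulrC ler_wpM2l ?(ltW d0)// lerDr.
- move=> a x; apply: (eval_inj HB) => e.
  by rewrite TP -(eval_co_act HB) TP s_co.
Qed.

End FromLeft.

Lemma mates_existsr (E_compact : forall a : A, hm_compact (co_act E a)) S :
  cb_module_maps P Y S -> exists2 T, cb_module_maps X Q T & mates S T.
Proof.
move=> [linS /cb_bound[c c0 Sc] Sact].
exact: (mate_of_left linS Sact c0 Sc E_compact).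
Qed.

End Adjunction.

(** Reduces to [g (eval e q) = eval e (tensor_map Q Q' g q)], which on elementary tensors is the
    [B]-linearity of [g]. *)
Lemma mates_natural (R : realType) (A B : cstarAlgebra R)
    (E : correspondence A B) (HB : has_mxnorms B)
    (X X' : opModule A) (Y Y' : opModule B)
    (P : haagerupTensor (adj_bimodule E) X)
    (P' : haagerupTensor (adj_bimodule E) X')
    (Q : haagerupTensor (corr_bimodule E) Y)
    (Q' : haagerupTensor (corr_bimodule E) Y')
    (f : X' -> X) (g : Y -> Y') (S : P -> Y) (T : X -> Q) :
  cb_module_maps X' X f -> cb_module_maps Y Y' g -> mates S T ->
  mates (g \o S \o tensor_map P' P f) (tensor_map Q Q' g \o T \o f).
Proof.
move=> fP gP ST e x /=.
have [_ ->] := tensor_mapP P' P fP; rewrite ST.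
have [[linG /cb_bound[d d0 Gd] _] GE] := tensor_mapP Q Q' gP.
have [ling /cb_bound[k k0 gk] gB] := gP.
have e1 : 0 <= hm_norm e + 1 by rewrite addr_ge0 ?hm_norm_ge0.
apply: (@ht_ext _ _ _ _ _ Q Y' (fun q => g (eval e q))
  (fun q => eval e (tensor_map Q Q' g q)) (k * (hm_norm e + 1))
  ((hm_norm e + 1) * d)).
- by move=> a u v; rewrite (eval_linear HB) ling.
- move=> q; rewrite (le_trans (norm1_map gk _))// -mulrA ler_wpM2l ?(ltW k0)//.
  exact: eval_norm1.
- by move=> a u v; rewrite linG (eval_linear HB).
- move=> q; rewrite (le_trans (eval_norm1 HB _ _))// -mulrA ler_wpM2l//.
  exact: norm1_map.
- by move=> h y; rewrite GE !(eval_tens HB) gB.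
Qed.

(** The product of the constant matrices of [m] and [y] has entries [n] times [m (x) y], so the
    elementary tensors vanish, and they are total. *)
Lemma ht_trivial (R : realType) (A B : cstarAlgebra R) (M : matBimodule A B)
    (Y : opModule B) (Q : haagerupTensor M Y) (n : nat) : (0 < n)%N ->
  (forall x : 'M[M]_n, mn_norm x = 0) -> forall q : Q, q = 0.
Proof.
move=> n0 M0 q; have T0 m y : ht_tens Q m y = 0.
  have := ht_cc Q (const_mx m : 'M[M]_n) (const_mx y); rewrite M0 mul0r => h.
  have /mn_norm_eq0/matrixP/(_ (Ordinal n0) (Ordinal n0)) :
      mn_norm (mxbil (ht_tens Q) (const_mx m : 'M[M]_n) (const_mx y)) = 0.
    by apply/eqP; rewrite eq_le h mn_ge0.
  rewrite !mxE (eq_bigr (fun=> ht_tens Q m y)) => [|k _]; last by rewrite !mxE.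
  rewrite sumr_const card_ord -scaler_nat => /eqP; rewrite scaler_eq0.
  by rewrite pnatr_eq0 eqn0Ngt n0 => /eqP.
apply: (@ht_ext _ _ _ _ _ Q Q id (fun=> 0) 1 1) => //.
- by move=> x; rewrite mul1r.
- by move=> k u v; rewrite scaler0 addr0.
- by move=> x; rewrite norm10 mul1r norm1_ge0.
Qed.

(** On matrices of size 0 the zero function is a C*-norm. So a size without one is positive, and
    there [xget] returns its default 0. *)
Lemma mxnorm0_of_none (R : realType) (B : cstarAlgebra R) : ~ has_mxnorms B ->
  exists2 n, (0 < n)%N & forall b : 'M[B]_n, cs_mxnorm b = 0.
Proof.
move=> /existsNP[n nP]; have none (N : 'M[B]_n -> R) : ~ is_cs_mxnorm N.
  move=> NP; apply: nP; rewrite /cs_mxnorm; case: xgetP => [N' _ //|/(_ N)].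
  by [].
exists n; last by move=> b; rewrite /cs_mxnorm xgetPN.
case: n nP none => // _ none; exfalso; apply: (none (fun=> 0)).
split; last by case.
split=> [|a b|a]; rewrite ?mul0r ?expr0n//.
split=> [x _|x y|k x|u _]; rewrite ?addr0 ?mulr0//.
- by apply/matrixP => -[].
- by exists 0; exact: cvg_cst.
Qed.

Lemma cb_module_maps0 (R : realType) (A : cstarAlgebra R) (X Y : opModule A) :
  cb_module_maps X Y (fun=> 0).
Proof.
split=> [k u v||a x]; rewrite ?scaler0 ?addr0 ?om_act0r//.
exists 0 => n x; rewrite mul0r (_ : map_mx _ _ = 0) ?mn_norm0//.
by apply/matrixP => i j; rewrite !mxE.
Qed.

Theorem theorem2p17 (R : realType) (A B : cstarAlgebra R)
    (E : correspondence A B)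
    (E_compact : forall a : A, hm_compact (co_act E a)) :
  exists Theta : forall (X : opModule A) (Y : opModule B)
      (P : haagerupTensor (adj_bimodule E) X)
      (Q : haagerupTensor (corr_bimodule E) Y),
      (P -> Y) -> (X -> Q),
    (forall (X : opModule A) (Y : opModule B)
        (P : haagerupTensor (adj_bimodule E) X)
        (Q : haagerupTensor (corr_bimodule E) Y),
       set_bij (cb_module_maps P Y) (cb_module_maps X Q) (Theta X Y P Q)) /\
    (forall (X X' : opModule A) (Y Y' : opModule B)
        (P : haagerupTensor (adj_bimodule E) X)
        (P' : haagerupTensor (adj_bimodule E) X')
        (Q : haagerupTensor (corr_bimodule E) Y)
        (Q' : haagerupTensor (corr_bimodule E) Y')
        (f : X' -> X) (g : Y -> Y') (S : P -> Y),
       cb_module_maps X' X f -> cb_module_maps Y Y' g ->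
       cb_module_maps P Y S ->
       Theta X' Y' P' Q' (g \o S \o tensor_map P' P f)
         = tensor_map Q Q' g \o Theta X Y P Q S \o f).
Proof.
(* If some matrix norm is missing, [P] and [Q] are zero spaces and both sets of maps consist of the
   zero map. *)
have [HB|nHB] := pselect (has_mxnorms B); last first.
  have [n n0 nB] := mxnorm0_of_none nHB.
  have P0 X (P : haagerupTensor (adj_bimodule E) X) (p : P) : p = 0.
    apply: (ht_trivial n0) => x; apply/eqP.
    by rewrite /= /adj_mxnorm /hm_mxnorm nB sqrtr0.
  have Q0 Y (Q : haagerupTensor (corr_bimodule E) Y) (q : Q) : q = 0.
    by apply: (ht_trivial n0) => x; rewrite /= /hm_mxnorm nB sqrtr0.
  exists (fun _ _ _ _ _ _ => 0); split=> [X Y P Q|*]; last first.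
    by apply/funext => x; rewrite [RHS]Q0.
  split=> [S _|S S' /set_mem[linS _ _] /set_mem[linS' _ _] _|T _].
  - exact: cb_module_maps0.
  - by apply/funext => p; rewrite (P0 _ _ p) (lin0 linS) (lin0 linS').
  - exists (fun=> 0); first exact: cb_module_maps0.
    by apply/funext => x; rewrite [RHS]Q0.
(* [Theta] picks the mate of [S]. Mates determine each other, which gives injectivity, surjectivity
   and, with [mates_natural], naturality. *)
pose Theta X Y (P : haagerupTensor (adj_bimodule E) X)
    (Q : haagerupTensor (corr_bimodule E) Y) (S : P -> Y) : X -> Q :=
  xget (fun=> 0) [set T | cb_module_maps X Q T /\ mates S T].
have ThetaP X Y (P : haagerupTensor (adj_bimodule E) X)
    (Q : haagerupTensor (corr_bimodule E) Y) (S : P -> Y) :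
    cb_module_maps P Y S ->
    cb_module_maps X Q (Theta X Y P Q S) /\ mates S (Theta X Y P Q S).
  move=> /(mates_existsr HB Q E_compact)[T TP ST].
  by rewrite /Theta; case: xgetP => [T' _ //|/(_ T)[]].
exists Theta; split=> [X Y P Q|X X' Y Y' P P' Q Q' f g S fP gP SP].
  split=> [S SP|S S' /set_mem SP /set_mem S'P SS'|T TP].
    by case: (ThetaP _ _ _ Q _ SP).
    have [_ m] := ThetaP _ _ _ Q _ SP; have [_ m'] := ThetaP _ _ _ Q _ S'P.
    by apply: (mates_uniquel SP S'P m); rewrite SS'.
  have [S SP ST] := mates_existsl HB P TP; exists S => //.
  have [_ m] := ThetaP _ _ _ Q _ SP.
  exact: (mates_uniquer HB m ST).
have [TP ST] := ThetaP _ _ _ Q _ SP.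
have [FP _] := tensor_mapP P' P fP.
have [_ m] := ThetaP _ _ P' Q' _ (cb_comp (cb_comp FP SP) gP).
exact: (mates_uniquer HB m (mates_natural HB P' Q' fP gP ST)).
Qed.
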